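(* Let $(X,\mu,d)$ be a Calderón--Zygmund space, with family $\mathcal R$ of Calderón--Zygmund sets, which satisfies condition (C). For all $1<p<\infty$ the space $BMO_p$ is the dual of $H^{1,p'}$, where $p'=p/(p-1)$.
   Context: **Calderón--Zygmund spaces.** Let $(X,\mu,d)$ be a metric measured space, $\mathcal R$ a family of subsets of $X$ and $\kappa_0>0$. $(X,\mu,d)$ is a Calderón--Zygmund space with constant $\kappa_0$ (and family $\mathcal R$ of Calderón--Zygmund sets) if: (i) for every $R\in\mathcal R$ there exists $r>0$ such that $R$ is contained in a ball of radius at most $\kappa_0r$ and $\mu(R^* )\le\kappa_0\,\mu(R)$, where $R^*=\{x\in X:d(x,R)<r\}$; (ii) for every $f\in L^1(\mu)$ and $\alpha>\kappa_0\|f\|_{L^1(\mu)}/\mu(X)$ ($\alpha>0$ if $\mu(X)=\infty$) there is a decomposition $f=g+\sum_{i\in\mathbb N}b_i$ such that: $|g|\le\kappa_0\alpha$ $\mu$-a.e.; each $b_i$ is supported in a set $R_i\in\mathcal R$ and $\int b_i\,d\mu=0$; $\|b_i\|_{L^1(\mu)}\le\kappa_0\,\alpha\,\mu(R_i)$; $\sum_i\mu(R_i)\le\kappa_0\|f\|_{L^1(\mu)}/\alpha$. **Condition (C).** There exists a subfamily $\mathcal R'\subseteq\mathcal R$ such that: (i) if $R_1,R_2\in\mathcal R'$ and $R_1\cap R_2\ne\emptyset$, then $R_1\subseteq R_2$ or $R_2\subseteq R_1$; (ii) every $R\in\mathcal R$ is contained in some $R'\in\mathcal R'$. **Hardy spaces.**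 For $1<q<\infty$, a $(1,q)$-atom is a function $a\in L^1(\mu)$ supported in a set $R\in\mathcal R$ with $\big(\frac1{\mu(R)}\int_R|a|^q\,d\mu\big)^{1/q}\le\mu(R)^{-1}$ and $\int a\,d\mu=0$. $H^{1,q}$ is the space of all $f\in L^1(\mu)$ of the form $f=\sum_j\lambda_ja_j$, with $a_j$ $(1,q)$-atoms and $\lambda_j\in\mathbb C$, $\sum_j|\lambda_j|<\infty$; $\|f\|_{H^{1,q}}$ is the infimum of $\sum_j|\lambda_j|$ over all such decompositions. **BMO spaces.** For $1<p<\infty$, $BMO_p$ is the quotient, modulo constant functions, of the space of all $f\in L^p_{\rm loc}(\mu)$ such that $$\|f\|_{BMO_p}=\sup_{R\in\mathcal R}\Big(\frac1{\mu(R)}\int_R|f-f_R|^p\,d\mu\Big)^{1/p}<\infty,\qquad f_R=\frac1{\mu(R)}\int_Rf\,d\mu.$$ **Pairing.** The element $f$ of $BMO_p$ corresponds to the functional $\ell_f$ given by $\ell_f(g)=\int_X f\,g\,d\mu$ for finite linear combinations $g$ of $(1,p')$-atoms (which are dense in $H^{1,p'}$).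
   Formalization: Functions giving the same functional are those whose difference has zero BMO_p seminorm, not only constants (false e.g. for two points with singletons as CZ sets); μ is σ-finite; L^p_loc means p-integrable on each CZ set; decompositions may have finitely many terms. *)

(* Defs.v *)
From HB Require Import structures.
From mathcomp Require Import all_boot all_order all_algebra.
From mathcomp Require Import complex.
From mathcomp Require Import all_classical all_reals all_analysis.

Set Implicit Arguments.
Unset Strict Implicit.
Unset Printing Implicit Defensive.

Import Order.TTheory GRing.Theory Num.Theory.
Import numFieldNormedType.Exports.

Local Open Scope classical_set_scope.
Local Open Scope ring_scope.

(* A carrier with a metric and a sigma-algebra; that open sets are measurable
   is a separate hypothesis of the theorem. *)
#[short(type="metricMeasurableType")]
HB.structure Definition MetricMeasurable (d : measure_display) (R : realType) :=
  { X of Measurable d X & Metric R X }.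

Section calderon_zygmund_spaces.
Context {R : realType} {d : measure_display} {X : metricMeasurableType d R}.
Context (mu : {measure set X -> \bar R}).
Local Notation C := R[i].
Local Notation normc := Normc.normc.

Implicit Types (f g : X -> C) (A : set X) (p q : R).

Definition cmeasurable_fun f : Prop :=
  measurable_fun setT (fun x => complex.Re (f x)) /\
  measurable_fun setT (fun x => complex.Im (f x)).

Definition L1 f : Prop :=
  mu.-integrable setT (fun x => (complex.Re (f x))%:E) /\
  mu.-integrable setT (fun x => (complex.Im (f x))%:E).

Definition cintegral A f : C :=
  Complex (\int[mu]_(x in A) complex.Re (f x))
          (\int[mu]_(x in A) complex.Im (f x)).

Definition L1_norm f : \bar R := (\int[mu]_x (normc (f x))%:E)%E.

Definition supported_in f A : Prop := {ae mu, forall x, ~ A x -> f x = 0}.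

(* [f = \sum_i u i], the series converging in L^1. *)
Definition L1_sum (u : nat -> X -> C) f : Prop :=
  (fun n => L1_norm (fun x => f x - \sum_(i < n) u i x)) @ \oo --> 0%E.

(* {x | d(x, A) < r} *)
Definition enlargement A (r : R) : set X :=
  [set x | (ereal_inf [set (mdist x y)%:E | y in A] < r%:E)%E].

(* The index set of the decomposition is at most countable: [Q i = set0] (which
   forces [b i = 0] a.e.) stands for an absent term.  Without this, a space such
   as a finite set with counting measure would have no decompositions, all
   members of [RR] having measure bounded below. *)
Definition calderon_zygmund_decomposition (kappa0 : R) (RR : set (set X))
    f (alpha : R) : Prop :=
  exists (g : X -> C) (b : nat -> X -> C) (Q : nat -> set X),
    [/\ L1 g /\ (forall i, L1 (b i)),
        L1_sum b (fun x => f x - g x),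
        {ae mu, forall x, normc (g x) <= kappa0 * alpha},
        forall i, [/\ RR (Q i) \/ Q i = set0,
                      supported_in (b i) (Q i),
                      cintegral setT (b i) = 0 &
                      (L1_norm (b i) <= (kappa0 * alpha)%:E * mu (Q i))%E]
      & (\sum_(0 <= i <oo) mu (Q i) <= (kappa0 / alpha)%:E * L1_norm f)%E].

Record calderon_zygmund (kappa0 : R) (RR : set (set X)) : Prop := {
  cz_constant_gt0 : 0 < kappa0 ;
  (* implicit in the use of averages over members of [RR] *)
  cz_sets : forall A, RR A ->
    [/\ measurable A, (0 < mu A)%E & (mu A < +oo)%E] ;
  cz_enlargement : forall A, RR A -> exists r : R,
    [/\ 0 < r,
        exists (x : X) (rho : R), rho <= kappa0 * r /\ A `<=` ball x rho
      & (mu (enlargement A r) <= kappa0%:E * mu A)%E] ;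
  cz_decomposition : forall f (alpha : R), L1 f -> 0 < alpha ->
    ((mu setT < +oo)%E -> kappa0 * fine (L1_norm f) / fine (mu setT) < alpha) ->
    calderon_zygmund_decomposition kappa0 RR f alpha }.

Definition condition_C (RR : set (set X)) : Prop :=
  exists RR' : set (set X),
    [/\ RR' `<=` RR,
        forall A B, RR' A -> RR' B -> A `&` B !=set0 -> A `<=` B \/ B `<=` A
      & forall A, RR A -> exists2 A', RR' A' & A `<=` A'].

Context (RR : set (set X)).

(** Atomic Hardy spaces *)

Definition atom q (a : X -> C) : Prop :=
  L1 a /\ cintegral setT a = 0 /\
  exists A, [/\ RR A, supported_in a A &
    ((((fine (mu A))^-1)%:E * \int[mu]_(x in A) (normc (a x) `^ q)%:E) `^ q^-1
      <= ((fine (mu A))^-1)%:E)%E].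

(* Finite (and empty) sums are included: terms with [lam j = 0] are absent. *)
Definition atomic_decomposition q f (lam : nat -> C) (a : nat -> X -> C)
  : Prop :=
  [/\ L1 f,
      forall j, lam j != 0 -> atom q (a j),
      (\sum_(0 <= j <oo) (normc (lam j))%:E < +oo)%E
    & L1_sum (fun j x => lam j * a j x) f].

Definition H1 q : set (X -> C) :=
  [set f | exists lam a, atomic_decomposition q f lam a].

Definition H1_norm q f : \bar R :=
  ereal_inf [set s | exists lam a, atomic_decomposition q f lam a /\
    s = (\sum_(0 <= j <oo) (normc (lam j))%:E)%E].

Definition finite_atomic q : set (X -> C) :=
  [set g | exists n (lam : 'I_n -> C) (a : 'I_n -> X -> C),
    (forall j, atom q (a j)) /\ g = (fun x => \sum_(j < n) lam j * a j x)].

(* Bounded linear functionals on H^{1,q}.  Functions stand for their classes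
   modulo a.e. equality, which a bounded linear [l] respects since the H^{1,q}
   norm does; the values of [l] outside [H1 q] are irrelevant, so two functionals
   are the same when they agree on [H1 q]. *)
Definition H1_dual q (l : (X -> C) -> C) : Prop :=
  (forall (c : C) f g, H1 q f -> H1 q g ->
     l (fun x => c * f x + g x) = c * l f + l g) /\
  exists M : R, forall g, H1 q g ->
    ((normc (l g))%:E <= M%:E * H1_norm q g)%E.

Definition H1_dual_norm q (l : (X -> C) -> C) : \bar R :=
  ereal_sup [set (normc (l g))%:E | g in H1 q `&` [set g | (H1_norm q g <= 1)%E]].

(** BMO spaces *)

Definition average A f : C := cintegral A f / (real_complex _ (fine (mu A))).

(* Local p-integrability is understood on the members of [RR], which is what the
   averages and the seminorm below require. *)
Definition Lp_loc p f : Prop :=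
  cmeasurable_fun f /\
  forall A, RR A -> (\int[mu]_(x in A) (normc (f x) `^ p)%:E < +oo)%E.

(* [maxe 0] only matters when [RR] is empty: the supremum is taken in [0, +oo]. *)
Definition BMO_norm p f : \bar R :=
  maxe 0%E (ereal_sup [set
    ((((fine (mu A))^-1)%:E *
       \int[mu]_(x in A) (normc (f x - average A f) `^ p)%:E) `^ p^-1)%E
    | A in RR]).

Definition BMO p : set (X -> C) :=
  [set f | Lp_loc p f /\ (BMO_norm p f < +oo)%E].

Definition eq_mod_constants f g : Prop :=
  exists c : C, {ae mu, forall x, f x - g x = c}.

(* [l] is given by g |-> \int f g on finite linear combinations of atoms. *)
Definition represents q f (l : (X -> C) -> C) : Prop :=
  forall g, finite_atomic q g ->
    L1 (fun x => f x * g x) /\ l g = cintegral setT (fun x => f x * g x).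

End calderon_zygmund_spaces.

(* Main.v *)
(** A function [f] of BMO need not be integrable against [g = \sum_j lam_j a_j] in
    H^{1,p'}, so the pairing is the limit of the integrals of [g] against the
    truncations of [f] at height [n].  A truncation is bounded, hence can be
    integrated term by term against the L^1-convergent series; it oscillates no
    more than [f], hence the [j]-th term is O(|lam_j| ||f||) uniformly in [n].  By
    Tannery's theorem the limit exists and equals [\sum_j lam_j \int f a_j]; in
    particular this sum does not depend on the decomposition.

    Conversely, a bounded functional restricts to the mean-zero L^{p'} functions on
    a set [A] of the family, where Radon-Nikodym represents it by an L^p function
    unique up to a constant.  In the family of condition (C), intersecting sets are
    comparable, so "contained in a common member" is an equivalence relation and
    distinct classes do not meet; fixing the constants by a zero average over one
    set per class makes the local densities agree on overlaps, and sigma-finiteness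
    reduces the gluing to countably many of them. *)
Require Import Defs.
From HB Require Import structures.
From mathcomp Require Import all_boot all_order all_algebra.
From mathcomp Require Import complex.
From mathcomp Require Import all_classical all_reals all_analysis.
From mathcomp Require Import measurable_realfun.
From mathcomp Require Import ring lra.
Set Implicit Arguments.
Unset Strict Implicit.
Unset Printing Implicit Defensive.
Import Order.TTheory GRing.Theory Num.Theory.
Import numFieldNormedType.Exports.
Local Open Scope classical_set_scope.
Local Open Scope ring_scope.

(** * Power integrals and a crude Hoelder inequality *)

(** The estimates concern real-valued functions on one set A of measure m, with norms kept as
    integrals of powers: an atom b satisfies int |b|^q <= m^(1-q), and oscillation at most D reads
    int |u - mean|^p <= D^p m. Complex functions enter through their two parts; this and a crude
    Hoelder inequality cost factors that end up in the 32 of the norm equivalence. Two obstacles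
    shape the converse. Radon-Nikodym yields a merely integrable density, so its L^p bound has to
    come from testing it against the extremal function of Hoelder's inequality. And the functional
    is controlled only on mean-zero functions, to which indicators do not belong; it is extended to
    L^q(A) by subtracting means first, which enlarges norms at most 8 times. Dually, oscillation is
    controlled by mean-zero tests. That one estimate gives the lower norm bound, the kernel of the
    pairing and, with bound zero, the constancy of the difference of two local densities. *)

Section power_integrals.
Context d (T : measurableType d) (R : realType) (mu : {measure set T -> \bar R}).
Implicit Types (A : set T) (f g u v : T -> R) (r c : R).
Local Notation integ A f := (mu.-integrable A (fun x => (f x)%:E)).

Lemma integrable_le A f g : measurable A -> measurable_fun setT f ->
  (forall x, A x -> `|f x| <= g x) -> integ A g -> integ A f.
Proof.
move=> mA mf fg; apply: le_integrable => //.
- by apply/measurable_EFinP; exact: measurable_funTS.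
- move=> x Ax /=; rewrite lee_fin (le_trans (fg x Ax))// ler_norm//.
Qed.

Lemma Rintegrable_add A f g : measurable A -> integ A f -> integ A g ->
  integ A (fun x => f x + g x).
Proof. by move=> mA i_f ig; have := integrableD mA i_f ig. Qed.

Lemma Rintegrable_mull A c f : measurable A -> integ A f ->
  integ A (fun x => c * f x).
Proof. by move=> mA i_f; have := integrableZl mA c i_f. Qed.

Lemma Rintegrable_norm A f : integ A f -> integ A (fun x => `|f x|).
Proof. by move=> i_f; have := integrable_norm i_f. Qed.

Lemma Rintegrable_cst A c : measurable A -> (mu A < +oo)%E -> integ A (cst c).
Proof.
move=> mA muA.
apply: (measurable_bounded_integrable mA muA); first exact: measurable_cst.
by exists `|c|; split; [exact: num_real | move=> M cM x Ax; exact: ltW].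
Qed.

Lemma Rintegral_dominated_convergence A (f_ : nat -> T -> R) f g : measurable A ->
  (forall n, measurable_fun setT (f_ n)) -> measurable_fun setT f ->
  (forall x, A x -> f_ n x @[n --> \oo] --> f x) ->
  integ A g -> (forall n x, A x -> `|f_ n x| <= g x) ->
  integ A f /\ \int[mu]_(x in A) f_ n x @[n --> \oo] --> \int[mu]_(x in A) f x.
Proof.
move=> mA mf_ mf f_f ig fg.
have [||||| intf _ cf] := @dominated_convergence _ _ _ mu A mA
  (fun n x => (f_ n x)%:E) (fun x => (f x)%:E) (fun x => (g x)%:E).
- by move=> n; apply/measurable_EFinP; exact: measurable_funTS.
- by apply/measurable_EFinP; exact: measurable_funTS.
- by apply: aeW => x Ax; apply: cvg_EFin; [exact: nearW|exact: f_f].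
- exact: ig.
- by apply: aeW => x n Ax /=; rewrite lee_fin fg.
split => //.
apply: fine_cvg; rewrite /Rintegral fineK//.
exact: integrable_fin_num.
Qed.

(** Root-free power of the L^r norm on A. Being a real number it is 0 when the integral is infinite,
    so a bound on it is informative only together with [in_Lp]. *)
Definition powint A r f : R := \int[mu]_(x in A) (`|f x| `^ r).

(** Measurability is asked on the whole space and integrability only on A, so that one global
    function can lie in the L^r spaces of many sets. *)
Definition in_Lp A r f : Prop :=
  measurable_fun setT f /\ integ A (fun x => `|f x| `^ r).

Lemma measurable_norm_powR f r : measurable_fun setT f ->
  measurable_fun setT (fun x => `|f x| `^ r).
Proof.
move=> mf; apply: (@measurableT_comp _ _ _ _ _ _ (fun y : R => y `^ r)).
  exact: measurable_powR.
exact: measurableT_comp.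
Qed.

Lemma powint_ge0 A r f : 0 <= powint A r f.
Proof. by apply: Rintegral_ge0 => x _; exact: powR_ge0. Qed.

(** A sum is at most twice its larger term in absolute value; this crude bound stands in for
    Minkowski's inequality throughout. *)
Lemma powR_norm_add (x y r : R) : 0 < r ->
  `|x + y| `^ r <= 2 `^ r * (`|x| `^ r + `|y| `^ r).
Proof.
move=> r0; have lr a b : 0 <= a -> a <= b -> a `^ r <= b `^ r.
  by move=> a0 ab; apply: ge0_ler_powR; rewrite ?nnegrE ?(ltW r0) ?(le_trans a0 ab).
wlog xy : x y / `|x| <= `|y|.
  move=> h; case: (leP `|x| `|y|) => [|/ltW] /h//.
  by rewrite addrC [_ `^ _ + _ in X in _ -> X]addrC.
apply: (@le_trans _ _ ((2 * `|y|) `^ r)).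
  apply: lr => //; apply: (le_trans (ler_normD _ _)).
  by rewrite mulr2n mulrDl mul1r lerD2r.
by rewrite powRM// ler_wpM2l ?powR_ge0// lerDr powR_ge0.
Qed.

Lemma in_Lp_le A r f g : measurable A -> 0 < r -> measurable_fun setT f ->
  (forall x, A x -> `|f x| <= `|g x|) -> in_Lp A r g -> in_Lp A r f.
Proof.
move=> mA r0 mf fg [mg ig]; split => //.
apply: (integrable_le _ _ _ ig) => //; first exact: measurable_norm_powR.
move=> x Ax; rewrite ger0_norm ?powR_ge0//.
by apply: ge0_ler_powR; rewrite ?nnegrE ?(ltW r0)//; exact: fg.
Qed.

Lemma in_LpD A r f g : measurable A -> 0 < r -> in_Lp A r f -> in_Lp A r g ->
  in_Lp A r (fun x => f x + g x).
Proof.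
move=> mA r0 [mf i_f] [mg ig].
have mfg : measurable_fun setT (fun x => f x + g x) by exact: measurable_funD.
split => //; apply: (@integrable_le _ _
    (fun x => 2 `^ r * (`|f x| `^ r + `|g x| `^ r))) => //.
- exact: measurable_norm_powR.
- by move=> x Ax; rewrite ger0_norm ?powR_ge0//; exact: powR_norm_add.
- by apply: Rintegrable_mull => //; exact: Rintegrable_add.
Qed.

Lemma powintD A r f g : measurable A -> 0 < r -> in_Lp A r f -> in_Lp A r g ->
  powint A r (fun x => f x + g x) <= 2 `^ r * (powint A r f + powint A r g).
Proof.
move=> mA r0 lf lg; have [_ ifg] := in_LpD mA r0 lf lg.
case: lf lg => mf i_f [mg ig].
have i_s : integ A (fun x => `|f x| `^ r + `|g x| `^ r) by exact: Rintegrable_add.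
rewrite /powint -RintegralD// -RintegralZl//; apply: le_Rintegral => //.
  exact: Rintegrable_mull.
by move=> x Ax; exact: powR_norm_add.
Qed.

Lemma in_LpZ A r c f : measurable A -> in_Lp A r f -> in_Lp A r (fun x => c * f x).
Proof.
move=> mA [mf i_f]; split; first exact: measurable_funM.
under eq_fun do rewrite normrM powRM//.
exact: Rintegrable_mull.
Qed.

Lemma powintZ A r c f : measurable A -> in_Lp A r f ->
  powint A r (fun x => c * f x) = `|c| `^ r * powint A r f.
Proof.
move=> mA [mf i_f]; rewrite /powint -RintegralZl//.
by apply: eq_Rintegral => x _; rewrite normrM powRM.
Qed.

Lemma in_LpB A r f g : measurable A -> 0 < r -> in_Lp A r f -> in_Lp A r g ->
  in_Lp A r (fun x => f x - g x).
Proof.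
move=> mA r0 lf lg.
have := in_LpD mA r0 lf (in_LpZ (-1) mA lg).
by under eq_fun do rewrite mulN1r.
Qed.

Lemma powintB A r f g : measurable A -> 0 < r -> in_Lp A r f -> in_Lp A r g ->
  powint A r (fun x => f x - g x) <= 2 `^ r * (powint A r f + powint A r g).
Proof.
move=> mA r0 lf lg.
have := powintD mA r0 lf (in_LpZ (-1) mA lg).
rewrite powintZ// normrN normr1 powR1 mul1r.
by rewrite (_ : (fun x => f x + -1 * g x) = (fun x => f x - g x))//;
  apply/funext => x; rewrite mulN1r.
Qed.

Lemma in_Lp_bounded A r c f : measurable A -> (mu A < +oo)%E -> 0 < r ->
  measurable_fun setT f -> (forall x, A x -> `|f x| <= c) -> in_Lp A r f.
Proof.
move=> mA muA r0 mf fc.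
apply: (@in_Lp_le _ _ _ (cst c)) => //.
  by move=> x Ax; rewrite (le_trans (fc x Ax))// ler_norm.
split; [exact: measurable_cst | exact: (Rintegrable_cst (`|c| `^ r) mA muA)].
Qed.

Lemma powint_cst A r c : measurable A -> powint A r (cst c) = `|c| `^ r * fine (mu A).
Proof. by move=> mA; exact: (Rintegral_cst mu mA (`|c| `^ r)). Qed.

Lemma in_Lp_sub A B r f : measurable A -> measurable B -> A `<=` B ->
  in_Lp B r f -> in_Lp A r f.
Proof. by move=> mA mB AB [mf i_f]; split => //; exact: integrableS i_f. Qed.

(** * Conjugate exponents: the inequalities of Young and Hoelder *)

Section conjugate_exponents.
Context (p q : R) (p0 : 0 < p) (q0 : 0 < q) (pq : p^-1 + q^-1 = 1).

Lemma conj_exponent_ge1 : 1 <= p /\ 1 <= q.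
Proof.
split; rewrite -invf_le1// -pq ?lerDl ?lerDr ?invr_ge0 ltW//.
Qed.

(** The weights 1/p and 1/q of the sharp inequality are at most 1 and are dropped. *)
Lemma young (a b : R) : 0 <= a -> 0 <= b -> a * b <= a `^ p + b `^ q.
Proof.
move=> a0 b0; apply: (le_trans (conjugate_powR a0 b0 p0 q0 pq)).
have [p1 q1] := conj_exponent_ge1.
by apply: lerD; rewrite ler_piMr ?powR_ge0// invf_le1.
Qed.

Lemma in_Lp_mul A u v : measurable A -> in_Lp A p u -> in_Lp A q v ->
  integ A (fun x => u x * v x).
Proof.
move=> mA [mu_ iu] [mv iv].
apply: (@integrable_le _ _ (fun x => `|u x| `^ p + `|v x| `^ q)) => //.
- exact: measurable_funM.
- by move=> x Ax; rewrite normrM young.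
- exact: Rintegrable_add.
Qed.

Lemma in_Lp_integrable A u : measurable A -> (mu A < +oo)%E -> in_Lp A p u ->
  integ A u.
Proof.
move=> mA muA lu.
have := @in_Lp_mul A u (cst 1) mA lu.
under eq_fun do rewrite mulr1; apply.
by apply: (@in_Lp_bounded _ _ 1) => // x _; rewrite normr1.
Qed.

(* The constant 2 comes from using Young's inequality on [u / D] and [m * v]. *)
Lemma hoelder_normalized A u v (D m : R) : measurable A -> 0 < D -> 0 < m ->
  in_Lp A p u -> in_Lp A q v -> powint A p u <= D `^ p * m ->
  powint A q v <= m `^ (1 - q) -> \int[mu]_(x in A) `|u x * v x| <= 2 * D.
Proof.
move=> mA D0 m0 lu lv hu hv.
have iuv := in_Lp_mul mA lu lv.
have Di : 0 < D^-1 by rewrite invr_gt0.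
have h : \int[mu]_(x in A) (m / D * `|u x * v x|) <=
    \int[mu]_(x in A) (D^-1 `^ p * `|u x| `^ p + m `^ q * `|v x| `^ q).
  apply: le_Rintegral => //.
  - apply: Rintegrable_mull => //; exact: (Rintegrable_norm iuv).
  - apply: Rintegrable_add => //; apply: Rintegrable_mull => //;
      [exact: lu.2|exact: lv.2].
  - move=> x Ax; rewrite -!powRM ?(ltW Di) ?(ltW m0)//.
    apply: le_trans (young _ _); rewrite ?mulr_ge0 ?(ltW Di) ?(ltW m0)//.
    suff -> : m / D * `|u x * v x| = D^-1 * `|u x| * (m * `|v x|) by [].
    by rewrite normrM; ring.
rewrite RintegralZl// ?RintegralD// ?RintegralZl// in h; last 5 first.
- exact: lv.2.
- exact: lu.2.
- by apply: Rintegrable_mull => //; exact: lu.2.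
- by apply: Rintegrable_mull => //; exact: lv.2.
- exact: (Rintegrable_norm iuv).
have h1 : D^-1 `^ p * powint A p u <= m.
  rewrite -(@ler_pM2l _ (D `^ p)) ?powR_gt0// mulrA -powRM ?(ltW Di) ?(ltW D0)//.
  by rewrite divff ?gt_eqF// powR1 mul1r.
have h2 : m `^ q * powint A q v <= m.
  apply: (@le_trans _ _ (m `^ q * m `^ (1 - q))).
    by rewrite ler_wpM2l ?powR_ge0.
  rewrite -powRD; last by rewrite (gt_eqF m0) implybT.
  by rewrite (_ : q + (1 - q) = 1) ?powRr1 ?(ltW m0)//; ring.
have h3 : m / D * \int[mu]_(x in A) `|u x * v x| <= m + m.
  by apply: (le_trans h); exact: lerD.
rewrite -(@ler_pM2l _ (m / D)) ?divr_gt0// (le_trans h3)//.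
suff -> : m / D * (2 * D) = m + m by [].
by field; rewrite gt_eqF.
Qed.

End conjugate_exponents.
End power_integrals.

(** * Testing membership in L^p against bounded functions *)

Section duality_test.
Context d (T : measurableType d) (R : realType) (mu : {measure set T -> \bar R}).
Implicit Types (A : set T) (f g u v : T -> R) (r c : R).
Local Notation integ A f := (mu.-integrable A (fun x => (f x)%:E)).

Lemma cvg_powR_norm0 r (x_ : nat -> R) : 0 < r ->
  x_ n @[n --> \oo] --> 0 -> (`|x_ n| `^ r) @[n --> \oo] --> 0.
Proof.
move=> r0 x0; apply/cvgr0Pnorm_lt => e e0.
have er0 : 0 < e `^ r^-1 by exact: powR_gt0.
move/cvgr0Pnorm_lt : x0 => /(_ _ er0); apply: filterS => n xn.
rewrite ger0_norm ?powR_ge0//.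
have -> : e = (e `^ r^-1) `^ r by rewrite -powRrM mulVf ?gt_eqF// powRr1 ?ltW.
by apply: gt0_ltr_powR; rewrite ?nnegrE ?powR_ge0.
Qed.

Lemma powint_cvg0 A r (f_ : nat -> T -> R) f g : measurable A -> 0 < r ->
  (forall n, measurable_fun setT (f_ n)) -> measurable_fun setT f ->
  (forall n x, A x -> `|f_ n x| <= `|g x|) -> (forall x, A x -> `|f x| <= `|g x|) ->
  (forall x, A x -> f_ n x @[n --> \oo] --> f x) -> in_Lp mu A r g ->
  powint mu A r (fun x => f x - f_ n x) @[n --> \oo] --> 0.
Proof.
move=> mA r0 mf_ mf fg_ fg cf lg.
have mB n : measurable_fun setT (fun x => f x - f_ n x) by exact: measurable_funB.
have [||||||] := @Rintegral_dominated_convergence _ _ _ mu A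
  (fun n x => `|f x - f_ n x| `^ r) (cst 0) (fun x => `|2 * g x| `^ r).
- by [].
- by move=> n; exact: measurable_norm_powR.
- exact: measurable_cst.
- move=> x Ax; apply: cvg_powR_norm0 => //.
  by rewrite -(subrr (f x)); apply: cvgB; [exact: cvg_cst | exact: cf].
- exact: (in_LpZ 2 mA lg).2.
- move=> n x Ax; rewrite ger0_norm ?powR_ge0//.
  apply: ge0_ler_powR; rewrite ?nnegrE ?(ltW r0)//.
  rewrite (le_trans (ler_normB _ _))// normrM ger0_norm// mulr2n mulrDl mul1r.
  by rewrite lerD ?fg ?fg_.
- by move=> _; rewrite (_ : \int[mu]_(x in A) cst 0 x = 0)//= (Rintegral_cst mu mA 0) mul0r.
Qed.

Context (p q : R) (p0 : 0 < p) (q0 : 0 < q) (pq : p^-1 + q^-1 = 1).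

(** This identity makes |w|^(p-1) a test function: its q-th power is |w|^p. *)
Lemma conj_exponent_mulB1 : (p - 1) * q = p.
Proof.
have p1 : p != 0 by rewrite gt_eqF.
have q1 : q != 0 by rewrite gt_eqF.
have : (p^-1 + q^-1) * (p * q) = p * q by rewrite pq mul1r.
rewrite mulrDl (mulrC p q) mulrA (mulrAC p^-1) mulVf// mul1r.
by rewrite mulrA mulVf// mul1r mulrBl mul1r (mulrC q p) => <-; ring.
Qed.

(** Arithmetic of the extremal test: I is the integral of |w|^p, t the factor that normalizes the
    test, M the bound on the tested integral. With J = I/m one finds (t I)^q = J^(q-1); raising this
    to the power p - 1 leaves J, because (q-1)(p-1) = 1, whence J <= M^p. *)
Lemma normalized_test_bound (I m M t : R) : 0 < I -> 0 < m -> 0 <= M -> 0 <= t ->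
  t `^ q * I = m `^ (1 - q) -> t * I <= M -> I <= M `^ p * m.
Proof.
move=> I0 m0 M0 t0 tI tM.
set J := I / m; have J0 : 0 < J by rewrite divr_gt0.
have IJ : I = J * m by rewrite /J divfK ?gt_eqF.
have e1 : (t * I) `^ q = J `^ (q - 1).
  have -> : (t * I) `^ q = (t `^ q * I) * I `^ (q - 1).
    rewrite powRM ?(ltW I0)// -mulrA -{2}[I]powRr1 ?(ltW I0)// -powRD ?subrKC//.
    by rewrite (gt_eqF I0) implybT.
  rewrite tI IJ powRM ?(ltW J0) ?(ltW m0)//.
  rewrite mulrCA -powRD; last by rewrite (gt_eqF m0) implybT.
  by rewrite (_ : 1 - q + (q - 1) = 0) ?powRr0 ?mulr1//; ring.
have pos1 : 0 <= p - 1.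
  by rewrite -(pmulr_lge0 _ q0) conj_exponent_mulB1 ltW.
have : ((t * I) `^ q) `^ (p - 1) <= (M `^ q) `^ (p - 1).
  have h0 : 0 <= t * I by rewrite mulr_ge0// ltW.
  by apply: ge0_ler_powR => //; rewrite ?nnegrE ?powR_ge0//;
    apply: ge0_ler_powR; rewrite ?nnegrE// ltW.
rewrite e1 -!powRrM (mulrC q) conj_exponent_mulB1.
rewrite (_ : (q - 1) * (p - 1) = 1); last first.
  have := conj_exponent_mulB1; rewrite mulrBl mul1r => h.
  by rewrite !mulrBl !mulrBr !mulr1 mul1r (mulrC q p) opprB addrA -addrA; lra.
by rewrite powRr1 ?(ltW J0)// IJ ler_pM2r.
Qed.

Lemma Rintegral_increasing_bounded A (W : nat -> T -> R) f c : measurable A ->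
  measurable_fun setT f -> (forall n, integ A (W n)) -> (forall n x, A x -> 0 <= W n x) ->
  (forall x, A x -> {homo (W ^~ x) : n m / (n <= m)%N >-> n <= m}) ->
  (forall x, A x -> W n x @[n --> \oo] --> f x) ->
  (forall n, \int[mu]_(x in A) W n x <= c) ->
  integ A f /\ \int[mu]_(x in A) f x <= c.
Proof.
move=> mA mf iW W0 ndW cW Wc.
have mW n : measurable_fun A (fun x => (W n x)%:E).
  exact: (measurable_int _ (iW n)).
have cvW := @cvg_monotone_convergence _ _ _ mu A mA (fun n x => (W n x)%:E) mW W0.
have f0 x : A x -> 0 <= f x.
  by move=> Ax; apply: (cvgr_to_ge (cW x Ax)); apply: nearW => n; exact: W0.
have lef : (\int[mu]_(x in A) (f x)%:E <= c%:E)%E.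
  apply: (@cvge_to_le _ \oo _ _ (fun n => (\int[mu]_(x in A) (W n x)%:E)%E)); last first.
    apply: nearW => n; move: (Wc n); rewrite -lee_fin /Rintegral fineK//.
    exact: integrable_fin_num.
  have -> : (\int[mu]_(x in A) (f x)%:E =
      \int[mu]_(x in A) (fun x0 : T => limn (fun n => (W n x0)%:E)) x)%E.
    apply: eq_integral => x /set_mem Ax; apply/esym/cvg_lim => //.
    by apply: cvg_EFin; [exact: nearW | exact: cW].
  by apply: cvW => x Ax n m nm; rewrite lee_fin; exact: ndW.
have i_f : integ A f.
  apply/integrableP; split; first by apply/measurable_EFinP; exact: measurable_funTS.
  under eq_integral => x /set_mem Ax do rewrite gee0_abs ?lee_fin ?f0//.
  by rewrite (le_lt_trans lef)// ltry.
by split => //; rewrite -lee_fin /Rintegral fineK//; exact: integrable_fin_num.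
Qed.

(** Converse of Hoelder's inequality. Only bounded tests [g] with [w * g] integrable are used, so
    nothing is presupposed on [w] beyond measurability; this is what lifts a density from L^1 to
    L^p. *)
Lemma powint_le_of_tests A (w : T -> R) (m M : R) : measurable A -> mu A = m%:E -> 0 < m ->
  0 <= M -> measurable_fun setT w ->
  (forall (g : T -> R) c, measurable_fun setT g -> (forall x, `|g x| <= c) ->
     integ A (fun x => w x * g x) ->
     powint mu A q g <= m `^ (1 - q) -> \int[mu]_(x in A) (w x * g x) <= M) ->
  in_Lp mu A p w /\ powint mu A p w <= M `^ p * m.
Proof.
move=> mA muA m0 M0 mw test.
have muA_lt : (mu A < +oo)%E by rewrite muA ltry.
pose E n := [set x | `|w x| <= n%:R].
have mE n : measurable (E n).
  rewrite -[X in measurable X]setTI; apply: measurable_fun_le => //.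
  exact: measurableT_comp.
(* The extremal function [|w|^(p-2) w] of Hoelder's inequality, cut off where
   [|w| > n] so that nothing is assumed about the integrability of [w]. *)
pose k n x := \1_(E n) x * (w x * `|w x| `^ (p - 2)).
pose W n x : R := \1_(E n) x * `|w x| `^ p.
have pos1 : 0 <= p - 1.
  by rewrite -(pmulr_lge0 _ q0) conj_exponent_mulB1 ltW.
have mI n : measurable_fun setT (\1_(E n) : T -> R) by exact: measurable_indic.
have w1 x : w x != 0 -> `|w x| `^ (p - 1) = `|w x| * `|w x| `^ (p - 2).
  move=> w0; rewrite -{2}[`|w x|]powRr1// -powRD ?normr_eq0 ?w0 ?implybT//.
  by congr (_ `^ _); ring.
have mk n : measurable_fun setT (k n).
  apply: measurable_funM => //; apply: measurable_funM => //.
  exact: measurable_norm_powR.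
have mW n : measurable_fun setT (W n).
  by apply: measurable_funM => //; exact: measurable_norm_powR.
have wk n x : w x * k n x = W n x.
  rewrite /k /W mulrCA; congr (_ * _).
  have [->|w0] := eqVneq (w x) 0; first by rewrite mul0r normr0 powR0 ?gt_eqF.
  rewrite mulrA -expr2 -real_normK ?num_real// expr2 -mulrA -w1//.
  rewrite -{1}[`|w x|]powRr1// -powRD ?normr_eq0 ?w0 ?implybT//.
  by congr (_ `^ _); ring.
have kq n x : `|k n x| `^ q = W n x.
  rewrite /k /W indicE; case: (x \in E n); rewrite ?mul0r ?mul1r ?normr0.
    rewrite normrM; have [->|w0] := eqVneq (w x) 0.
      by rewrite normr0 mul0r !powR0 ?gt_eqF.
    by rewrite (ger0_norm (powR_ge0 _ _)) -w1// -powRrM conj_exponent_mulB1.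
  by rewrite powR0 ?gt_eqF.
have W0 n x : 0 <= W n x by rewrite mulr_ge0 ?powR_ge0.
have Wb n x : `|W n x| <= n%:R `^ p.
  rewrite ger0_norm// /W indicE; case: (boolP (x \in E n)) => [/set_mem wn|_].
    by rewrite mul1r; apply: ge0_ler_powR; rewrite ?nnegrE// ltW.
  by rewrite mul0r powR_ge0.
have iW n : integ A (W n).
  apply: (integrable_le mA (mW n) (g := cst (n%:R `^ p))); first by move=> x _; exact: Wb.
  exact: Rintegrable_cst.
have IW n : \int[mu]_(x in A) W n x <= M `^ p * m.
  set I := Rintegral _ _ _.
  have [I0|I0] := leP I 0; first by rewrite (le_trans I0)// mulr_ge0 ?powR_ge0// ltW.
  (* The q-th power of [k n] is [W n], whose integral is [I]; this [t] makes [t * k n] meet the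
     constraint with equality. *)
  pose t := (m `^ (1 - q) / I) `^ q^-1.
  have tq : t `^ q * I = m `^ (1 - q).
    rewrite /t -powRrM mulVf ?gt_eqF// powRr1 ?divfK ?gt_eqF//.
    by rewrite divr_ge0 ?powR_ge0// ltW.
  apply: (@normalized_test_bound _ _ _ t) => //; first exact: powR_ge0.
  have kb x : `|k n x| <= n%:R `^ (p - 1).
    rewrite /k indicE; case: (boolP (x \in E n)) => [/set_mem wn|_]; last first.
      by rewrite mul0r normr0 powR_ge0.
    rewrite mul1r normrM; have [->|w0] := eqVneq (w x) 0.
      by rewrite normr0 mul0r powR_ge0.
    rewrite (ger0_norm (powR_ge0 _ _)) -w1//.
    by apply: ge0_ler_powR; rewrite ?nnegrE.
  have wt x : w x * (t * k n x) = t * W n x by rewrite mulrCA wk.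
  have lk : in_Lp mu A q (k n) by apply: (@in_Lp_bounded _ _ _ _ _ _ (n%:R `^ (p - 1))).
  have := test (fun x => t * k n x) (t * n%:R `^ (p - 1)).
  under eq_Rintegral do rewrite wt.
  rewrite (RintegralZl t mA (iW n)); apply.
  - exact: measurable_funM.
  - by move=> x; rewrite normrM ger0_norm ?powR_ge0// ler_wpM2l ?powR_ge0.
  - by under eq_fun do rewrite wt; exact: Rintegrable_mull.
  - rewrite powintZ// ger0_norm ?powR_ge0// -tq ler_wpM2l ?powR_ge0//.
    by rewrite /powint; under eq_Rintegral do rewrite kq.
(* The bound does not depend on n, so monotone convergence removes the cutoff. *)
have [] := @Rintegral_increasing_bounded A W (fun x => `|w x| `^ p) (M `^ p * m) mA.
- exact: measurable_norm_powR.
- exact: iW.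
- by [].
- move=> x Ax a b ab; rewrite /W ler_wpM2r ?powR_ge0// !indicE.
  case: (boolP (x \in E a)) => [/set_mem wa|//]; rewrite mem_set//.
  by apply: (le_trans wa); rewrite ler_nat.
- move=> x Ax; apply: cvg_near_cst; near=> n.
  rewrite /W indicE mem_set ?mul1r// /E /=; near: n; exact: nbhs_infty_ger.
- exact: IW.
- by move=> i_f le_f; split => //; split.
Unshelve. all: by end_near.
Qed.

End duality_test.

(** * The dual of L^q on a set of finite measure *)

Import HBNNSimple.

Section simple_approximation.
Context d (T : measurableType d) (R : realType).

Lemma nnsfun_approximation (f : T -> R) : measurable_fun setT f ->
  (forall x, 0 <= f x) -> exists s : {nnsfun T >-> R}^nat,
  (forall n x, s n x <= f x) /\ (forall x, s n x @[n --> \oo] --> f x).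
Proof.
move=> mf f0; have mf' : measurable_fun setT (fun x => (f x)%:E) by exact/measurable_EFinP.
exists (nnsfun_approx measurableT mf'); split.
  move=> n x; rewrite -lee_fin nnsfun_approxE; apply: le_approx => //.
  by move=> y _; rewrite lee_fin.
move=> x.
have := @cvg_nnsfun_approx _ _ _ _ measurableT _ mf' (fun y _ => f0 y) x I.
by move/fine_cvgP => [].
Qed.

End simple_approximation.

Section riesz_representation.
Context d (T : measurableType d) (R : realType)
  (mu : {sigma_finite_measure set T -> \bar R}).
Local Notation integ A f := (mu.-integrable A (fun x => (f x)%:E)).
Context (p q : R) (p0 : 0 < p) (q0 : 0 < q) (pq : p^-1 + q^-1 = 1).
Context (A : set T) (m M : R) (mA : measurable A) (muA : mu A = m%:E)
  (m0 : 0 < m) (M0 : 0 <= M) (Lam : (T -> R) -> R).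
Hypothesis Lam_linear : forall c f g, in_Lp mu A q f -> in_Lp mu A q g ->
  Lam (fun x => c * f x + g x) = c * Lam f + Lam g.
(** Boundedness in root-free form: the condition on [g] says that it has at most [s] times the size
    of a normalized atom. *)
Hypothesis Lam_bounded : forall s g, 0 < s -> in_Lp mu A q g ->
  powint mu A q g <= s `^ q * m `^ (1 - q) -> `|Lam g| <= M * s.

Let muA_lty : (mu A < +oo)%E. Proof. by rewrite muA ltry. Qed.

Let in_Lp_indic E : measurable E -> in_Lp mu A q (\1_E).
Proof.
move=> mE; apply: (@in_Lp_bounded _ _ _ _ _ _ 1) => // x _.
by rewrite indicE; case: (_ \in _); rewrite ?normr1 ?normr0.
Qed.

(** A function of zero norm obeys the bound at every scale s, so its image is arbitrarily small. In
    s = e / (M + 1), the 1 allows for M = 0. *)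
Let Lam_eq0 g : in_Lp mu A q g -> powint mu A q g = 0 -> Lam g = 0.
Proof.
move=> lg g0; apply/eqP; rewrite -normr_le0; apply/ler_addgt0Pr => e e0.
rewrite add0r; have M1 : 0 < M + 1 by rewrite ltr_wpDl.
apply: (@le_trans _ _ (M * (e / (M + 1)))).
  by apply: Lam_bounded; rewrite ?divr_gt0// g0 mulr_ge0 ?powR_ge0.
by rewrite mulrCA ler_piMr ?(ltW e0)// ler_pdivrMr// mul1r lerDl.
Qed.

Let in_Lp0 : in_Lp mu A q (cst 0).
Proof. by apply: (@in_Lp_bounded _ _ _ _ _ _ 0) => // x _; rewrite normr0. Qed.

Let Lam0 : Lam (cst 0) = 0.
Proof.
by apply: Lam_eq0 => //; rewrite powint_cst// normr0 powR0 ?gt_eqF// mul0r.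
Qed.

Let LamD f g : in_Lp mu A q f -> in_Lp mu A q g ->
  Lam (fun x => f x + g x) = Lam f + Lam g.
Proof.
move=> lf lg; have := Lam_linear 1 lf lg; rewrite mul1r => <-.
by congr Lam; apply/funext => x; rewrite mul1r.
Qed.

Let LamB f g : in_Lp mu A q f -> in_Lp mu A q g ->
  Lam (fun x => f x - g x) = Lam f - Lam g.
Proof.
move=> lf lg; have := Lam_linear (-1) lg lf; rewrite mulN1r addrC => <-.
by congr Lam; apply/funext => x; rewrite mulN1r addrC.
Qed.

Let Lam_cvg (f_ : nat -> T -> R) f : (forall n, in_Lp mu A q (f_ n)) ->
  in_Lp mu A q f -> powint mu A q (fun x => f x - f_ n x) @[n --> \oo] --> 0 ->
  Lam (f_ n) @[n --> \oo] --> Lam f.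
Proof.
move=> lf_ lf f0; apply/cvgrPdist_le => e e0.
have M1 : 0 < M + 1 by rewrite ltr_wpDl.
have s0 : 0 < e / (M + 1) by rewrite divr_gt0.
have c0 : 0 < (e / (M + 1)) `^ q * m `^ (1 - q) by rewrite mulr_gt0// powR_gt0.
move/cvgr0Pnorm_le : f0 => /(_ _ c0); apply: filterS => n.
rewrite ger0_norm ?powint_ge0// => h.
rewrite -LamB//; apply: (@le_trans _ _ (M * (e / (M + 1)))).
  by apply: Lam_bounded => //; exact: in_LpB.
by rewrite mulrCA ler_piMr ?(ltW e0)// ler_pdivrMr// mul1r lerDl.
Qed.

(** Defined on all sets, although only the trace of E on A counts: indicators that agree on A differ
    by a function of zero [powint]. *)
Let nu (E : set T) : \bar R := (Lam (\1_E))%:E.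

Let nu0 : nu set0 = 0%E.
Proof. by rewrite /nu indic0 Lam0. Qed.

Let nu_fin E : measurable E -> nu E \is a fin_num.
Proof. by []. Qed.

(** Countable additivity is continuity of [Lam]: indicators of the finite unions converge pointwise
    and stay below 1, hence converge in L^q(A), as A has finite measure. *)
Let nu_sigma_additive : semi_sigma_additive nu.
Proof.
move=> F mF tF mUF.
pose G n := \bigcup_(i in [set i | (i < n)%N]) F i.
have mG n : measurable (G n) by apply: bigcup_measurable => i _.
have GS n x : \1_(G n.+1) x = \1_(F n) x + \1_(G n) x :> R.
  rewrite !indicE; case: (boolP (x \in F n)) => [/set_mem Fnx|/negP nFnx].
    rewrite mem_set; last by exists n => //=.
    case: (boolP (x \in G n)) => [/set_mem [i /= ni Fix]|_]; last by rewrite addr0.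
    have : i = n by apply: tF => //; exists x.
    by move=> ein; rewrite ein ltnn in ni.
  rewrite add0r; congr (_ %:R); congr nat_of_bool; apply/idP/idP => /set_mem.
    move=> [i /=]; rewrite ltnS leq_eqVlt => /orP[/eqP -> Fx|ni Fix].
      by exfalso; apply: nFnx; exact: mem_set.
    by apply: mem_set; exists i.
  by move=> [i /= ni Fix]; apply: mem_set; exists i => //=; exact: leqW.
have sumE n : (\sum_(0 <= i < n) nu (F i) = (Lam (\1_(G n)))%:E)%E.
  elim: n => [|n IH].
    rewrite big_nil (_ : G 0%N = set0) ?indic0 ?Lam0//.
    by apply/seteqP; split=> // x [].
  rewrite big_nat_recr//= IH /nu -EFinD -LamD//; try exact: in_Lp_indic.
  by congr (Lam _)%:E; apply/funext => x; rewrite GS addrC.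
under eq_fun do rewrite sumE.
apply: cvg_EFin; first exact: nearW.
apply: Lam_cvg; [by move=> n; exact: in_Lp_indic|exact: in_Lp_indic|].
apply: (@powint_cvg0 _ _ _ _ _ _ _ _ (cst 1)) => //.
- by move=> n; exact: measurable_indic.
- by move=> n x _; rewrite /cst normr1 indicE; case: (x \in _); rewrite ?normr1 ?normr0.
- by move=> x _; rewrite /cst normr1 indicE; case: (x \in _); rewrite ?normr1 ?normr0.
- move=> x _; case: (boolP (x \in \bigcup_n F n)) => [/set_mem [k _ Fkx]|nx].
    apply: cvg_near_cst; near=> n; rewrite !indicE !mem_set//; first by exists k.
    exists k => //=; near: n; exact: nbhs_infty_gt.
  apply: cvg_near_cst; near=> n; rewrite !indicE (negbTE nx) (_ : x \in G n = false)//.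
  apply/negbTE/negP => /set_mem [i _ Fix]; move/negP: nx; apply.
  by apply: mem_set; exists i.
- by apply: (@in_Lp_bounded _ _ _ _ _ _ 1) => // x _; rewrite normr1.
Unshelve. all: by end_near.
Qed.

HB.instance Definition _ := isCharge.Build _ T R nu nu0 nu_fin nu_sigma_additive.

Let nu_dominated : nu `<< mu.
Proof.
apply/null_content_dominatesP => E mE muE0.
rewrite /nu Lam_eq0//; first exact: in_Lp_indic.
rewrite /powint /Rintegral.
have : (\int[mu]_(x in A) (`|\1_E x| `^ q)%:E = \int[mu]_(x in A) (\1_E x)%:E)%E.
  apply: eq_integral => x _; rewrite indicE; case: (_ \in _); rewrite ?normr1 ?normr0.
    by rewrite powR1.
  by rewrite powR0// gt_eqF.
move=> ->; rewrite integral_indic//.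
suff e : mu (E `&` A) = 0%E by exact: (congr1 fine e).
apply/eqP; rewrite eq_le measure_ge0 andbT -muE0; apply: le_measure; rewrite ?inE//.
exact: measurableI.
Qed.

Let density x : R := fine (Radon_Nikodym nu mu x).

Let density_EFin x : (density x)%:E = Radon_Nikodym nu mu x.
Proof. by rewrite fineK//; exact: Radon_Nikodym_fin_num. Qed.

Let density_integrable : integ setT density.
Proof.
by under eq_fun do rewrite density_EFin; exact: Radon_Nikodym_integrable.
Qed.

Let measurable_density : measurable_fun setT density.
Proof. by apply/measurable_EFinP; apply: (measurable_int mu); exact: density_integrable. Qed.

Let density_integrableA : integ A density.
Proof. exact: (integrableS measurableT). Qed.

Let Lam_indic E : measurable E ->
  Lam (\1_E) = \int[mu]_(x in A) (density x * \1_E x).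
Proof.
move=> mE.
(* Radon-Nikodym integrates over the whole of its set. Cutting E by A first yields an integral over
   A, and does not change [Lam]. *)
have -> : Lam (\1_E) = Lam (\1_(E `&` A)).
  apply/eqP; rewrite -subr_eq0 -LamB; try exact: in_Lp_indic.
    rewrite Lam_eq0//; first by apply: in_LpB => //; apply: in_Lp_indic => //; exact: measurableI.
    rewrite /powint -[RHS](mul0r (fine (mu A))) -(Rintegral_cst mu mA).
    apply: eq_Rintegral => x xA; rewrite !indicE in_setI xA andbT subrr normr0.
    by rewrite powR0// gt_eqF.
  by apply: in_Lp_indic; exact: measurableI.
have mEA : measurable (E `&` A) by exact: measurableI.
have := Radon_Nikodym_integral nu_dominated mEA.
rewrite -[LHS]/((Lam _)%:E) => h; apply: EFin_inj; rewrite h.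
rewrite setIC integral_mkcondr /Rintegral fineK; last first.
  apply: integrable_fin_num => //.
  apply: (integrable_le mA (g := fun x => `|density x|)) => //.
  - by apply: measurable_funM => //; exact: measurable_indic.
  - move=> x _; rewrite normrM indicE; case: (_ \in _); rewrite ?normr1 ?normr0 ?mulr1//.
    by rewrite mulr0.
  - exact: Rintegrable_norm.
apply: eq_integral => x _; rewrite patchE indicE; case: (_ \in _).
  by rewrite mulr1 density_EFin.
by rewrite mulr0.
Qed.

(** Integrability of the product is part of the property because at this stage the density is only
    known to be in L^1. *)
Let represented g := [/\ in_Lp mu A q g, integ A (fun x => density x * g x)
  & Lam g = \int[mu]_(x in A) (density x * g x)].

Let represented_indic E : measurable E -> represented (\1_E).
Proof.
move=> mE; split; [exact: in_Lp_indic| |exact: Lam_indic].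
apply: (integrable_le mA (g := fun x => `|density x|)) => //.
- by apply: measurable_funM => //; exact: measurable_indic.
- move=> x _; rewrite normrM indicE; case: (_ \in _); rewrite ?normr1 ?normr0 ?mulr1//.
  by rewrite mulr0.
- exact: Rintegrable_norm.
Qed.

Let represented_lin c f g : represented f -> represented g ->
  represented (fun x => c * f x + g x).
Proof.
move=> [lf i_f ef] [lg ig eg].
have e x : density x * (c * f x + g x) = c * (density x * f x) + density x * g x by ring.
split.
- by apply: in_LpD => //; exact: in_LpZ.
- under eq_fun do rewrite e.
  by apply: Rintegrable_add => //; exact: Rintegrable_mull.
- rewrite Lam_linear// ef eg.
  under [RHS]eq_Rintegral do rewrite e.
  by rewrite RintegralD// ?RintegralZl//; exact: Rintegrable_mull.
Qed.

Let represented0 : represented (cst 0).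
Proof. by rewrite -indic0; exact: represented_indic. Qed.

Let represented_nnsfun (s : {nnsfun T >-> R}) : represented s.
Proof.
have -> : (s : T -> R) = (fun x => \sum_(y <- finmap.enum_fset (fset_set (range s)))
    (y * \1_(s @^-1` [set y]) x)).
  by apply/funext => x; rewrite [LHS]fimfunE fsbig_finite.
elim: (finmap.enum_fset _) => [|y r IH].
  rewrite (_ : (fun x => _) = cst 0) //.
  by apply/funext => x; rewrite big_nil.
rewrite (_ : (fun x => _) = (fun x => y * \1_(s @^-1` [set y]) x +
    \sum_(y <- r) (y * \1_(s @^-1` [set y]) x))); last first.
  by apply/funext => x; rewrite big_cons.
apply: represented_lin IH; apply: represented_indic.
by rewrite -[X in measurable X]setTI; exact: (measurable_funPT s).
Qed.

(** Simple functions below the positive and negative parts of g converge to g and are dominated by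
    |g|: [Lam] passes to the limit by L^q continuity, the integral by dominated convergence. The
    product is assumed integrable, since that the density is in L^p is deduced from this lemma. *)
Let represented_all g : in_Lp mu A q g -> integ A (fun x => density x * g x) ->
  represented g.
Proof.
move=> lg ig; split => //.
have mg := lg.1.
have le_maxr0 (a : R) : 0 <= Num.max a 0 by rewrite le_max lexx orbT.
pose gp x := Num.max (g x) 0; pose gn x := Num.max (- g x) 0.
have mgp : measurable_fun setT gp by exact: measurable_maxr.
have mgn : measurable_fun setT gn.
  by apply: measurable_maxr => //; exact: measurableT_comp.
have [s [s_le s_cvg]] := nnsfun_approximation mgp (fun x => le_maxr0 _).
have [t [t_le t_cvg]] := nnsfun_approximation mgn (fun x => le_maxr0 _).
pose u n x := - 1 * t n x + s n x.
have ru n : represented (u n) by apply: represented_lin; exact: represented_nnsfun.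
have gE x : g x = -1 * gn x + gp x.
  by rewrite /gn /gp; case: (leP (g x) 0); case: (leP (- g x) 0); lra.
have cu x : u n x @[n --> \oo] --> g x.
  rewrite gE; apply: cvgD; last exact: s_cvg.
  by apply: cvgM; [exact: cvg_cst | exact: t_cvg].
have u_le n x : `|u n x| <= `|g x|.
  have := s_le n x; have := t_le n x.
  have s0 : 0 <= s n x by []; have t0 : 0 <= t n x by [].
  rewrite /u /gn /gp; case: (leP (g x) 0) => g0.
    by rewrite (ler0_norm g0); case: (leP (- g x) 0) => *; rewrite ler_norml; lra.
  by rewrite (gtr0_norm g0); case: (leP (- g x) 0) => *; rewrite ler_norml; lra.
have mu_ n : measurable_fun setT (u n) by have [[]] := ru n.
have h1 : Lam (u n) @[n --> \oo] --> Lam g.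
  apply: Lam_cvg => //; first by move=> n; have [] := ru n.
  by apply: (@powint_cvg0 _ _ _ _ _ _ _ _ g).
have [||||||_ h2] := @Rintegral_dominated_convergence _ _ _ mu A
  (fun n x => density x * u n x) (fun x => density x * g x) (fun x => `|density x * g x|).
- by [].
- by move=> n; exact: measurable_funM.
- exact: measurable_funM.
- by move=> x Ax; apply: cvgM; [exact: cvg_cst | exact: cu].
- exact: Rintegrable_norm.
- by move=> n x Ax; rewrite !normrM ler_wpM2l.
- apply: (cvg_unique _ h1) => //.
  have -> : (fun n => Lam (u n)) = (fun n => \int[mu]_(x in A) (density x * u n x)).
    by apply/funext => n; have [] := ru n.
  exact: h2.
Qed.

(** [represented_all] serves twice: on bounded tests it puts the density in L^p; then Young's
    inequality makes the product with any L^q function integrable, and it applies to all of them. *)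
Lemma Lq_riesz_representation : exists h, in_Lp mu A p h /\
  forall g, in_Lp mu A q g -> Lam g = \int[mu]_(x in A) (h x * g x).
Proof.
have [lh _] : in_Lp mu A p density /\ powint mu A p density <= M `^ p * m.
  apply: (powint_le_of_tests p0 q0 pq) => // g c mg gc ig gm.
  have lg : in_Lp mu A q g by exact: (@in_Lp_bounded _ _ _ _ _ _ c).
  have [_ _ <-] := represented_all lg ig.
  rewrite (le_trans (ler_norm _))// -[leRHS]mulr1 Lam_bounded//.
  by rewrite powR1 mul1r.
exists density; split => // g lg.
have ig := in_Lp_mul p0 q0 pq mA lh lg.
by have [] := represented_all lg ig.
Qed.

End riesz_representation.

(** * Mean-zero functions on a set *)

Section cancellative_functions.
Context d (T : measurableType d) (R : realType)
  (mu : {measure set T -> \bar R}).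
Local Notation integ A f := (mu.-integrable A (fun x => (f x)%:E)).

(* The real multiples of (1,q)-atoms with support in [A]; unlike for [atom], the
   vanishing outside [A] is everywhere and not almost everywhere. *)
Definition cancellative (A : set T) (q : R) (b : T -> R) : Prop :=
  [/\ in_Lp mu A q b, forall x, ~ A x -> b x = 0 & \int[mu]_(x in A) b x = 0].

Definition mean (A : set T) (g : T -> R) : R :=
  (\int[mu]_(x in A) g x) / fine (mu A).

(** The indicator forces vanishing everywhere outside A, as [cancellative] demands; on L^q(A) this
    is a projection onto the cancellative functions. *)
Definition center (A : set T) (g : T -> R) (x : T) : R :=
  \1_A x * (g x - mean A g).

Context (p q : R) (p0 : 0 < p) (q0 : 0 < q) (pq : p^-1 + q^-1 = 1).
Context (A : set T) (m : R) (mA : measurable A) (muA : mu A = m%:E) (m0 : 0 < m).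

Let muA_lty : (mu A < +oo)%E. Proof. by rewrite muA ltry. Qed.
Let pq' : q^-1 + p^-1 = 1. Proof. by rewrite addrC. Qed.

Lemma in_Lp_cst r c : 0 < r -> in_Lp mu A r (cst c).
Proof. by move=> r0; apply: (@in_Lp_bounded _ _ _ _ _ _ `|c|). Qed.

Lemma in_Lp_integrable_conj g : in_Lp mu A q g -> integ A g.
Proof. exact: in_Lp_integrable q0 p0 pq' _ _ mA muA_lty. Qed.

Lemma center_in x g : A x -> center A g x = g x - mean A g.
Proof. by move=> Ax; rewrite /center indicE mem_set// mul1r. Qed.

Lemma center_out x g : ~ A x -> center A g x = 0.
Proof. by move=> Ax; rewrite /center indicE memNset// mul0r. Qed.

(** Hoelder's inequality for g / s against the constant function 1; the 2 is the constant of
    [hoelder_normalized]. *)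
Lemma mean_bound s g : 0 < s -> in_Lp mu A q g ->
  powint mu A q g <= s `^ q * m `^ (1 - q) -> `|mean A g| <= 2 * s / m.
Proof.
move=> s0 lg gs.
have lg1 : in_Lp mu A q (fun x => s^-1 * g x) by exact: in_LpZ.
have h : powint mu A q (fun x => s^-1 * g x) <= m `^ (1 - q).
  rewrite powintZ// ger0_norm ?invr_ge0 ?(ltW s0)//.
  rewrite -(@ler_pM2l _ (s `^ q)) ?powR_gt0// mulrA -powRM ?invr_ge0 ?(ltW s0)//.
  by rewrite divff ?gt_eqF// powR1 mul1r.
have := @hoelder_normalized _ _ _ mu p q p0 q0 pq A (cst 1) _ 1 m mA ltr01 m0
  (in_Lp_cst 1 p0) lg1.
rewrite powint_cst// normr1 powR1 muA mul1r => /(_ (lexx _) h) h2.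
have ig1 : integ A (fun x => s^-1 * g x).
  by apply: Rintegrable_mull => //; exact: in_Lp_integrable_conj.
have h3 : `|\int[mu]_(x in A) (s^-1 * g x)| <= 2.
  apply: (le_trans (le_normr_Rintegral mA ig1)).
  rewrite mulr1 in h2; apply: le_trans h2.
  by under [leRHS]eq_Rintegral do rewrite mul1r.
rewrite RintegralZl// in h3; last exact: in_Lp_integrable_conj.
rewrite normrM ger0_norm ?invr_ge0 ?(ltW s0)// in h3.
rewrite /mean muA/= normrM [X in _ * X]ger0_norm ?invr_ge0 ?(ltW m0)//.
rewrite ler_pM2r ?invr_gt0// -(@ler_pM2l _ s^-1) ?invr_gt0//.
by rewrite mulrCA mulVf ?gt_eqF// mulr1.
Qed.

Lemma mean_linear c f g : integ A f -> integ A g ->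
  mean A (fun x => c * f x + g x) = c * mean A f + mean A g.
Proof.
move=> i_f ig; rewrite /mean RintegralD// ?RintegralZl//; last exact: Rintegrable_mull.
by rewrite mulrDl mulrA.
Qed.

Lemma center_linear c f g : integ A f -> integ A g ->
  center A (fun x => c * f x + g x) = fun x => c * center A f x + center A g x.
Proof.
by move=> i_f ig; apply/funext => x; rewrite /center mean_linear//; ring.
Qed.

Lemma measurable_center g : measurable_fun setT g -> measurable_fun setT (center A g).
Proof.
by move=> mg; apply: measurable_funM; [exact: measurable_indic | exact: measurable_funB].
Qed.

Lemma center_cancellative g : in_Lp mu A q g -> cancellative A q (center A g).
Proof.
move=> lg; have ig := in_Lp_integrable_conj lg; split.
- apply: (@in_Lp_le _ _ _ _ _ _ _ (fun x => g x - mean A g)) => //.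
  + by apply: measurable_center; exact: lg.1.
  + by move=> x Ax; rewrite center_in.
  + apply: in_LpB => //; exact: in_Lp_cst.
- by move=> x Ax; rewrite center_out.
- rewrite (@eq_Rintegral _ _ _ _ _ (fun x => g x - mean A g)); last first.
    by move=> x /set_mem Ax; rewrite center_in.
  rewrite RintegralB//; last exact: (Rintegrable_cst (mean A g) mA muA_lty).
  by rewrite (Rintegral_cst mu mA (mean A g)) /mean muA/= divfK ?subrr ?gt_eqF.
Qed.

Lemma center_id b : cancellative A q b -> center A b = b.
Proof.
move=> [lb b0 ib]; apply/funext => x; rewrite /center /mean ib mul0r subr0 indicE.
by case: (boolP (x \in A)) => [_|/negP xA]; rewrite ?mul1r// mul0r b0// => Ax; apply: xA; exact: mem_set.
Qed.

(** Origin of the 8: (8 s)^q = 2^q 2^q (2 s)^q, where the first factor is that of [powintB], the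
    second absorbs a sum of two terms since 2 <= 2^q, and (2 s)^q comes from the bound on the
    mean. *)
Lemma powint_center s g : 0 < s -> in_Lp mu A q g ->
  powint mu A q g <= s `^ q * m `^ (1 - q) ->
  powint mu A q (center A g) <= (8 * s) `^ q * m `^ (1 - q).
Proof.
move=> s0 lg gs; have q1 := (conj_exponent_ge1 p0 q0 pq).2.
have two_le : 2 <= 2 `^ q :> R.
  by rewrite -{1}[2]powRr1//; apply: ler_powR => //; rewrite ler1n.
have -> : powint mu A q (center A g) = powint mu A q (fun x => g x - cst (mean A g) x).
  by apply: eq_Rintegral => x /set_mem Ax; rewrite center_in.
apply: (le_trans (powintB mA q0 lg (in_Lp_cst _ q0))).
rewrite powint_cst// muA/=.
have h1 : `|mean A g| `^ q * m <= (2 * s) `^ q * m `^ (1 - q).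
  apply: (@le_trans _ _ ((2 * s / m) `^ q * m)).
    rewrite ler_pM2r//; apply: ge0_ler_powR; rewrite ?nnegrE ?(ltW q0)//.
      by rewrite divr_ge0 ?mulr_ge0 ?ltW.
    exact: mean_bound.
  rewrite powRM ?mulr_ge0 ?invr_ge0 ?(ltW s0) ?(ltW m0)// -mulrA ler_wpM2l ?powR_ge0//.
  suff -> : m^-1 `^ q * m = m `^ (1 - q) by [].
  rewrite -powR_inv1 ?(ltW m0)// -powRrM -{2}[m]powRr1 ?(ltW m0)// -powRD; last first.
    by rewrite (gt_eqF m0) implybT.
  by congr (_ `^ _); ring.
have s2 : s `^ q <= (2 * s) `^ q.
  by apply: ge0_ler_powR; rewrite ?nnegrE ?mulr_ge0 ?(ltW q0) ?(ltW s0)//; lra.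
have h2 : powint mu A q g + `|mean A g| `^ q * m <= 2 * ((2 * s) `^ q * m `^ (1 - q)).
  rewrite mulr2n mulrDl mul1r lerD// (le_trans gs)//.
  by rewrite ler_wpM2r ?powR_ge0.
apply: (le_trans (ler_wpM2l (powR_ge0 _ _) h2)).
rewrite (_ : 8 * s = 2 * (2 * (2 * s))); last by ring.
rewrite [in leRHS]powRM ?mulr_ge0 ?(ltW s0)// [in leRHS]powRM ?mulr_ge0 ?(ltW s0)//.
rewrite -!mulrA ler_wpM2l ?powR_ge0// !mulrA ler_wpM2r ?powR_ge0//.
by rewrite ler_wpM2r ?powR_ge0.
Qed.

Lemma cancellativeZ c b : cancellative A q b -> cancellative A q (fun x => c * b x).
Proof.
move=> [lb b0 ib]; split; first exact: in_LpZ.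
- by move=> x Ax; rewrite b0// mulr0.
- by rewrite RintegralZl// ?ib ?mulr0//; exact: in_Lp_integrable_conj.
Qed.

Lemma cancellative0 : cancellative A q (cst 0).
Proof.
split; [exact: in_Lp_cst|by []|].
by rewrite (Rintegral_cst mu mA 0) mul0r.
Qed.

Lemma cancellative_scaled_bound (L : (T -> R) -> R) (M s : R) b : 0 <= M -> 0 < s ->
  (forall c b, cancellative A q b -> L (fun x => c * b x) = c * L b) ->
  (forall b, cancellative A q b -> powint mu A q b <= m `^ (1 - q) -> `|L b| <= M) ->
  cancellative A q b -> powint mu A q b <= s `^ q * m `^ (1 - q) -> `|L b| <= M * s.
Proof.
move=> M0 s0 LZ LM cb bs.
have := LM _ (cancellativeZ s^-1 cb).
have lb : in_Lp mu A q b by case: cb.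
rewrite powintZ// LZ// !normrM ger0_norm ?invr_ge0 ?(ltW s0)// => h.
rewrite mulrC -ler_pdivrMl//; apply: h.
rewrite -(@ler_pM2l _ (s `^ q)) ?powR_gt0// mulrA -powRM ?invr_ge0 ?(ltW s0)//.
by rewrite divff ?gt_eqF// powR1 mul1r.
Qed.

(** Subtracting the mean is self-adjoint: the integral of (u - mean u) g equals that of u against
    the centered g. Hence arbitrary tests of u - mean u become mean-zero tests of u, at the cost of
    the 8 of [powint_center]. *)
Lemma oscillation_of_tests u (M : R) : 0 <= M -> in_Lp mu A p u ->
  (forall b, cancellative A q b -> powint mu A q b <= m `^ (1 - q) ->
     `|\int[mu]_(x in A) (u x * b x)| <= M) ->
  powint mu A p (fun x => u x - mean A u) <= (8 * M) `^ p * m.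
Proof.
move=> M0 lu test.
have iu : integ A u by exact: in_Lp_integrable p0 q0 pq _ _ mA muA_lty lu.
apply: (powint_le_of_tests p0 q0 pq mA muA m0 (M := 8 * M) _ _ _).2.
- by rewrite mulr_ge0.
- by apply: measurable_funB => //; exact: lu.1.
- move=> g c mg gc _ gm.
  have lg : in_Lp mu A q g by exact: (@in_Lp_bounded _ _ _ _ _ _ c).
  have ig := in_Lp_integrable_conj lg.
  have iug := in_Lp_mul p0 q0 pq mA lu lg.
  have e : \int[mu]_(x in A) ((u x - mean A u) * g x) =
      \int[mu]_(x in A) (u x * center A g x).
    transitivity (\int[mu]_(x in A) (u x * g x - mean A u * g x)).
      by apply: eq_Rintegral => x _; rewrite mulrBl.
    transitivity (\int[mu]_(x in A) (u x * g x - mean A g * u x)); last first.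
      by apply: eq_Rintegral => x /set_mem Ax; rewrite center_in// mulrBr (mulrC (mean A g)).
    rewrite !RintegralB//; try exact: Rintegrable_mull.
    by rewrite !RintegralZl// /mean; congr (_ - _); ring.
  rewrite e (le_trans (ler_norm _))// mulrC.
  apply: (@cancellative_scaled_bound (fun b => \int[mu]_(x in A) (u x * b x))) => //.
  + move=> k b [lb _ _]; have iub := in_Lp_mul p0 q0 pq mA lu lb.
    by rewrite -RintegralZl//; apply: eq_Rintegral => x _; rewrite mulrCA.
  + exact: center_cancellative.
  + rewrite -[8]mulr1; apply: powint_center => //.
    by rewrite powR1 mul1r.
Qed.

End cancellative_functions.

(** Composing [L] with [center] extends it explicitly, with no appeal to Hahn-Banach, to L^q(A) with
    bound [M * 8]; the representation of the extension restricts well because [center] fixes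
    cancellative functions. *)
Lemma cancellative_representation d (T : measurableType d) (R : realType)
    (mu : {sigma_finite_measure set T -> \bar R}) (p q : R) (A : set T) (m : R)
    (L : (T -> R) -> R) (M : R) :
  0 < p -> 0 < q -> p^-1 + q^-1 = 1 -> measurable A -> mu A = m%:E -> 0 < m -> 0 <= M ->
  (forall c b b', cancellative mu A q b -> cancellative mu A q b' ->
     L (fun x => c * b x + b' x) = c * L b + L b') ->
  (forall b, cancellative mu A q b -> powint mu A q b <= m `^ (1 - q) -> `|L b| <= M) ->
  exists h, in_Lp mu A p h /\
    forall b, cancellative mu A q b -> L b = \int[mu]_(x in A) (h x * b x).
Proof.
move=> p0 q0 pq mA muA m0 M0 Llin LM.
have c0 : cancellative mu A q (cst 0) by exact: (cancellative0 q0 mA muA).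
have L0 : L (cst 0) = 0.
  have := Llin 1 _ _ c0 c0; rewrite mul1r.
  rewrite (_ : (fun x => _) = cst 0); last by apply/funext => x; rewrite /= mulr0 addr0.
  by move/eqP; rewrite eq_sym -subr_eq0 addrK => /eqP.
have LZ c b : cancellative mu A q b -> L (fun x => c * b x) = c * L b.
  move=> cb; have := Llin c _ _ cb c0; rewrite L0 addr0 => <-.
  by congr L; apply/funext => x; rewrite addr0.
have [|||h [lh hL]] := @Lq_riesz_representation _ _ _ mu p q p0 q0 pq A m (M * 8) mA muA m0 _
  (fun g => L (center mu A g)).
- by rewrite mulr_ge0.
- move=> c f g lf lg; rewrite (center_linear mA);
    try exact: (in_Lp_integrable_conj p0 q0 pq mA muA).
  by rewrite Llin//; exact: (center_cancellative p0 q0 pq mA muA m0).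
- move=> s g s0 lg gs; rewrite -mulrA.
  apply: (cancellative_scaled_bound p0 q0 pq mA muA) => //.
  + by rewrite mulr_gt0.
  + exact: (center_cancellative p0 q0 pq mA muA m0).
  + exact: (powint_center p0 q0 pq mA muA m0).
exists h; split => // b cb; rewrite -hL; first by rewrite (center_id cb).
by case: cb.
Qed.

(** * Essential unions *)

Section essential_union.
Context d (T : measurableType d) (R : realType).
Implicit Types (F : set (set T)) (E B : set T) (S : nat -> set T).

(** Empty terms are allowed so that an empty family has sequences too, and so that a merged sequence
    may be padded at indices that code no pair. *)
Definition sequence_in F S : Prop := forall n, F (S n) \/ S n = set0.

Definition merge_sequences (S_ : nat -> nat -> set T) (k : nat) : set T :=
  if @unpickle (nat * nat)%type k is Some ij then S_ ij.1 ij.2 else set0.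

Lemma merge_sequences_in F (S_ : nat -> nat -> set T) : (forall i, sequence_in F (S_ i)) ->
  sequence_in F (merge_sequences S_).
Proof.
move=> FS k; rewrite /merge_sequences; case: unpickle => [[i j]|]; last by right.
exact: FS.
Qed.

Lemma sub_merge_sequences (S_ : nat -> nat -> set T) i :
  \bigcup_n S_ i n `<=` \bigcup_k merge_sequences S_ k.
Proof.
move=> x [n _ Sx]; exists (pickle (i, n)) => //.
by rewrite /merge_sequences pickleK.
Qed.

Lemma measurable_sequence_in F S : (forall B, F B -> measurable B) ->
  sequence_in F S -> measurable (\bigcup_n S n).
Proof.
move=> mF FS; apply: bigcupT_measurable => n.
by case: (FS n) => [/mF//|->].
Qed.

(** Exhaustion: among countable unions from F take one that covers the most of E. The supremum is
    attained by merging near-optimal sequences, and a maximal union misses only a null part of each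
    member. *)
Lemma essential_union_finite (mu : {measure set T -> \bar R}) F E :
  (forall B, F B -> measurable B) -> measurable E -> (mu E < +oo)%E ->
  exists2 S, sequence_in F S &
    forall B, F B -> mu (E `&` (B `\` \bigcup_n S n)) = 0%E.
Proof.
move=> mF mE muE.
pose val S : R := fine (mu (E `&` \bigcup_n S n)).
have fin G : measurable G -> (mu (E `&` G) \is a fin_num).
  move=> mG; rewrite ge0_fin_numE//; apply: le_lt_trans muE.
  by apply: le_measure; rewrite ?inE//; exact: measurableI.
have mono G H : measurable G -> measurable H -> G `<=` H ->
    fine (mu (E `&` G)) <= fine (mu (E `&` H)).
  move=> mG mH GH; rewrite fine_le ?fin//.
  by apply: le_measure; rewrite ?inE//; [exact: measurableI..|exact: setIS].
pose V := [set x | exists2 S, sequence_in F S & x = val S].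
have hV : has_sup V.
  split; first by exists (val (fun=> set0)), (fun=> set0) => // n; right.
  exists (fine (mu E)) => _ [S FS ->]; rewrite /val -[in leRHS](setIT E).
  by apply: mono => //; exact: measurable_sequence_in FS.
have app k : exists S, sequence_in F S /\ sup V - k.+1%:R^-1 < val S.
  have k0 : 0 < k.+1%:R^-1 :> R by rewrite invr_gt0 ltr0n.
  have [_ [S FS ->] h] := sup_adherent k0 hV.
  by exists S.
have [S_ S_P] := choice app.
pose S := merge_sequences S_.
have FS : sequence_in F S by apply: merge_sequences_in => i; have [] := S_P i.
have mU : measurable (\bigcup_n S n) by exact: measurable_sequence_in FS.
have valS : val S = sup V.
  apply/eqP; rewrite eq_le; apply/andP; split.
    by apply: ub_le_sup; [exact: hV.2 | exists S].
  apply/ler_addgt0Pr => e e0.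
  have [k ke] : exists k : nat, k.+1%:R^-1 < e.
    have [k _ h] := near_infty_natSinv_lt (PosNum e0).
    by exists k; apply: (h k) => /=.
  have [Fk hk] := S_P k.
  have : val (S_ k) <= val S.
    apply: mono => //; first exact: measurable_sequence_in Fk.
    exact: sub_merge_sequences.
  move: hk; rewrite ltrBlDr => hk h; apply: (le_trans (ltW hk)).
  by apply: lerD => //; exact: ltW.
exists S => // B FB.
have mB := mF _ FB.
(* Putting B in front of S gives a competitor, so by maximality what B adds inside E has measure
   zero. *)
pose S' k := if k is n.+1 then S n else B.
have FS' : sequence_in F S' by case => [|n]; [left|exact: FS].
have US' : \bigcup_n S' n = \bigcup_n S n `|` (B `\` \bigcup_n S n).
  apply/seteqP; split => x.
    case=> -[|n] _ /= Bx; last by left; exists n.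
    by have [?|?] := pselect ((\bigcup_n S n) x); [left|right].
  by case=> [[n _ Sx]|[Bx _]]; [exists n.+1 | exists 0%N].
have mD : measurable (B `\` \bigcup_n S n) by exact: measurableD.
have : val S' <= val S by rewrite valS; apply: ub_le_sup; [exact: hV.2 | exists S'].
have mED : measurable (E `&` (B `\` \bigcup_n S n)) by exact: measurableI.
have mES : measurable (E `&` \bigcup_n S n) by exact: measurableI.
rewrite /val US' setIUr measureU//; last first.
  by apply/seteqP; split => // x [[_ Ux] [_ [_]]].
rewrite fineD ?fin// gerDl => h.
have := measure_ge0 mu (E `&` (B `\` \bigcup_n S n)).
rewrite -[X in (0 <= X)%E](fineK (fin _ mD)) lee_fin => h'.
rewrite -(fineK (fin _ mD)); congr (_%:E); apply/eqP.
by rewrite eq_le h h'.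
Qed.

Lemma essential_union (mu : {sigma_finite_measure set T -> \bar R}) F :
  (forall B, F B -> measurable B) ->
  exists2 S, sequence_in F S &
    forall B, F B -> mu (B `\` \bigcup_n S n) = 0%E.
Proof.
move=> mF; have [G GT mG] := sigma_finiteT mu.
have app i : exists S, sequence_in F S /\
    forall B, F B -> mu (G i `&` (B `\` \bigcup_n S n)) = 0%E.
  by have [S FS SP] := essential_union_finite mF (mG i).1 (mG i).2; exists S.
have [S_ S_P] := choice app.
have FS : sequence_in F (merge_sequences S_).
  by apply: merge_sequences_in => i; have [] := S_P i.
exists (merge_sequences S_) => // B FB.
have mU : measurable (\bigcup_k merge_sequences S_ k) by exact: measurable_sequence_in FS.
have mB := mF _ FB.
have mD : measurable (B `\` \bigcup_k merge_sequences S_ k) by exact: measurableD.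
apply/(negligibleP mu mD); rewrite -[X in _.-negligible X]setTI GT setI_bigcupl.
apply: negligible_bigcup => i.
have mUi : measurable (\bigcup_n S_ i n) by exact: measurable_sequence_in (S_P i).1.
have mDi : measurable (G i `&` (B `\` \bigcup_n S_ i n)).
  by apply: measurableI; [exact: (mG i).1 | exact: measurableD].
apply: (@negligibleS _ _ _ _ (G i `&` (B `\` \bigcup_n S_ i n))).
  by apply: setIS; apply: setDS; exact: sub_merge_sequences.
by apply/negligibleP => //; exact: (S_P i).2.
Qed.

End essential_union.

(** * Gluing local densities *)

Section almost_everywhere.
Context d (T : measurableType d) (R : realType) (mu : {measure set T -> \bar R}).
Local Notation integ A f := (mu.-integrable A (fun x => (f x)%:E)).
Implicit Types (A B : set T) (f g b : T -> R).

Lemma integrable_ae_eq A f g : measurable A -> measurable_fun setT f ->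
  {ae mu, forall x, A x -> f x = g x} -> integ A g -> integ A f.
Proof.
move=> mA mf fg /integrableP[mg ig]; apply/integrableP.
have mf' : measurable_fun A (fun x => (f x)%:E).
  by apply/measurable_EFinP; exact: measurable_funTS.
split => //; rewrite (@ae_eq_integral _ _ _ mu A (fun x => `|(g x)%:E|%E))//.
- exact: measurableT_comp.
- exact: measurableT_comp.
- by apply: filterS fg => x fg Ax; rewrite fg.
Qed.

Lemma Rintegral_ae_eq A f g : measurable A -> measurable_fun setT f -> measurable_fun setT g ->
  {ae mu, forall x, A x -> f x = g x} -> \int[mu]_(x in A) f x = \int[mu]_(x in A) g x.
Proof.
move=> mA mf mg fg; congr fine; apply: ae_eq_integral => //.
- by apply/measurable_EFinP; exact: measurable_funTS.
- by apply/measurable_EFinP; exact: measurable_funTS.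
- by apply: filterS fg => x fg Ax; rewrite fg.
Qed.

Lemma in_Lp_ae_eq A r f g : measurable A -> measurable_fun setT f ->
  {ae mu, forall x, A x -> f x = g x} -> in_Lp mu A r g -> in_Lp mu A r f.
Proof.
move=> mA mf fg [mg ig]; split => //; apply: integrable_ae_eq ig => //.
  exact: measurable_norm_powR.
by apply: filterS fg => x fg Ax; rewrite fg.
Qed.

Lemma powint_eq0 A r f : measurable A -> 0 < r -> in_Lp mu A r f -> powint mu A r f <= 0 ->
  {ae mu, forall x, A x -> f x = 0}.
Proof.
move=> mA r0 [mf i_f] f0.
have mfr : measurable_fun A (fun x => (`|f x| `^ r)%:E).
  by apply/measurable_EFinP/measurable_funTS/measurable_norm_powR.
have /(ae_eq_integral_abs mu mA mfr) h : (\int[mu]_(x in A) `|(`|f x| `^ r)%:E| = 0)%E.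
  under eq_integral do rewrite gee0_abs ?lee_fin ?powR_ge0//.
  rewrite -[LHS]fineK; last exact: integrable_fin_num.
  by congr (_%:E); apply/eqP; rewrite eq_le f0 powint_ge0.
apply: filterS h => x h Ax; have /eqP := h Ax.
by rewrite /= eqe powR_eq0 normr_eq0 => /andP[/eqP].
Qed.

Lemma Rintegral_support A B f : measurable A -> measurable B -> A `<=` B ->
  (forall x, ~ A x -> f x = 0) -> \int[mu]_(x in B) f x = \int[mu]_(x in A) f x.
Proof.
move=> mA mB AB f0; have BA : B `&` A = A by apply/setIidr.
rewrite -[in RHS]BA Rintegral_mkcondr.
apply: eq_Rintegral => x _; rewrite patchE; case: (boolP (x \in A)) => // /negP xA.
by rewrite f0// => Ax; apply: xA; exact: mem_set.
Qed.

Lemma integrable_support A B f : measurable A -> measurable B -> A `<=` B ->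
  (forall x, ~ A x -> f x = 0) -> integ A f -> integ B f.
Proof.
move=> mA mB AB f0 i_f.
have h := (integrable_mkcond (fun x => (f x)%:E) mA).1 i_f.
apply: (integrableS measurableT) => //; apply: eq_integrable h => // x _.
rewrite patchE; case: (boolP (x \in A)) => // /negP xA.
by rewrite f0// => Ax; apply: xA; exact: mem_set.
Qed.

Lemma cancellative_sub A B q b : measurable A -> measurable B -> A `<=` B -> 0 < q ->
  cancellative mu A q b -> cancellative mu B q b.
Proof.
move=> mA mB AB q0 [[mb ib] b0 i0]; split.
- split => //; apply: integrable_support ib => // x Ax.
  by rewrite b0// normr0 powR0// gt_eqF.
- by move=> x Bx; apply: b0 => Ax; apply: Bx; exact: AB.
- by rewrite (@Rintegral_support A).
Qed.

Context (p q : R) (p0 : 0 < p) (q0 : 0 < q) (pq : p^-1 + q^-1 = 1).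

(** The case M = 0 of [oscillation_of_tests]: the oscillation of u vanishes. *)
Lemma annihilator_cancellative A (m : R) u : measurable A -> mu A = m%:E -> 0 < m ->
  in_Lp mu A p u ->
  (forall b, cancellative mu A q b -> \int[mu]_(x in A) (u x * b x) = 0) ->
  {ae mu, forall x, A x -> u x = mean mu A u}.
Proof.
move=> mA muA m0 lu u0.
have lum : in_Lp mu A p (fun x => u x - mean mu A u).
  by apply: in_LpB => //; exact: (in_Lp_cst mA muA).
have h : powint mu A p (fun x => u x - mean mu A u) <= (8 * 0) `^ p * m.
  by apply: (oscillation_of_tests p0 q0 pq mA muA m0) => // b cb _; rewrite u0// normr0.
rewrite mulr0 powR0 ?gt_eqF// mul0r in h.
apply: filterS (powint_eq0 mA p0 lum h) => x h' Ax.
by apply/eqP; rewrite -subr_eq0 h'.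
Qed.

End almost_everywhere.

Section gluing.
Context d (T : measurableType d) (R : realType)
  (mu : {sigma_finite_measure set T -> \bar R}).
Context (p q : R) (p0 : 0 < p) (q0 : 0 < q) (pq : p^-1 + q^-1 = 1).
Context (F : set (set T)).
Hypothesis F_sets : forall A, F A -> [/\ measurable A, (0 < mu A)%E & (mu A < +oo)%E].
Hypothesis F_nested : forall A B, F A -> F B -> A `&` B !=set0 ->
  A `<=` B \/ B `<=` A.
Context (h : set T -> T -> R).
Hypothesis h_measurable : forall A, measurable_fun setT (h A).
Hypothesis h_Lp : forall A, F A -> in_Lp mu A p (h A).
Hypothesis h_compatible : forall A B b, F A -> F B -> A `<=` B -> cancellative mu A q b ->
  \int[mu]_(x in A) (h A x * b x) = \int[mu]_(x in B) (h B x * b x).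

Let F_measurable A : F A -> measurable A. Proof. by case/F_sets. Qed.

Let F_fine A : F A -> mu A = (fine (mu A))%:E.
Proof. by case/F_sets => mA A0 Aoo; rewrite fineK// ge0_fin_numE. Qed.

Let F_gt0 A : F A -> 0 < fine (mu A).
Proof. by case/F_sets => mA A0 Aoo; rewrite fine_gt0// A0. Qed.

Let F_integrable A B f : F A -> F B -> A `<=` B -> in_Lp mu B p f ->
  mu.-integrable A (fun x => (f x)%:E).
Proof.
move=> FA FB AB lf; apply: (in_Lp_integrable p0 q0 pq) => //.
- exact: F_measurable.
- by have [] := F_sets FA.
- by apply: in_Lp_sub lf => //; exact: F_measurable.
Qed.

Let connected A B := exists C, [/\ F C, A `<=` C & B `<=` C].

Let class A := [set B | F B /\ connected A B].

(** If C contains A' and D, then C meets B', so by nestedness one of C and B' contains the other;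
    the larger one contains both B' and D. *)
Let class_eq A B : F A -> F B -> A `&` B !=set0 -> class A = class B.
Proof.
have sub A' B' : F A' -> F B' -> A' `&` B' !=set0 -> class A' `<=` class B'.
  move=> FA FB AB D [FD [C [FC AC DC]]]; split => //.
  have BC : B' `&` C !=set0 by case: AB => x [Ax Bx]; exists x; split => //; exact: AC.
  case: (F_nested FB FC BC) => [BsC|CsB]; first by exists C.
  by exists B'; split => //; exact: subset_trans CsB.
by move=> FA FB AB; apply/seteqP; split; apply: sub => //; rewrite setIC.
Qed.

(** The choice depends on A only through its class, so sets of one class receive literally the same
    normalizing set. *)
Let base A := xget set0 (class A).

Let baseP A : F A -> F (base A) /\ connected A (base A).
Proof. move=> FA; have clA : class A A by split => //; exists A; split.
exact: (@xgetI _ set0 (class A) A clA). Qed.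

(** The base set need not lie in A, and [h A] carries no information outside A; the density of a
    member containing both can be averaged over the base and used on A. *)
Let hull A := xget set0 [set C | [/\ F C, A `<=` C & base A `<=` C]].

Let hullP A : F A -> [/\ F (hull A), A `<=` hull A & base A `<=` hull A].
Proof. move=> FA; have [_ ex] := baseP FA.
exact: (@xgetPex _ set0 [set C | [/\ F C, A `<=` C & base A `<=` C]] ex). Qed.

(* The local densities are determined up to constants; normalizing by the average
   over a set chosen once per class makes them agree on overlaps. *)
Let phi A x := h (hull A) x - mean mu (base A) (h (hull A)).

Let h_diff_constant A B : F A -> F B -> A `<=` B ->
  {ae mu, forall x, A x -> h A x - h B x = mean mu A (fun y => h A y - h B y)}.
Proof.
move=> FA FB AB; have mA := F_measurable FA; have mB := F_measurable FB.
have lhB : in_Lp mu A p (h B) by apply: in_Lp_sub (h_Lp FB).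
apply: (annihilator_cancellative p0 q0 pq (F_measurable FA) (F_fine FA) (F_gt0 FA)).
  by apply: in_LpB => //; exact: h_Lp.
move=> b cb; have [lb b0 _] := cb.
under eq_Rintegral do rewrite mulrBl.
rewrite RintegralB//; [|exact: (in_Lp_mul p0 q0 pq mA (h_Lp FA) lb)|exact: (in_Lp_mul p0 q0 pq mA lhB lb)].
apply/eqP; rewrite subr_eq0 (h_compatible FA FB AB cb); apply/eqP.
by apply: Rintegral_support => // x Ax; rewrite b0// mulr0.
Qed.

(** The two densities differ on A by a constant, and averaging over D identifies it as the
    difference of their means. *)
Let h_normalized_eq A B D : F A -> F B -> F D -> A `<=` B -> D `<=` A ->
  {ae mu, forall x, A x -> h A x - mean mu D (h A) = h B x - mean mu D (h B)}.
Proof.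
move=> FA FB FD AB DA; have ae1 := h_diff_constant FA FB AB.
set c := mean mu A _ in ae1.
have mD := F_measurable FD.
have iA : mu.-integrable D (fun x => (h A x)%:E) by apply: (F_integrable FD FA) => //; exact: h_Lp.
have iB : mu.-integrable D (fun x => (h B x)%:E).
  by apply: (F_integrable FD FB (subset_trans DA AB)); exact: h_Lp.
have : mean mu D (h A) - mean mu D (h B) = c.
  rewrite /mean -mulrBl -RintegralB//.
  rewrite (@Rintegral_ae_eq _ _ _ mu D _ (cst c))//.
  - by rewrite (Rintegral_cst mu mD c) mulfK// gt_eqF// F_gt0.
  - exact: measurable_funB.
  - by apply: filterS ae1 => x e Dx; apply: e; exact: DA.
move=> ec; apply: filterS ae1 => x e Ax; move: (e Ax); rewrite -ec => e'.
apply/eqP; rewrite subr_eq; apply/eqP; rewrite -(subrK (h B x) (h A x)) e'; ring.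
Qed.

(** When A and B meet, so do their hulls, which are then comparable and both contain the common
    base: the densities of the hulls, normalized over that base, agree on the smaller hull. *)
Let phi_overlap A B : F A -> F B -> {ae mu, forall x, A x -> B x -> phi A x = phi B x}.
Proof.
move=> FA FB; have [AB|AB] := pselect (A `&` B !=set0); last first.
  by apply: aeW => x Ax Bx; exfalso; apply: AB; exists x.
have eb : base A = base B by rewrite /base (class_eq FA FB AB).
have [FCA ACA bCA] := hullP FA; have [FCB BCB bCB] := hullP FB.
have [FD _] := baseP FA.
have CC : hull A `&` hull B !=set0.
  by case: AB => x [Ax Bx]; exists x; split; [exact: ACA|exact: BCB].
case: (F_nested FCA FCB CC) => CS.
- apply: filterS (h_normalized_eq FCA FCB FD CS bCA) => x e Ax Bx.
  by rewrite /phi -eb; apply: e; exact: ACA.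
- rewrite -eb in bCB.
  apply: filterS (h_normalized_eq FCB FCA FD CS bCB) => x e Ax Bx.
  by rewrite /phi -eb -e//; exact: BCB.
Qed.

Lemma glue_densities : exists2 f, measurable_fun setT f &
  forall A, F A -> in_Lp mu A p f /\
    forall b, cancellative mu A q b ->
      \int[mu]_(x in A) (f x * b x) = \int[mu]_(x in A) (h A x * b x).
Proof.
have [S FS SP] := essential_union mu F_measurable.
have mS n : measurable (S n) by case: (FS n) => [/F_measurable//|->].
have mphi A : measurable_fun setT (phi A) by exact: measurable_funB.
have mD n : measurable (seqDU S n).
  by apply: measurableD => //; apply: bigsetU_measurable => i _.
(* The pieces [seqDU S i] are disjoint, so at each point at most one term is nonzero and the partial
   sums are eventually constant. An absent [S i = set0] has an empty piece. *)
pose f_ n x := \sum_(0 <= i < n) \1_(seqDU S i) x * phi (S i) x.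
have mf_ n : measurable_fun setT (f_ n).
  apply: measurable_sum => i; apply: measurable_funM => //.
have f_D x k n : seqDU S k x -> (k < n)%N -> f_ n x = phi (S k) x.
  move=> Dx kn; rewrite /f_ (bigD1_seq k) ?mem_index_iota ?iota_uniq//=.
  rewrite indicE mem_set// mul1r big1 ?addr0// => i ik.
  rewrite indicE memNset ?mul0r// => Dix.
  by move/eqP: ik; apply; apply: (trivIset_seqDU S) => //; exists x.
have f_nD x n : ~ (\bigcup_k S k) x -> f_ n x = 0.
  move=> Ux; rewrite /f_ big1// => i _; rewrite indicE memNset ?mul0r//.
  by case=> Six _; apply: Ux; exists i.
have cf x : exists l : R, f_ n x @[n --> \oo] --> l.
  have [|Ux] := pselect ((\bigcup_k S k) x).
    rewrite seqDU_bigcup_eq => -[k _ Dx]; exists (phi (S k) x).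
    apply: cvg_near_cst; near=> n; apply: f_D => //; near: n; exact: nbhs_infty_gt.
  by exists 0; apply: cvg_near_cst; near=> n; exact: f_nD.
have [f fP] := choice cf.
have mf : measurable_fun setT f by apply: (measurable_fun_cvg mf_) => x _; exact: fP.
have fD x k : seqDU S k x -> f x = phi (S k) x.
  move=> Dx; apply: (cvg_unique _ (fP x)) => //.
  apply: cvg_near_cst; near=> n; apply: f_D => //; near: n; exact: nbhs_infty_gt.
exists f => // A FA.
have mA := F_measurable FA.
(* Two exceptional sets are discarded: a countable union of null sets from the overlaps of A with
   the [S n], and the part of A that the [S n] miss. *)
have fphi : {ae mu, forall x, A x -> f x = phi A x}.
  have ae1 : {ae mu, forall x, forall n, F (S n) -> S n x -> A x -> phi (S n) x = phi A x}.
    apply: ae_foralln => n; have [FSn|FSn] := pselect (F (S n)); last by exact: aeW.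
    by apply: filterS (phi_overlap FSn FA) => x.
  have ae2 : {ae mu, forall x, A x -> (\bigcup_n S n) x}.
    exists (A `\` \bigcup_n S n); split; [|exact: SP|].
      by apply: measurableD => //; exact: bigcupT_measurable.
    by move=> x /= /not_implyP.
  apply: filterS2 ae1 ae2 => x e1 e2 Ax.
  have := e2 Ax; rewrite seqDU_bigcup_eq => -[k _ Dx].
  rewrite (fD _ _ Dx); have Skx : S k x by case: Dx.
  by apply: e1 => //; case: (FS k) => // Sk0; rewrite Sk0 in Skx.
have [FC AC bC] := hullP FA; have mC := F_measurable FC.
have lhC : in_Lp mu A p (h (hull A)) by apply: in_Lp_sub (h_Lp FC).
have lphi : in_Lp mu A p (phi A).
  by apply: in_LpB => //; apply: (in_Lp_cst mA (F_fine FA)).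
split; first exact: in_Lp_ae_eq fphi lphi.
move=> b cb; have [lb b0 ib] := cb.
have mb := lb.1.
have intb : mu.-integrable A (fun x => (b x)%:E).
  by apply: (in_Lp_integrable_conj p0 q0 pq mA (F_fine FA)).
(* The normalizing constant disappears against b, whose mean is zero. *)
rewrite (@Rintegral_ae_eq _ _ _ mu A _ (fun x => h (hull A) x * b x -
    mean mu (base A) (h (hull A)) * b x)); first last.
- by apply: filterS fphi => x e Ax; rewrite e// /phi mulrBl.
- by apply: measurable_funB; apply: measurable_funM.
- exact: measurable_funM.
- by [].
rewrite RintegralB//; [|exact: (in_Lp_mul p0 q0 pq mA lhC lb)|exact: Rintegrable_mull].
rewrite RintegralZl// ib mulr0 subr0 (h_compatible FA FC AC cb).
by apply/esym/Rintegral_support => // x Ax; rewrite b0// mulr0.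
Unshelve. all: by end_near.
Qed.

End gluing.

(** * Truncations and Tannery's theorem *)

Section truncation.
Context {R : realType}.
Implicit Types (x y : R) (n : nat).

Definition trunc n x : R := Num.max (- n%:R) (Num.min n%:R x).

Lemma trunc_le n x : `|trunc n x| <= n%:R.
Proof.
have n0 : 0 <= n%:R :> R by [].
rewrite /trunc ler_norml le_max lexx/= ge_max ge_min lexx/= andbT.
by rewrite (le_trans _ n0)// oppr_le0.
Qed.

Lemma trunc_lip n x y : `|trunc n x - trunc n y| <= `|x - y|.
Proof.
have spec z : [\/ n%:R <= z /\ trunc n z = n%:R, z <= - n%:R /\ trunc n z = - n%:R
    | [/\ - n%:R <= z, z <= n%:R & trunc n z = z]].
  have n0 : 0 <= n%:R :> R by [].
  rewrite /trunc; case: (leP n%:R z) => nz.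
    by apply: Or31; split => //; apply/max_idPr; rewrite (le_trans _ n0)// oppr_le0.
  case: (leP (- n%:R) z) => nz'; last by apply: Or32; split=> //; exact: ltW.
  by apply: Or33; split => //; exact: ltW.
have h1 := ler_norm (x - y); have h2 := ler_norm (y - x); rewrite distrC in h2.
have n0 : 0 <= n%:R :> R by [].
move: (n%:R) n0 (trunc n x) (trunc n y) (spec x) (spec y) => N N0 tx ty.
move: `|x - y| h1 h2 => r h1 h2.
rewrite ler_norml => -[[? ->]|[? ->]|[? ? ->]] [[? ->]|[? ->]|[? ? ->]]; lra.
Qed.

Lemma trunc0 n : trunc n 0 = 0.
Proof.
have n0 : 0 <= n%:R :> R by [].
by rewrite /trunc (min_idPr n0); apply/max_idPr; rewrite oppr_le0.
Qed.

Lemma trunc_le_norm n x : `|trunc n x| <= `|x|.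
Proof. by have := trunc_lip n x 0; rewrite trunc0 !subr0. Qed.

Lemma trunc_id n x : `|x| <= n%:R -> trunc n x = x.
Proof.
rewrite ler_norml => /andP[nx xn]; rewrite /trunc (min_idPr xn).
by apply/max_idPr.
Qed.

Lemma cvg_trunc x : trunc n x @[n --> \oo] --> x.
Proof.
apply: cvg_near_cst; near=> n; apply: trunc_id; near: n; exact: nbhs_infty_ger.
Unshelve. all: by end_near.
Qed.

Lemma measurable_trunc d (T : measurableType d) n (f : T -> R) :
  measurable_fun setT f -> measurable_fun setT (fun x : T => trunc n (f x)).
Proof.
by move=> mf; apply: measurable_maxr => //; exact: measurable_minr.
Qed.

End truncation.

Section tannery.
Context {R : realType}.

(** The tails of all the series, and of the limit series, are at most the tail of [series w]: one N
    serves every n, and below N only finitely many terms have to converge. Two tails and the finite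
    part cost e / 4 each. *)
Lemma tannery (alpha : nat -> nat -> R) (a c w : nat -> R) :
  (forall n, series (alpha n) @ \oo --> a n) -> (forall n k, `|alpha n k| <= w k) ->
  (forall k, alpha n k @[n --> \oo] --> c k) -> cvgn (series w) ->
  a n @[n --> \oo] --> limn (series c) /\ series c @ \oo --> limn (series c).
Proof.
move=> ha hw hc cw.
have c_le k : `|c k| <= w k.
  apply: (@cvgr_to_le _ \oo _ _ (fun n => `|alpha n k|)); last exact: nearW.
  by apply: cvg_norm; exact: hc.
have cc : cvgn (series c).
  apply: normed_cvg; apply: (series_le_cvg _ _ c_le cw) => [k|k]//.
  exact: le_trans (c_le k).
have tail (beta : nat -> R) b N : (forall k, `|beta k| <= w k) -> series beta @ \oo --> b ->
    `|b - series beta N| <= limn (series w) - series w N.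
  move=> bw hb; apply: (@cvgr_to_le _ \oo _ _ (fun M => `|series beta M - series beta N|)).
    by apply: cvg_norm; apply: cvgB => //; exact: cvg_cst.
  near=> M; have NM : (N <= M)%N by near: M; exact: nbhs_infty_ge.
  rewrite sub_series NM (le_trans (ler_norm_sum _ _ _))//.
  apply: (@le_trans _ _ (\sum_(N <= k < M) w k)); first exact: ler_sum.
  have -> : \sum_(N <= k < M) w k = series w M - series w N by rewrite sub_series NM.
  rewrite lerD2r; apply: (nondecreasing_cvgn_le _ cw).
  apply: nondecreasing_series => k _ _; exact: le_trans (bw k).
split => //; apply/cvgrPdist_le => e e0.
have e40 : 0 < e / 4 by rewrite divr_gt0.
have [N _ hN] : \forall N \near \oo, limn (series w) - series w N <= e / 4.
  have /cvgrPdist_le /(_ _ e40) := cw; apply: filterS => N.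
  by rewrite ler_norml => /andP[].
have {}hN := hN N (leqnn N).
have : (series (alpha n) N) @[n --> \oo] --> series c N.
  elim: N {hN} => [|N IH]; first by rewrite /series/= big_geq//; under eq_fun do rewrite big_geq//; exact: cvg_cst.
  rewrite seriesSr; under eq_fun do rewrite seriesSr.
  by apply: cvgD; [exact: IH | exact: hc].
move/cvgrPdist_le => /(_ _ e40); apply: filterS => n hn.
have h1 := tail _ _ N (hw n) (ha n).
have h2 := tail _ _ N c_le cc.
set A := limn (series c) in h2 *; set s := series c N in hn h2.
set t := series (alpha n) N in hn h1.
have -> : A - a n = (A - s) + (s - t) - (a n - t) by ring.
apply: (le_trans (ler_normB _ _)).
have := ler_normD (A - s) (s - t); lra.
Unshelve. all: by end_near.
Qed.

End tannery.

(** * Truncations of one function tested against one mean-zero function *)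

Section truncated_tests.
Context d (T : measurableType d) (R : realType) (mu : {measure set T -> \bar R}).
Local Notation integ A f := (mu.-integrable A (fun x => (f x)%:E)).
Implicit Types (A : set T) (f u b : T -> R).

Lemma ae_support_restrict A f : {ae mu, forall x, ~ A x -> f x = 0} ->
  {ae mu, forall x, setT x -> f x = (f \_ A) x}.
Proof.
apply: filterS => x f0 _; rewrite patchE; case: (boolP (x \in A)) => // /negP xA.
by rewrite f0// => Ax; apply: xA; exact: mem_set.
Qed.

Lemma Rintegral_ae_support A f : measurable A -> measurable_fun setT f ->
  {ae mu, forall x, ~ A x -> f x = 0} -> \int[mu]_x f x = \int[mu]_(x in A) f x.
Proof.
move=> mA mf f0; rewrite [RHS]Rintegral_mkcond; apply: Rintegral_ae_eq => //.
  by apply/(measurable_restrictT f mA); exact: measurable_funTS.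
exact: ae_support_restrict.
Qed.

Lemma integrable_ae_support A f : measurable A -> measurable_fun setT f ->
  {ae mu, forall x, ~ A x -> f x = 0} -> integ A f -> integ setT f.
Proof.
move=> mA mf f0 i_f; apply: (integrable_ae_eq _ _ (ae_support_restrict f0)) => //.
have := (integrable_mkcond (fun x => (f x)%:E) mA).1 i_f.
by apply: eq_integrable => // x _; rewrite !patchE; case: ifP.
Qed.

Context (p q : R) (p0 : 0 < p) (q0 : 0 < q) (pq : p^-1 + q^-1 = 1).
Context (A : set T) (m D : R) (mA : measurable A) (muA : mu A = m%:E) (m0 : 0 < m) (D0 : 0 < D).
Context (u b : T -> R).
Hypothesis u_Lp : in_Lp mu A p u.
Hypothesis u_osc : powint mu A p (fun x => u x - mean mu A u) <= D `^ p * m.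
Hypothesis b_Lp : in_Lp mu A q b.
Hypothesis b_supp : {ae mu, forall x, ~ A x -> b x = 0}.
Hypothesis b_int0 : \int[mu]_x b x = 0.
Hypothesis b_norm : powint mu A q b <= m `^ (1 - q).

Let mu_ := u_Lp.1.
Let mb := b_Lp.1.

Let b_int0A : \int[mu]_(x in A) b x = 0.
Proof. by rewrite -Rintegral_ae_support. Qed.

Lemma test_integrable : integ setT (fun x => u x * b x).
Proof.
apply: (@integrable_ae_support A) => //; first exact: measurable_funM.
  by apply: filterS b_supp => x b0 Ax; rewrite b0// mulr0.
exact: (in_Lp_mul p0 q0 pq mA).
Qed.

Let trunc_supp n : {ae mu, forall x, ~ A x -> trunc n (u x) * b x = 0}.
Proof. by apply: filterS b_supp => x b0 Ax; rewrite b0// mulr0. Qed.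

Let trunc_Lp n : in_Lp mu A p (fun x => trunc n (u x)).
Proof.
apply: in_Lp_le u_Lp => //; first exact: measurable_trunc.
by move=> x _; exact: trunc_le_norm.
Qed.

(** As b has mean zero, a constant may be subtracted: not the mean of the truncation but the
    truncation of the mean c, because truncation is 1-Lipschitz and this leaves a difference
    dominated by |u - c|, whatever n. *)
Lemma truncated_test_bound n : `|\int[mu]_x (trunc n (u x) * b x)| <= 2 * D.
Proof.
have mtu := measurable_trunc n mu_.
rewrite (@Rintegral_ae_support A)//; last exact: measurable_funM.
pose c := mean mu A u.
have lc r : 0 < r -> in_Lp mu A r (cst c) by move=> r0; exact: (in_Lp_cst mA muA).
have luc : in_Lp mu A p (fun x => u x - c) by apply: in_LpB => //; exact: lc.
have ltc : in_Lp mu A p (fun x => trunc n (u x) - trunc n c).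
  by apply: in_LpB => //; exact: (in_Lp_cst mA muA).
have ib : integ A b by exact: (in_Lp_integrable_conj p0 q0 pq mA muA).
have itb : integ A (fun x => trunc n (u x) * b x) by exact: (in_Lp_mul p0 q0 pq mA).
have itcb := in_Lp_mul p0 q0 pq mA ltc b_Lp.
have iucb := in_Lp_mul p0 q0 pq mA luc b_Lp.
have -> : \int[mu]_(x in A) (trunc n (u x) * b x) =
    \int[mu]_(x in A) ((trunc n (u x) - trunc n c) * b x).
  under [RHS]eq_Rintegral do rewrite mulrBl.
  rewrite RintegralB//; last exact: Rintegrable_mull.
  by rewrite RintegralZl// b_int0A mulr0 subr0.
apply: (le_trans (le_normr_Rintegral mA itcb)).
apply: (le_trans _ (hoelder_normalized p0 q0 pq mA D0 m0 luc b_Lp u_osc b_norm)).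
apply: le_Rintegral => //; [exact: Rintegrable_norm..|].
by move=> x _; rewrite !normrM ler_wpM2r// trunc_lip.
Qed.

Lemma truncated_test_cvg :
  \int[mu]_x (trunc n (u x) * b x) @[n --> \oo] --> \int[mu]_x (u x * b x).
Proof.
have [||||||//] := @Rintegral_dominated_convergence _ _ _ mu setT
  (fun n x => trunc n (u x) * b x) (fun x => u x * b x) (fun x => `|u x * b x|).
- by [].
- by move=> n; apply: measurable_funM => //; exact: measurable_trunc.
- exact: measurable_funM.
- by move=> x _; apply: cvgM; [exact: cvg_trunc | exact: cvg_cst].
- exact: (Rintegrable_norm test_integrable).
- by move=> n x _; rewrite !normrM ler_wpM2r// trunc_le_norm.
Qed.

End truncated_tests.

(** * Complex-valued functions *)

Section complex_parts.
Context {R : realType}.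
Local Notation C := R[i].
Local Notation normc := Normc.normc.
Implicit Types (z w : C).

(** Indexing by a boolean lets both parts be treated by one proof; a product exchanges [k] and
    [~~ k], as in [partM]. *)
Definition part (k : bool) z : R := if k then complex.Im z else complex.Re z.

Lemma partD k z w : part k (z + w) = part k z + part k w.
Proof. by case: k z w => -[a b] [c e]. Qed.

Lemma partN k z : part k (- z) = - part k z.
Proof. by case: k z => -[a b]. Qed.

Lemma partB k z w : part k (z - w) = part k z - part k w.
Proof. by rewrite partD partN. Qed.

Lemma part0 k : part k 0 = 0. Proof. by case: k. Qed.

Lemma part_sum k (I : Type) (r : seq I) (P : pred I) (F : I -> C) :
  part k (\sum_(i <- r | P i) F i) = \sum_(i <- r | P i) part k (F i).
Proof. by apply: (big_morph _ (partD k) (part0 k)). Qed.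

Lemma ReM z w : complex.Re (z * w) = complex.Re z * complex.Re w - complex.Im z * complex.Im w.
Proof. by case: z w => a b [c e]. Qed.

Lemma ImM z w : complex.Im (z * w) = complex.Re z * complex.Im w + complex.Im z * complex.Re w.
Proof. by case: z w => a b [c e]. Qed.

Lemma partM k z w : part k (z * w) =
  complex.Re z * part k w + (if k then 1 else -1) * complex.Im z * part (~~ k) w.
Proof. by case: k; rewrite /part/= ?ReM ?ImM; ring. Qed.

Lemma complex_eq z w : (forall k, part k z = part k w) -> z = w.
Proof. by case: z w => a b [c e] h; have := h false; have /= := h true => -> ->. Qed.

Lemma normc_ge0 z : 0 <= normc z.
Proof. by case: z => a b; exact: sqrtr_ge0. Qed.

Lemma part_le_normc k z : `|part k z| <= normc z.
Proof.
case: z => a b; rewrite /= -sqrtr_sqr.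
by case: k; rewrite ler_wsqrtr//= ?lerDr ?lerDl sqr_ge0.
Qed.

Lemma normc_le_parts z : normc z <= `|complex.Re z| + `|complex.Im z|.
Proof.
case: z => a b /=; rewrite -[leRHS]ger0_norm ?addr_ge0// -[leRHS]sqrtr_sqr.
rewrite ler_wsqrtr// sqrrD !real_normK ?num_real// [leRHS]addrAC lerDl.
by rewrite mulrn_wge0// mulr_ge0.
Qed.

Lemma normc_triangle z w : normc (z + w) <= normc z + normc w.
Proof. exact: le_normcD. Qed.

Lemma normc_sum (I : Type) (r : seq I) (P : pred I) (F : I -> C) :
  normc (\sum_(i <- r | P i) F i) <= \sum_(i <- r | P i) normc (F i).
Proof.
elim/big_rec2: _ => [|i y z _ h]; first by rewrite Normc.normc0.
by apply: (le_trans (normc_triangle _ _)); rewrite lerD2l.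
Qed.

Lemma measurable_normc d (T : measurableType d) (h : T -> C) :
  (forall k, measurable_fun setT (fun x => part k (h x))) ->
  measurable_fun setT (fun x => normc (h x)).
Proof.
move=> mh.
have -> : (fun x => normc (h x)) =
    (fun x => Num.sqrt (part false (h x) ^+ 2 + part true (h x) ^+ 2)).
  by apply/funext => x; case: (h x).
apply: (@measurableT_comp _ _ _ _ _ _ (@Num.sqrt R)).
  exact: continuous_measurable_fun (@sqrt_continuous R).
by apply: measurable_funD; apply: measurable_funX.
Qed.

(** Translates the normalized means in [atom] and in the BMO norm into root-free bounds. For
    infinite I both sides are false. *)
Lemma powmean_le (r m s : R) (I : \bar R) : 0 < r -> 0 < m -> 0 <= s -> (0 <= I)%E ->
  (((m^-1)%:E * I) `^ r^-1 <= s%:E)%E <-> (I <= (s `^ r * m)%:E)%E.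
Proof.
move=> r0 m0 s0; case: I => [x| |] // x0.
- rewrite -EFinM poweR_EFin !lee_fin -ler_pdivrMr// mulrC.
  rewrite lee_fin in x0.
  have x0' : 0 <= x / m by rewrite divr_ge0// ltW.
  split => h.
    have : ((x / m) `^ r^-1) `^ r <= s `^ r.
      by apply: ge0_ler_powR; rewrite ?nnegrE ?powR_ge0// ltW.
    by rewrite -powRrM mulVf ?gt_eqF// powRr1.
  have : (x / m) `^ r^-1 <= (s `^ r) `^ r^-1.
    by apply: ge0_ler_powR; rewrite ?nnegrE ?powR_ge0 ?invr_ge0// ltW.
  by rewrite -[in leRHS]powRrM divff ?gt_eqF// powRr1.
- by rewrite gt0_muley ?lte_fin ?invr_gt0// poweRyr ?invr_eq0 ?gt_eqF.
Qed.

End complex_parts.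

Section complex_powers.
Context {R : realType} {d : measure_display} {T : measurableType d}.
Context (mu : {measure set T -> \bar R}).
Local Notation C := R[i].
Local Notation normc := Normc.normc.
Context (A : set T) (r : R) (h : T -> C) (mA : measurable A) (r0 : 0 < r).
Hypothesis mh : forall k, measurable_fun setT (fun x => part k (h x)).

Let mn : measurable_fun A (fun x => (normc (h x) `^ r)%:E).
Proof.
apply/measurable_EFinP/measurable_funTS.
apply: (@measurableT_comp _ _ _ _ _ _ (fun y : R => y `^ r)); first exact: measurable_powR.
exact: measurable_normc.
Qed.

Lemma part_in_Lp k (c : R) : (\int[mu]_(x in A) (normc (h x) `^ r)%:E <= c%:E)%E ->
  in_Lp mu A r (fun x => part k (h x)) /\ powint mu A r (fun x => part k (h x)) <= c.
Proof.
move=> hc.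
have mp : measurable_fun A (fun x => (`|part k (h x)| `^ r)%:E).
  by apply/measurable_EFinP/measurable_funTS/measurable_norm_powR.
have le : (\int[mu]_(x in A) (`|part k (h x)| `^ r)%:E <= c%:E)%E.
  apply: le_trans hc; apply: ge0_le_integral => //.
  - move=> x _; rewrite lee_fin; apply: ge0_ler_powR; rewrite ?nnegrE ?(ltW r0) ?normc_ge0//.
    exact: part_le_normc.
have lp : in_Lp mu A r (fun x => part k (h x)).
  split=> //; apply/integrableP; split => //.
  under eq_integral do rewrite gee0_abs ?lee_fin ?powR_ge0//.
  exact: le_lt_trans le (ltry _).
by split => //; rewrite -lee_fin /powint /Rintegral fineK//; exact: integrable_fin_num lp.2.
Qed.

Lemma normc_powint_le (c : R) : (forall k, in_Lp mu A r (fun x => part k (h x))) ->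
  (forall k, powint mu A r (fun x => part k (h x)) <= c) ->
  (\int[mu]_(x in A) (normc (h x) `^ r)%:E <= (2 `^ r * (2 * c))%:E)%E.
Proof.
move=> lp pc.
pose g x := 2 `^ r * (`|part false (h x)| `^ r + `|part true (h x)| `^ r).
have i1 := (lp false).2; have i2 := (lp true).2.
have ig : mu.-integrable A (fun x => (g x)%:E).
  by apply: Rintegrable_mull => //; exact: Rintegrable_add.
apply: (@le_trans _ _ (\int[mu]_(x in A) (g x)%:E)%E).
  apply: ge0_le_integral => //.
  - by move=> x _; rewrite lee_fin powR_ge0.
  - exact: (measurable_int mu).
  - move=> x _; rewrite lee_fin /g -[`|part false _|]normr_id -[`|part true _|]normr_id.
    apply: le_trans (powR_norm_add _ _ r0).
    apply: ge0_ler_powR; rewrite ?nnegrE ?(ltW r0) ?normc_ge0//.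
    by rewrite (le_trans (normc_le_parts _))// ler_norm.
rewrite -[leLHS]fineK; last exact: integrable_fin_num.
rewrite lee_fin -/(Rintegral mu A g) /g RintegralZl// ?RintegralD//; last exact: Rintegrable_add.
rewrite ler_wpM2l ?powR_ge0// mulr2n mulrDl mul1r.
by apply: lerD; [exact: (pc false) | exact: (pc true)].
Qed.

End complex_powers.

Section complex_integrals.
Context {R : realType} {d : measure_display} {X : metricMeasurableType d R}.
Context (mu : {measure set X -> \bar R}).
Local Notation C := R[i].
Local Notation normc := Normc.normc.
Local Notation integ A f := (mu.-integrable A (fun x => (f x)%:E)).
Implicit Types (f g h : X -> C) (A : set X) (c : C).

Lemma L1P f : L1 mu f <-> forall k, integ setT (fun x => part k (f x)).
Proof. by split=> [[? ?] []|h] //; split; [exact: (h false) | exact: (h true)]. Qed.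

Lemma L1_measurable f : L1 mu f -> forall k, measurable_fun setT (fun x => part k (f x)).
Proof. by move=> /L1P h k; apply/measurable_EFinP; exact: (measurable_int mu (h k)). Qed.

Lemma part_cintegral k A f : part k (cintegral mu A f) = \int[mu]_(x in A) part k (f x).
Proof. by case: k. Qed.

Lemma L1_lin c f g : L1 mu f -> L1 mu g -> L1 mu (fun x => c * f x + g x).
Proof.
move=> /L1P hf /L1P hg; apply/L1P => k.
under eq_fun do rewrite partD partM.
apply: Rintegrable_add => //; apply: Rintegrable_add => //; exact: Rintegrable_mull.
Qed.

Lemma cintegral_lin c f g : L1 mu f -> L1 mu g ->
  cintegral mu setT (fun x => c * f x + g x) =
  c * cintegral mu setT f + cintegral mu setT g.
Proof.
move=> /L1P hf /L1P hg; apply: complex_eq => k.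
rewrite partD partM !part_cintegral.
under eq_Rintegral do rewrite partD partM.
have h1 j a : integ setT (fun x => a * part j (f x)) by exact: Rintegrable_mull.
have i1 := h1 k (complex.Re c); have i2 := h1 (~~ k) ((if k then 1 else -1) * complex.Im c).
rewrite (RintegralD measurableT (Rintegrable_add measurableT i1 i2) (hg k)).
by rewrite (RintegralD measurableT i1 i2) !(RintegralZl _ measurableT (hf _)).
Qed.

Lemma L1_0 : L1 mu (fun=> 0).
Proof.
by apply/L1P => k; under eq_fun do rewrite part0; exact: integrable0.
Qed.

Lemma cintegral0 : cintegral mu setT (fun=> 0) = 0.
Proof.
apply: complex_eq => k; rewrite part_cintegral part0.
by rewrite /Rintegral integral0.
Qed.

Lemma part_cintegral_le k f : L1 mu f ->
  (`|part k (cintegral mu setT f)|%:E <= L1_norm mu f)%E.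
Proof.
move=> lf; have := lf => /L1P /(_ k) i_f; rewrite part_cintegral.
rewrite (EFin_normr_Rintegral measurableT i_f).
apply: (le_trans (le_abse_integral mu measurableT (measurable_int mu i_f))).
apply: ge0_le_integral => //.
- by apply: measurableT_comp => //; exact: (measurable_int mu i_f).
- by apply/measurable_EFinP/measurable_normc; exact: L1_measurable.
- by move=> x _; rewrite lee_fin part_le_normc.
Qed.

Lemma part_average k A f : measurable A -> part k (average mu A f) = mean mu A (fun x => part k (f x)).
Proof.
move=> mA; rewrite /average /mean -(part_cintegral k A f).
set z := cintegral _ _ _; set a := fine _.
have -> : (real_complex R a)^-1 = real_complex R a^-1 by rewrite fmorphV.
by rewrite mulrC partM/=; case: k; case: z => x y /=; ring.
Qed.

End complex_integrals.

(** * The pairing of BMO with atoms *)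

Section complex_limits.
Context {R : realType}.
Local Notation C := R[i].
Local Notation normc := Normc.normc.
Implicit Types (zs ws : nat -> C) (z w c : C).

Definition ccvg zs z : Prop := forall k, part k (zs n) @[n --> \oo] --> part k z.

Definition clim zs : C :=
  Complex (limn (fun n => part false (zs n))) (limn (fun n => part true (zs n))).

Lemma ccvg_clim zs z : ccvg zs z -> clim zs = z.
Proof.
by move=> h; apply: complex_eq => k; case: k; rewrite /clim /=; apply/cvg_lim => //;
  [exact: (h true) | exact: (h false)].
Qed.

Lemma ccvg_unique zs z w : ccvg zs z -> ccvg zs w -> z = w.
Proof. by move=> /ccvg_clim <- /ccvg_clim <-. Qed.

Lemma ccvg_cst z : ccvg (fun=> z) z.
Proof. by move=> k; exact: cvg_cst. Qed.

Lemma ccvg_lin c zs ws z w : ccvg zs z -> ccvg ws w ->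
  ccvg (fun n => c * zs n + ws n) (c * z + w).
Proof.
move=> hz hw k; rewrite partD partM; under eq_fun do rewrite partD partM.
by apply: cvgD; [apply: cvgD; (apply: cvgM; [exact: cvg_cst|exact: hz])|exact: hw].
Qed.

Lemma ccvg_near zs ws z : (\forall n \near \oo, zs n = ws n) -> ccvg zs z -> ccvg ws z.
Proof.
move=> zw hz k; apply: cvg_trans (hz k); apply: near_eq_cvg.
by apply: filterS zw => n ->.
Qed.

(** Only the parts are passed to the limit, and recombining them loses the factor 2. *)
Lemma ccvg_normc_le zs z (M : R) : (forall n, normc (zs n) <= M) -> ccvg zs z ->
  normc z <= 2 * M.
Proof.
move=> zM hz; apply: (le_trans (normc_le_parts z)); rewrite mulr2n mulrDl mul1r.
have h k : `|part k z| <= M.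
  apply: (@cvgr_to_le _ \oo _ _ (fun n => `|part k (zs n)|)).
    by apply: cvg_norm; exact: hz.
  by apply: nearW => n; exact: le_trans (part_le_normc k _) (zM n).
by apply: lerD; [exact: (h false) | exact: (h true)].
Qed.

(** Truncated part by part rather than radially, so that the real estimates apply to each part. *)
Definition ctrunc n z : C := Complex (trunc n (complex.Re z)) (trunc n (complex.Im z)).

Lemma part_ctrunc k n z : part k (ctrunc n z) = trunc n (part k z).
Proof. by case: k. Qed.

End complex_limits.

Section pairing.
Context {R : realType} {d : measure_display} {X : metricMeasurableType d R}.
Context (mu : {measure set X -> \bar R}).
Local Notation C := R[i].
Local Notation normc := Normc.normc.
Local Notation integ A f := (mu.-integrable A (fun x => (f x)%:E)).
Implicit Types (f g h : X -> C) (A : set X) (c : C).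

Lemma part_mul_integral k (z w : X -> C) :
  (forall j k, integ setT (fun x => part j (z x) * part k (w x))) ->
  integ setT (fun x => part k (z x * w x)) /\
  \int[mu]_x part k (z x * w x) = \int[mu]_x (part false (z x) * part k (w x)) +
    (if k then 1 else -1) * \int[mu]_x (part true (z x) * part (~~ k) (w x)).
Proof.
move=> h.
have e x : part k (z x * w x) = part false (z x) * part k (w x) +
    (if k then 1 else -1) * (part true (z x) * part (~~ k) (w x)).
  by rewrite partM mulrA.
have i1 := h false k; have i2 := h true (~~ k).
have i3 := Rintegrable_mull (if k then 1 else -1) measurableT i2.
split; first by under eq_fun do rewrite e; exact: Rintegrable_add.
under eq_Rintegral do rewrite e.
by rewrite (RintegralD measurableT i1 i3) (RintegralZl _ measurableT i2).
Qed.

(* [clim] is a junk value when there is no convergence; for [f] in BMO and [g] in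
   H^{1,q} the sequence converges. *)
Definition bmo_pairing f g : C := clim (fun n => cintegral mu setT (fun x => ctrunc n (f x) * g x)).

Context (RR : set (set X)) (p q : R) (p0 : 0 < p) (q0 : 0 < q) (pq : p^-1 + q^-1 = 1).
Hypothesis RR_sets : forall A, RR A ->
  [/\ measurable A, (0 < mu A)%E & (mu A < +oo)%E].

Lemma RR_measurable A : RR A -> measurable A.
Proof. by case/RR_sets. Qed.

Lemma RR_fine A : RR A -> mu A = (fine (mu A))%:E.
Proof. by case/RR_sets => mA A0 Aoo; rewrite fineK// ge0_fin_numE. Qed.

Lemma RR_gt0 A : RR A -> 0 < fine (mu A).
Proof. by case/RR_sets => mA A0 Aoo; rewrite fine_gt0// A0. Qed.

(** BMO norm at most D, in root-free form and for each part separately. Passing to it from the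
    complex norm costs nothing; the way back costs a factor 4. *)
Definition oscillation_bounded (D : R) f : Prop :=
  (forall k, measurable_fun setT (fun x => part k (f x))) /\
  forall A k, RR A -> in_Lp mu A p (fun x => part k (f x)) /\
    powint mu A p (fun x => part k (f x) - mean mu A (fun y => part k (f y))) <=
    D `^ p * fine (mu A).

Lemma cmeasurable_part f : cmeasurable_fun f ->
  forall k, measurable_fun setT (fun x => part k (f x)).
Proof. by move=> [h1 h2] []. Qed.

Lemma BMO_oscillation f D : 0 <= D -> Lp_loc mu RR p f -> (BMO_norm mu RR p f <= D%:E)%E ->
  oscillation_bounded D f.
Proof.
move=> D0 [mf lf] fD; split; first exact: cmeasurable_part.
move=> A k RA; have mA := RR_measurable RA.
have mf' := cmeasurable_part mf.
split.
  have lfA := lf A RA.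
  apply: (part_in_Lp (c := fine (\int[mu]_(x in A) (normc (f x) `^ p)%:E)%E) mA p0 mf' _ _).1.
  by rewrite fineK// ge0_fin_numE// integral_ge0// => x _; rewrite lee_fin powR_ge0.
have h : (\int[mu]_(x in A) (normc (f x - average mu A f) `^ p)%:E <=
    (D `^ p * fine (mu A))%:E)%E.
  apply/powmean_le => //; first exact: RR_gt0.
    by apply: integral_ge0 => x _; rewrite lee_fin powR_ge0.
  apply: le_trans fD; rewrite /BMO_norm le_max; apply/orP; right.
  by apply: ereal_sup_ubound; exists A.
have mh j : measurable_fun setT (fun x => part j (f x - average mu A f)).
  by under eq_fun do rewrite partB; exact: measurable_funB.
have [_] := part_in_Lp mA p0 mh k h.
by under eq_fun do rewrite partB part_average//.
Qed.

(** The 4: recombining the parts gives the factor 2^p times 2 on p-th powers, which is at most 4^p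
    since p >= 1. *)
Lemma oscillation_BMO f D : 0 <= D -> oscillation_bounded D f ->
  BMO mu RR p f /\ (BMO_norm mu RR p f <= (4 * D)%:E)%E.
Proof.
move=> D0 [mf lf]; have [p1 _] := conj_exponent_ge1 p0 q0 pq.
have bnd : (BMO_norm mu RR p f <= (4 * D)%:E)%E.
  rewrite /BMO_norm ge_max lee_fin mulr_ge0//=; apply: ge_ereal_sup => _ [A RA <-].
  have mA := RR_measurable RA.
  apply/powmean_le => //; [exact: RR_gt0|by rewrite mulr_ge0| |].
    by apply: integral_ge0 => x _; rewrite lee_fin powR_ge0.
  have mh j : measurable_fun setT (fun x => part j (f x - average mu A f)).
    by under eq_fun do rewrite partB; exact: measurable_funB.
  have lh j : in_Lp mu A p (fun x => part j (f x - average mu A f)).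
    under eq_fun do rewrite partB.
    apply: in_LpB => //; first exact: (lf A j RA).1.
    exact: (in_Lp_cst mA (RR_fine RA)).
  have ph j : powint mu A p (fun x => part j (f x - average mu A f)) <= D `^ p * fine (mu A).
    under eq_fun do rewrite partB part_average//.
    exact: (lf A j RA).2.
  apply: (le_trans (normc_powint_le mA p0 mh lh ph)); rewrite lee_fin.
  rewrite (_ : 4 * D = 2 * (2 * D)); last by ring.
  rewrite (powRM _ _ (mulr_ge0 _ _))// [in leRHS]powRM// -!mulrA ler_wpM2l ?powR_ge0//.
  rewrite ler_wpM2r ?mulr_ge0 ?powR_ge0 ?(ltW (RR_gt0 RA))//.
  by rewrite -{1}[2]powRr1//; apply: ler_powR => //; rewrite ler1n.
split => //; split; last exact: le_lt_trans bnd (ltry _).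
split; first by split; [exact: (mf false) | exact: (mf true)].
move=> A RA; have mA := RR_measurable RA.
pose c := Num.max (powint mu A p (fun x => part false (f x))) (powint mu A p (fun x => part true (f x))).
apply: (@le_lt_trans _ _ (2 `^ p * (2 * c))%:E); last exact: ltry.
apply: normc_powint_le => //; first by move=> k; exact: (lf A k RA).1.
by move=> k; rewrite /c le_max; case: k; rewrite lexx ?orbT.
Qed.

Lemma atomP a : atom mu RR q a -> exists A, RR A /\ forall k,
  [/\ in_Lp mu A q (fun x => part k (a x)),
      {ae mu, forall x, ~ A x -> part k (a x) = 0},
      \int[mu]_x part k (a x) = 0 &
      powint mu A q (fun x => part k (a x)) <= fine (mu A) `^ (1 - q)].
Proof.
move=> [la [ia [A [RA sa na]]]]; exists A; split => // k.
have mA := RR_measurable RA; have m0 := RR_gt0 RA.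
have ma := L1_measurable la.
have h : (\int[mu]_(x in A) (normc (a x) `^ q)%:E <= (fine (mu A) `^ (1 - q))%:E)%E.
  have -> : fine (mu A) `^ (1 - q) = (fine (mu A))^-1 `^ q * fine (mu A).
    rewrite -powR_inv1 ?(ltW m0)// -powRrM -[X in _ * X]powRr1 ?(ltW m0)// -powRD.
      by congr (_ `^ _); ring.
    by rewrite (gt_eqF m0) implybT.
  have mi0 : 0 <= (fine (mu A))^-1 by rewrite invr_ge0 ltW.
  apply/powmean_le => //.
  by apply: integral_ge0 => x _; rewrite lee_fin powR_ge0.
have [l1 l2] := part_in_Lp mA q0 ma k h; split => //.
- by move: sa; rewrite /supported_in; apply: filterS => x ax Ax; rewrite ax// part0.
- by rewrite -part_cintegral ia part0.
Qed.

Section atom_tests.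
Context (f a : X -> C) (D : R).
Hypotheses (D0 : 0 < D) (fD : oscillation_bounded D f) (ha : atom mu RR q a).

Let parts (j k : bool) : [/\ integ setT (fun x => part j (f x) * part k (a x)),
  forall n, `|\int[mu]_x (trunc n (part j (f x)) * part k (a x))| <= 2 * D &
  \int[mu]_x (trunc n (part j (f x)) * part k (a x)) @[n --> \oo] -->
  \int[mu]_x (part j (f x) * part k (a x))].
Proof.
have [A [RA /(_ k) [la sa ia na]]] := atomP ha.
have mA := RR_measurable RA.
have [lf of_] := fD.2 A j RA.
split.
- exact: (test_integrable p0 q0 pq mA lf la sa).
- exact: (truncated_test_bound p0 q0 pq mA (RR_fine RA) (RR_gt0 RA) D0 lf of_ la sa ia na).
- exact: (truncated_test_cvg p0 q0 pq mA lf la sa).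
Qed.

Let trunc_integ n (j k : bool) : integ setT (fun x => trunc n (part j (f x)) * part k (a x)).
Proof.
have [h _ _] := parts j k.
apply: (integrable_le measurableT _ _ (Rintegrable_norm h)).
  apply: measurable_funM; first exact: (measurable_trunc n (fD.1 j)).
  exact: (L1_measurable ha.1).
by move=> x _; rewrite !normrM ler_wpM2r// trunc_le_norm.
Qed.

Lemma atom_pairing_L1 : L1 mu (fun x => f x * a x).
Proof.
apply/L1P => k; apply: (part_mul_integral k _).1 => j k'.
by have [] := parts j k'.
Qed.

Let trunc_integ' n (j k : bool) :
  integ setT (fun x => part j (ctrunc n (f x)) * part k (a x)).
Proof. by under eq_fun do rewrite part_ctrunc; exact: trunc_integ. Qed.

Let part_trunc n k : part k (cintegral mu setT (fun x => ctrunc n (f x) * a x)) =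
  \int[mu]_x (trunc n (part false (f x)) * part k (a x)) +
    (if k then 1 else -1) * \int[mu]_x (trunc n (part true (f x)) * part (~~ k) (a x)).
Proof.
rewrite part_cintegral (part_mul_integral k (trunc_integ' n)).2.
by under eq_Rintegral do rewrite part_ctrunc.
Qed.

(** 8 is 2 from Hoelder's inequality, times the two real products in each part of f a, times the two
    parts. *)
Lemma atom_pairing_bound n : normc (cintegral mu setT (fun x => ctrunc n (f x) * a x)) <= 8 * D.
Proof.
have h k : `|part k (cintegral mu setT (fun x => ctrunc n (f x) * a x))| <= 4 * D.
  rewrite part_trunc (_ : 4 * D = 2 * D + 2 * D); last by ring.
  apply: (le_trans (ler_normD _ _)); apply: lerD; first by have [] := parts false k.
  rewrite normrM (_ : `|if k then 1 else -1| = 1 :> R) ?mul1r.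
    by have [] := parts true (~~ k).
  by case: k; rewrite ?normrN normr1.
apply: (le_trans (normc_le_parts _)).
have := h false; have := h true; rewrite /part; lra.
Qed.

Lemma atom_pairing_cvg : ccvg (fun n => cintegral mu setT (fun x => ctrunc n (f x) * a x))
  (cintegral mu setT (fun x => f x * a x)).
Proof.
move=> k; under eq_fun do rewrite part_trunc.
rewrite part_cintegral (part_mul_integral k _).2; last by move=> j k'; have [] := parts j k'.
apply: cvgD; first by have [] := parts false k.
by apply: cvgM; [exact: cvg_cst | have [] := parts true (~~ k)].
Qed.

Lemma atom_pairing_limit_bound : normc (cintegral mu setT (fun x => f x * a x)) <= 16 * D.
Proof.
have := ccvg_normc_le atom_pairing_bound atom_pairing_cvg.
by rewrite mulrA; congr (_ <= _ * _); ring.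
Qed.

End atom_tests.

End pairing.

(** * Atomic decompositions *)

Section real_nneseries.
Context {R : realType} (w : nat -> R) (w0 : forall k, 0 <= w k).

Lemma nneseries_le_bound (S : R) : (forall n, \sum_(0 <= k < n) w k <= S) ->
  (\sum_(0 <= k <oo) (w k)%:E <= S%:E)%E.
Proof.
move=> wS; apply: lime_le; first by apply: is_cvg_nneseries => k _ _; rewrite lee_fin.
by apply: nearW => n; rewrite sumEFin lee_fin.
Qed.

Lemma nneseries_partial_le (S : R) n : (\sum_(0 <= k <oo) (w k)%:E <= S%:E)%E ->
  \sum_(0 <= k < n) w k <= S.
Proof.
rewrite -lee_fin -sumEFin; apply: le_trans.
by apply: nneseries_lim_ge => k _ _; rewrite lee_fin.
Qed.

Lemma cvgn_series_bounded (S : R) : (forall n, \sum_(0 <= k < n) w k <= S) -> cvgn (series w).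
Proof.
move=> wS; apply: nondecreasing_is_cvgn; first exact: nondecreasing_series.
by exists S => _ [n _ <-]; exact: wS.
Qed.

End real_nneseries.

Section atomic_decompositions.
Context {R : realType} {d : measure_display} {X : metricMeasurableType d R}.
Context (mu : {measure set X -> \bar R}) (RR : set (set X)) (q : R).
Local Notation C := R[i].
Local Notation normc := Normc.normc.
Implicit Types (f g a : X -> C) (lam : nat -> C).

Lemma finite_atomic_ind (P : (X -> C) -> Prop) : P (fun=> 0) ->
  (forall c a g, atom mu RR q a -> finite_atomic mu RR q g -> P g ->
     P (fun x => c * a x + g x)) ->
  forall g, finite_atomic mu RR q g -> P g.
Proof.
move=> P0 PS g [n [lam [a [ha ->]]]].
elim: n lam a ha => [|n IH] lam a ha.
  by rewrite (_ : (fun x => _) = fun=> 0)//; apply/funext => x; rewrite big_ord0.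
rewrite (_ : (fun x => _) = fun x => lam ord0 * a ord0 x +
    \sum_(j < n) lam (lift ord0 j) * a (lift ord0 j) x); last first.
  by apply/funext => x; rewrite big_ord_recl.
apply: PS => //; last by apply: IH.
by exists n, (fun j => lam (lift ord0 j)), (fun j => a (lift ord0 j)).
Qed.

Lemma finite_atomic0 : finite_atomic mu RR q (fun=> 0).
Proof.
exists 0%N, (fun=> 0), (fun _ _ => 0); split; first by case.
by apply/funext => x; rewrite big_ord0.
Qed.

Lemma finite_atomic_add c a g : atom mu RR q a -> finite_atomic mu RR q g ->
  finite_atomic mu RR q (fun x => c * a x + g x).
Proof.
move=> ha [n [lam [b [hb ->]]]].
exists n.+1, (fun j => if unlift ord0 j is Some i then lam i else c),
  (fun j => if unlift ord0 j is Some i then b i else a); split.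
  by move=> j; case: unlift.
apply/funext => x; rewrite big_ord_recl unlift_none; congr (_ + _).
by apply: eq_bigr => i _; rewrite liftK.
Qed.

Lemma finite_atomic_atom a : atom mu RR q a -> finite_atomic mu RR q a.
Proof.
move=> ha; have := finite_atomic_add 1 ha finite_atomic0.
by rewrite (_ : (fun x => _) = a)//; apply/funext => x; rewrite mul1r addr0.
Qed.

Lemma finite_atomic_L1 g : finite_atomic mu RR q g -> L1 mu g.
Proof.
apply: finite_atomic_ind => [|c a h [la _] _ lh]; first exact: L1_0.
exact: L1_lin.
Qed.

Lemma partial_sum_finite_atomic lam (a : nat -> X -> C) n :
  (forall j, lam j != 0 -> atom mu RR q (a j)) ->
  finite_atomic mu RR q (fun x => \sum_(0 <= i < n) lam i * a i x).
Proof.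
move=> ha; elim: n => [|n IH].
  rewrite (_ : (fun x => _) = fun=> 0); first exact: finite_atomic0.
  by apply/funext => x; rewrite big_geq.
(* Where the coefficient is zero, [a n] is unconstrained and need not be an atom, so the term is
   removed. *)
have [l0|l0] := eqVneq (lam n) 0.
  rewrite (_ : (fun x => _) = fun x => \sum_(0 <= i < n) lam i * a i x)//.
  by apply/funext => x; rewrite big_nat_recr//= l0 mul0r addr0.
rewrite (_ : (fun x => _) = fun x => lam n * a n x + \sum_(0 <= i < n) lam i * a i x).
  by apply: finite_atomic_add => //; exact: ha.
by apply/funext => x; rewrite big_nat_recr//= addrC.
Qed.

Lemma atomic_decomposition_cons c b g lam (a : nat -> X -> C) : atom mu RR q b ->
  atomic_decomposition mu RR q g lam a ->
  atomic_decomposition mu RR q (fun x => c * b x + g x)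
    (fun j => if j is i.+1 then lam i else c) (fun j => if j is i.+1 then a i else b).
Proof.
move=> hb [lg ha ls cs]; split.
- by apply: L1_lin => //; case: hb.
- by case=> [//|j]; exact: ha.
- pose S := fine (\sum_(0 <= j <oo) (normc (lam j))%:E)%E.
  have sE : (\sum_(0 <= j <oo) (normc (lam j))%:E <= S%:E)%E.
    rewrite fineK// ge0_fin_numE//; apply: nneseries_ge0 => j _ _.
    by rewrite lee_fin normc_ge0.
  have n0 k : 0 <= normc (lam k) by exact: normc_ge0.
  apply: (@le_lt_trans _ _ (normc c + S)%:E); last exact: ltry.
  apply: nneseries_le_bound => [[|k]|[|n]]; rewrite ?normc_ge0//.
    rewrite big_geq// addr_ge0 ?normc_ge0//.
    by have := nneseries_partial_le n0 0 sE; rewrite big_geq.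
  rewrite big_nat_recl//= lerD2l; exact: (nneseries_partial_le n0).
- rewrite /L1_sum -(cvg_shiftS _ _); apply: cvg_trans cs; apply: near_eq_cvg; apply: nearW => n /=.
  congr (L1_norm mu _); apply/funext => x.
  by rewrite big_ord_recl/= opprD addrACA subrr add0r.
Qed.

Lemma decomposition0 : atomic_decomposition mu RR q (fun=> 0) (fun=> 0) (fun _ _ => 0).
Proof.
split.
- exact: L1_0.
- by move=> j; rewrite eqxx.
- by rewrite Normc.normc0 eseries0// ltry.
- apply: cvg_near_cst; apply: nearW => n.
  rewrite (_ : (fun x => _) = fun=> 0); last first.
    by apply/funext => x; rewrite big1 ?subrr// => i _; rewrite mul0r.
  by rewrite /L1_norm Normc.normc0 integral0.
Qed.

Lemma finite_atomic_H1 g : finite_atomic mu RR q g -> H1 mu RR q g.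
Proof.
apply: finite_atomic_ind => [|c b h hb _ [lam [a hla]]].
  by eexists; eexists; exact: decomposition0.
by eexists; eexists; apply: atomic_decomposition_cons hla.
Qed.

(** The first N coefficients are zeroed rather than the sequence shifted: from n = N on, the
    remainders coincide with those of g. *)
Lemma decomposition_tail g lam (a : nat -> X -> C) N : atomic_decomposition mu RR q g lam a ->
  atomic_decomposition mu RR q (fun x => g x - \sum_(0 <= i < N) lam i * a i x)
    (fun j => if (j < N)%N then 0 else lam j) a.
Proof.
move=> [lg ha ls cs]; have lG := finite_atomic_L1 (partial_sum_finite_atomic N ha).
split.
- rewrite (_ : (fun x => _) = fun x => -1 * (\sum_(0 <= i < N) lam i * a i x) + g x).
    exact: L1_lin.
  by apply/funext => x; rewrite mulN1r addrC.
- by move=> j; case: ltnP => _; rewrite ?eqxx//; exact: ha.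
- apply: le_lt_trans ls; apply: lee_nneseries => j _.
    by move=> _; rewrite lee_fin normc_ge0.
  by rewrite lee_fin; case: ifP => // _; rewrite Normc.normc0 normc_ge0.
- move: cs; rewrite /L1_sum; apply: cvg_trans; apply: near_eq_cvg; near=> n.
  congr (L1_norm mu _); apply/funext => x.
  have Nn : (N <= n)%N by near: n; exact: nbhs_infty_ge.
  rewrite -(big_mkord xpredT (fun i => lam i * a i x)).
  rewrite -(big_mkord xpredT (fun i => (if (i < N)%N then 0 else lam i) * a i x)).
  rewrite [in LHS](big_cat_nat (leq0n N) Nn)/= [X in _ = _ - X](big_cat_nat (leq0n N) Nn)/=.
  have -> : \sum_(0 <= i < N) (if (i < N)%N then 0 else lam i) * a i x = 0.
    by rewrite big_nat_cond big1// => i /andP[/andP[_ iN] _]; rewrite iN mul0r.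
  have -> : \sum_(N <= i < n) (if (i < N)%N then 0 else lam i) * a i x =
      \sum_(N <= i < n) lam i * a i x.
    by apply: eq_big_nat => i /andP[Ni _]; rewrite ltnNge Ni.
  by rewrite add0r opprD addrA.
Unshelve. all: by end_near.
Qed.

(** Density of [finite_atomic] in H^{1,q}: the remainder after N terms has norm at most the tail of
    the series of |lam j|. *)
Lemma H1_norm_tail g lam (a : nat -> X -> C) (e : R) : 0 < e ->
  atomic_decomposition mu RR q g lam a -> exists N : nat,
  (H1_norm mu RR q (fun x => g x - \sum_(0 <= i < N) lam i * a i x)%R <= e%:E)%E.
Proof.
move=> e0 hd; have [lg ha ls cs] := hd.
have n0 k : 0 <= normc (lam k) by exact: normc_ge0.
pose S := fine (\sum_(0 <= j <oo) (normc (lam j))%:E)%E.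
have sE : (\sum_(0 <= j <oo) (normc (lam j))%:E <= S%:E)%E.
  rewrite fineK// ge0_fin_numE//; apply: nneseries_ge0 => j _ _.
  by rewrite lee_fin normc_ge0.
have hS n := nneseries_partial_le n0 n sE.
have /cvgrPdist_le /(_ e e0) [N _ hN] := cvgn_series_bounded n0 hS.
have {}hN := hN N (leqnn N).
exists N; apply: ge_ereal_inf; eexists.
  by eexists; eexists; split; [exact: decomposition_tail hd|reflexivity].
apply: nneseries_le_bound => [k|n]; first exact: normc_ge0.
case: (leqP n N) => [nN|/ltnW Nn].
  rewrite big_nat_cond big1 ?ltW// => i /andP[/andP[_ ni] _].
  by rewrite (leq_trans ni nN) Normc.normc0.
rewrite (big_cat_nat (leq0n N) Nn)/= [X in X + _]big_nat_cond big1 ?add0r; last first.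
  by move=> i /andP[/andP[_ iN] _]; rewrite iN Normc.normc0.
rewrite (@eq_big_nat _ _ _ _ _ _ (fun k => normc (lam k))); last first.
  by move=> i /andP[Ni _]; rewrite ltnNge Ni.
have -> : \sum_(N <= k < n) normc (lam k) =
    series (fun k => normc (lam k)) n - series (fun k => normc (lam k)) N.
  by rewrite sub_series Nn.
apply: le_trans (hN); apply: le_trans (ler_norm _); rewrite lerD2r.
apply: (nondecreasing_cvgn_le _ (cvgn_series_bounded n0 hS)).
exact: nondecreasing_series.
Qed.

End atomic_decompositions.

(** * The pairing along atomic decompositions *)

Section pairing_decompositions.
Context {R : realType} {d : measure_display} {X : metricMeasurableType d R}.
Context (mu : {measure set X -> \bar R}).
Local Notation C := R[i].
Local Notation normc := Normc.normc.
Local Notation integ A f := (mu.-integrable A (fun x => (f x)%:E)).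
Implicit Types (f g h : X -> C) (A : set X) (c : C) (lam : nat -> C).

Lemma ctrunc_mul_L1 n f h : (forall k, measurable_fun setT (fun x => part k (f x))) ->
  L1 mu h -> L1 mu (fun x => ctrunc n (f x) * h x).
Proof.
move=> mf lh; apply/L1P => k; apply: (part_mul_integral k _).1 => j k'.
have ih := (L1P mu h).1 lh k'.
apply: (integrable_le measurableT _ _ (Rintegrable_mull n%:R measurableT (Rintegrable_norm ih))).
  rewrite (_ : (fun x => _) = fun x => trunc n (part j (f x)) * part k' (h x)); last first.
    by apply/funext => x; rewrite part_ctrunc.
  by apply: measurable_funM; [exact: measurable_trunc (mf j) | exact: (L1_measurable lh)].
by move=> x _; rewrite normrM part_ctrunc ler_wpM2r// trunc_le.
Qed.

Lemma ctrunc_mul_norm n f h : (forall k, measurable_fun setT (fun x => part k (f x))) ->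
  L1 mu h -> (L1_norm mu (fun x => ctrunc n (f x) * h x)%R <= (2 * n%:R)%:E * L1_norm mu h)%E.
Proof.
move=> mf lh; have lfh := ctrunc_mul_L1 n mf lh.
have mh : measurable_fun setT (fun x => (normc (h x))%:E).
  by apply/measurable_EFinP/measurable_normc; exact: (L1_measurable lh).
rewrite /L1_norm -ge0_integralZl//; last first.
  by move=> x _; rewrite lee_fin normc_ge0.
apply: ge0_le_integral => //.
- by move=> x _; rewrite lee_fin normc_ge0.
- by apply/measurable_EFinP/measurable_normc; exact: (L1_measurable lfh).
- exact: measurable_funeM.
- move=> x _; rewrite -EFinM lee_fin Normc.normcM ler_wpM2r ?normc_ge0//.
  apply: (le_trans (normc_le_parts _)); rewrite mulr2n mulrDl mul1r.
  by apply: lerD; exact: trunc_le.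
Qed.

Lemma partial_sum_pairing (phi : X -> C) lam (a : nat -> X -> C) N :
  (forall k, lam k != 0 -> L1 mu (fun x => phi x * a k x)) ->
  L1 mu (fun x => phi x * \sum_(0 <= k < N) lam k * a k x) /\
  cintegral mu setT (fun x => phi x * \sum_(0 <= k < N) lam k * a k x) =
  \sum_(0 <= k < N) lam k * cintegral mu setT (fun x => phi x * a k x).
Proof.
move=> ha; elim: N => [|N [IH1 IH2]].
  rewrite big_geq// (_ : (fun x => _) = fun=> 0); last first.
    by apply/funext => x; rewrite big_geq// mulr0.
  by split; [exact: L1_0 | exact: cintegral0].
rewrite big_nat_recr//=; have [l0|l0] := eqVneq (lam N) 0.
  rewrite (_ : (fun x => _) = fun x => phi x * \sum_(0 <= k < N) lam k * a k x).
    by rewrite l0 mul0r addr0.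
  by apply/funext => x; rewrite big_nat_recr//= l0 mul0r addr0.
rewrite (_ : (fun x => _) = fun x => lam N * (phi x * a N x) +
    phi x * \sum_(0 <= k < N) lam k * a k x); last first.
  by apply/funext => x; rewrite big_nat_recr//=; ring.
split; first by apply: L1_lin => //; exact: ha.
by rewrite (cintegral_lin _ (ha N l0) IH1) IH2; exact: addrC.
Qed.

Context (RR : set (set X)) (p q : R) (p0 : 0 < p) (q0 : 0 < q) (pq : p^-1 + q^-1 = 1).
Hypothesis RR_sets : forall A, RR A ->
  [/\ measurable A, (0 < mu A)%E & (mu A < +oo)%E].

(** [S] belongs to one decomposition while [bmo_pairing] refers to none, so the infimum over
    decompositions can be taken afterwards. After the limit in n the terms are at most 16 D |lam k|;
    passing to the limit of their partial sums by parts doubles this to 32. *)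
Lemma pairing_decomposition f D g lam (a : nat -> X -> C) (S : R) : 0 < D ->
  oscillation_bounded mu RR p D f -> atomic_decomposition mu RR q g lam a ->
  (forall n, \sum_(0 <= k < n) normc (lam k) <= S) ->
  [/\ ccvg (fun n => cintegral mu setT (fun x => ctrunc n (f x) * g x)) (bmo_pairing mu f g),
      ccvg (fun n => \sum_(0 <= k < n) lam k * cintegral mu setT (fun x => f x * a k x))
        (bmo_pairing mu f g) &
      normc (bmo_pairing mu f g) <= 32 * D * S].
Proof.
move=> D0 fD [lg ha ls cs] lS.
have mf := fD.1.
have n0 k : 0 <= normc (lam k) by exact: normc_ge0.
pose al n k := lam k * cintegral mu setT (fun x => ctrunc n (f x) * a k x).
pose c k := lam k * cintegral mu setT (fun x => f x * a k x).
pose w k := 8 * D * normc (lam k).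
have al_le n k : normc (al n k) <= w k.
  rewrite /al /w; have [->|l0] := eqVneq (lam k) 0.
    by rewrite mul0r Normc.normc0 mulr0.
  rewrite Normc.normcM mulrC ler_wpM2r//.
  exact: (atom_pairing_bound p0 q0 pq RR_sets D0 fD (ha k l0)).
have al_cvg k : ccvg (fun n => al n k) (c k).
  rewrite /al /c; have [->|l0] := eqVneq (lam k) 0.
    by under eq_fun do rewrite mul0r; rewrite mul0r; exact: ccvg_cst.
  have := @ccvg_lin _ (lam k) _ _ _ _
    (atom_pairing_cvg p0 q0 pq RR_sets D0 fD (ha k l0)) (@ccvg_cst R 0).
  by rewrite addr0; under eq_fun do rewrite addr0.
have cw : cvgn (series w).
  apply: (@cvgn_series_bounded _ _ _ (8 * D * S)) => [k|n].
    by rewrite /w mulr_ge0// mulr_ge0// ltW.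
  by rewrite -mulr_sumr ler_wpM2l// mulr_ge0// ltW.
have lG N : L1 mu (fun x => \sum_(0 <= k < N) lam k * a k x).
  by apply: finite_atomic_L1; apply: partial_sum_finite_atomic ha.
(* Here n is fixed: the truncation is at most 2 n in modulus, so L^1 convergence of the remainders
   [r N] passes to the integrals. Uniformity in n comes from [w] alone. *)
have series_al n : ccvg (fun N => \sum_(0 <= k < N) al n k)
    (cintegral mu setT (fun x => ctrunc n (f x) * g x)).
  have lfg := ctrunc_mul_L1 n mf lg.
  pose r N x := g x - \sum_(i < N) lam i * a i x.
  have lr N : L1 mu (r N).
    rewrite (_ : r N = fun x => -1 * (\sum_(0 <= i < N) lam i * a i x) + g x).
      exact: L1_lin.
    by apply/funext => x; rewrite /r big_mkord mulN1r addrC.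
  have e N : \sum_(0 <= k < N) al n k = cintegral mu setT (fun x => ctrunc n (f x) * g x) -
      cintegral mu setT (fun x => ctrunc n (f x) * r N x).
    have ltk k : lam k != 0 -> L1 mu (fun x => ctrunc n (f x) * a k x).
      by move=> l0; apply: ctrunc_mul_L1 => //; case: (ha k l0).
    rewrite -(partial_sum_pairing N ltk).2.
    have := cintegral_lin (-1) (ctrunc_mul_L1 n mf (lr N)) lfg.
    rewrite mulN1r addrC => <-; congr cintegral; apply/funext => x.
    by rewrite /r big_mkord; ring.
  move=> k; suff h0 : (fun N => part k (cintegral mu setT (fun x => ctrunc n (f x) * r N x))) @ \oo --> (0 : R).
    pose A := part k (cintegral mu setT (fun x => ctrunc n (f x) * g x)).
    have h1 : (fun N => A - part k (cintegral mu setT (fun x => ctrunc n (f x) * r N x))) @ \oo -->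
        A - 0 by apply: cvgB => //; exact: cvg_cst.
    rewrite subr0 in h1; apply: cvg_trans h1; apply: near_eq_cvg; apply: nearW => N.
    by rewrite e partB.
  apply/norm_cvg0P.
  have h : (fun N => (`|part k (cintegral mu setT (fun x => ctrunc n (f x) * r N x))|)%:E) @ \oo --> 0%E.
    apply: (@squeeze_cvge _ _ _ _ (fun=> 0%E) _ (fun N => ((2 * n%:R)%:E * L1_norm mu (r N))%E)).
    - apply: nearW => N; rewrite lee_fin normr_ge0/=.
      apply: (le_trans (part_cintegral_le k (ctrunc_mul_L1 n mf (lr N)))).
      exact: ctrunc_mul_norm.
    - exact: cvg_cst.
    - rewrite -[X in _ --> X](mule0 (2 * n%:R)%:E); apply: cvgeZl => //.
  by move/fine_cvgP : h => [].
have tan k := @tannery _ (fun n j => part k (al n j))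
    (fun n => part k (cintegral mu setT (fun x => ctrunc n (f x) * g x)))
    (fun j => part k (c j)) w
    (fun n => ltac:(rewrite /series; under eq_fun do rewrite -part_sum; exact: series_al))
    (fun n j => le_trans (part_le_normc k _) (al_le n j)) (fun j => al_cvg j k) cw.
pose L : C := Complex (limn (series (fun j => part false (c j)))) (limn (series (fun j => part true (c j)))).
have h1 : ccvg (fun n => cintegral mu setT (fun x => ctrunc n (f x) * g x)) L.
  by case; [exact: (tan true).1 | exact: (tan false).1].
have h2 : ccvg (fun n => \sum_(0 <= k < n) c k) L.
  by case; under eq_fun do rewrite part_sum; [exact: (tan true).2 | exact: (tan false).2].
have -> : bmo_pairing mu f g = L by exact: ccvg_clim.
split => //; rewrite (_ : 32 * D * S = 2 * (16 * D * S)); last by ring.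
apply: ccvg_normc_le h2 => n.
apply: (le_trans (normc_sum _ _ _)).
apply: (@le_trans _ _ (\sum_(0 <= k < n) 16 * D * normc (lam k))).
  apply: ler_sum => k _; rewrite /c; have [->|l0] := eqVneq (lam k) 0.
    by rewrite mul0r Normc.normc0 mulr0.
  rewrite Normc.normcM mulrC ler_wpM2r//.
  exact: (atom_pairing_limit_bound p0 q0 pq RR_sets D0 fD (ha k l0)).
by rewrite -mulr_sumr ler_wpM2l// mulr_ge0// ltW.
Qed.

End pairing_decompositions.

(** * Bounded functionals on the Hardy space *)

Section duality.
Context {R : realType} {d : measure_display} {X : metricMeasurableType d R}.
Context (mu : {measure set X -> \bar R}).
Local Notation C := R[i].
Local Notation normc := Normc.normc.
Local Notation integ A f := (mu.-integrable A (fun x => (f x)%:E)).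
Implicit Types (f g h : X -> C) (A : set X) (c : C) (lam : nat -> C).
Context (RR : set (set X)) (p q : R) (p0 : 0 < p) (q0 : 0 < q) (pq : p^-1 + q^-1 = 1).
Hypothesis RR_sets : forall A, RR A ->
  [/\ measurable A, (0 < mu A)%E & (mu A < +oo)%E].
Local Notation bmo_pairing := (bmo_pairing mu).
Local Notation H1 := (H1 mu RR q).
Local Notation H1_norm := (H1_norm mu RR q).
Local Notation H1_dual := (H1_dual mu RR q).
Local Notation atom := (atom mu RR q).
Local Notation osc := (oscillation_bounded mu RR p).

Lemma decomposition_sum g lam (a : nat -> X -> C) : atomic_decomposition mu RR q g lam a ->
  exists2 S : R, (\sum_(0 <= j <oo) (normc (lam j))%:E = S%:E)%E &
    forall n, \sum_(0 <= k < n) normc (lam k) <= S.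
Proof.
move=> [_ _ ls _]; have n0 k : 0 <= normc (lam k) by exact: normc_ge0.
have e : (\sum_(0 <= j <oo) (normc (lam j))%:E =
    (fine (\sum_(0 <= j <oo) (normc (lam j))%:E))%:E)%E.
  by rewrite fineK// ge0_fin_numE//; apply: nneseries_ge0 => j _ _; rewrite lee_fin.
exists (fine (\sum_(0 <= j <oo) (normc (lam j))%:E)%E) => // n.
by apply: nneseries_partial_le => //; rewrite -e.
Qed.

Lemma H1_L1 g : H1 g -> L1 mu g.
Proof. by move=> [lam [a []]]. Qed.

Lemma H1_norm_ge0 g : (0 <= H1_norm g)%E.
Proof.
apply/ereal_infP => _ [lam [a [_ ->]]].
by apply: nneseries_ge0 => j _ _; rewrite lee_fin normc_ge0.
Qed.

Lemma pairing_cvg f D g : 0 < D -> osc D f -> H1 g ->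
  ccvg (fun n => cintegral mu setT (fun x => ctrunc n (f x) * g x)) (bmo_pairing f g).
Proof.
move=> D0 fD [lam [a hd]]; have [S _ hS] := decomposition_sum hd.
by have [] := pairing_decomposition p0 q0 pq RR_sets D0 fD hd hS.
Qed.

Lemma pairing_bound f D g : 0 < D -> osc D f -> H1 g ->
  ((normc (bmo_pairing f g))%:E <= (32 * D)%:E * H1_norm g)%E.
Proof.
move=> D0 fD _; have D32 : 0 < 32 * D by rewrite mulr_gt0.
rewrite -lee_pdivrMl//; apply/ereal_infP => _ [lam [a [hd ->]]].
have [S -> hS] := decomposition_sum hd.
rewrite lee_pdivrMl// -EFinM lee_fin.
by have [] := pairing_decomposition p0 q0 pq RR_sets D0 fD hd hS.
Qed.

Lemma pairing_linear f D c g h : 0 < D -> osc D f -> H1 g -> H1 h ->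
  bmo_pairing f (fun x => c * g x + h x) = c * bmo_pairing f g + bmo_pairing f h.
Proof.
move=> D0 fD hg hh; apply: ccvg_clim.
have -> : (fun n => cintegral mu setT (fun x => ctrunc n (f x) * (c * g x + h x))) =
    (fun n => c * cintegral mu setT (fun x => ctrunc n (f x) * g x) +
      cintegral mu setT (fun x => ctrunc n (f x) * h x)).
  apply/funext => n; rewrite -cintegral_lin.
  - by congr cintegral; apply/funext => x; ring.
  - exact: (ctrunc_mul_L1 n fD.1 (H1_L1 hg)).
  - exact: (ctrunc_mul_L1 n fD.1 (H1_L1 hh)).
exact: (@ccvg_lin _ c _ _ _ _ (pairing_cvg D0 fD hg) (pairing_cvg D0 fD hh)).
Qed.

Lemma H1_dual_pairing f D : 0 < D -> osc D f -> H1_dual (bmo_pairing f).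
Proof.
move=> D0 fD; split; first by move=> c g h hg hh; exact: (pairing_linear c D0 fD hg hh).
by exists (32 * D) => g; exact: pairing_bound.
Qed.

Lemma atom_H1 a : atom a -> H1 a.
Proof. by move=> ha; apply: finite_atomic_H1; exact: finite_atomic_atom. Qed.

Lemma H1_0 : H1 (fun=> 0).
Proof. by apply: finite_atomic_H1; exact: finite_atomic0. Qed.

Lemma dual0 l : H1_dual l -> l (fun=> 0) = 0.
Proof.
move=> [hl _]; have := hl 1 _ _ H1_0 H1_0.
rewrite !mul1r addr0.
by move/eqP; rewrite eq_sym -subr_eq0 addrK => /eqP.
Qed.

Lemma pairing_atom f D a : 0 < D -> osc D f -> atom a ->
  bmo_pairing f a = cintegral mu setT (fun x => f x * a x).
Proof.
by move=> D0 fD ha; apply: ccvg_clim; exact: (atom_pairing_cvg p0 q0 pq RR_sets D0 fD ha).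
Qed.

Lemma pairing_represents f D : 0 < D -> osc D f -> represents mu RR q f (bmo_pairing f).
Proof.
move=> D0 fD; apply: finite_atomic_ind => [|c a g ha hg [lfg eg]].
  rewrite (dual0 (H1_dual_pairing D0 fD)).
  rewrite (_ : (fun x => _) = fun=> 0); last by apply/funext => x; rewrite mulr0.
  by split; [exact: L1_0 | rewrite cintegral0].
have lfa := atom_pairing_L1 p0 q0 pq RR_sets D0 fD ha.
rewrite (_ : (fun x => _) = fun x => c * (f x * a x) + f x * g x); last first.
  by apply/funext => x; ring.
split; first exact: L1_lin.
rewrite (pairing_linear c D0 fD (atom_H1 ha) (finite_atomic_H1 hg)) eg (pairing_atom D0 fD ha).
by rewrite cintegral_lin.
Qed.

Lemma dual_bound l : H1_dual l -> exists2 M : R, 0 <= M & forall g, H1 g ->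
  ((normc (l g))%:E <= M%:E * H1_norm g)%E.
Proof.
move=> [_ [M hM]]; exists `|M| => // g hg; apply: (le_trans (hM g hg)).
by rewrite lee_wpmul2r ?H1_norm_ge0// lee_fin ler_norm.
Qed.

Lemma dual_sub l g h : H1_dual l -> H1 h -> H1 (fun x => g x - h x) ->
  l g = l (fun x => g x - h x) + l h.
Proof.
move=> [hl _] hh hgh; have := hl 1 _ _ hgh hh; rewrite mul1r => <-.
by congr l; apply/funext => x; rewrite mul1r subrK.
Qed.

Lemma normc_eq0_le z : (forall e : R, 0 < e -> normc z <= e) -> z = 0 :> C.
Proof.
move=> h; apply: Normc.eq0_normc; apply/eqP; rewrite eq_le normc_ge0 andbT.
by apply/ler_addgt0Pr => e e0; rewrite add0r; exact: h.
Qed.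

(** The partial sums of a decomposition are finite combinations of atoms, where l and l' agree; both
    are small on the remainder. *)
Lemma H1_dual_unique l l' : H1_dual l -> H1_dual l' ->
  (forall g, finite_atomic mu RR q g -> l g = l' g) -> forall g, H1 g -> l g = l' g.
Proof.
move=> hl hl' ll' g [lam [a hd]].
have [M M0 hM] := dual_bound hl; have [M' M'0 hM'] := dual_bound hl'.
apply/eqP; rewrite -subr_eq0; apply/eqP; apply: normc_eq0_le => e e0.
have MM : 0 < M + M' + 1 by rewrite ltr_wpDl ?addr_ge0.
have e'0 : 0 < e / (M + M' + 1) by rewrite divr_gt0.
have [N hN] := H1_norm_tail e'0 hd.
pose G x := \sum_(0 <= i < N) lam i * a i x.
have fG : finite_atomic mu RR q G by apply: partial_sum_finite_atomic; case: hd.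
have hG := finite_atomic_H1 fG.
have hr : H1 (fun x => g x - G x).
  by eexists; eexists; exact: (decomposition_tail N hd).
rewrite (dual_sub hl hG hr) (dual_sub hl' hG hr) (ll' _ fG) opprD addrACA subrr addr0.
have b K m : 0 <= K -> (forall g, H1 g -> ((normc (m g))%:E <= K%:E * H1_norm g)%E) ->
    normc (m (fun x => g x - G x) : C) <= K * (e / (M + M' + 1)).
  move=> K0 hK; rewrite -lee_fin; apply: (le_trans (hK _ hr)).
  by rewrite EFinM lee_wpmul2l// lee_fin.
apply: (le_trans (normc_triangle _ _)).
rewrite (_ : normc (- _) = normc (l' (fun x => g x - G x))); last exact: normcN.
apply: (le_trans (lerD (b _ _ M0 hM) (b _ _ M'0 hM'))).
rewrite -mulrDl mulrCA ler_piMr ?(ltW e0)// ler_pdivrMr// mul1r lerDl//.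
Qed.

(** The decomposition with all coefficients zero already converges to f in L^1. Hence a bounded
    functional respects equality almost everywhere. *)
Lemma H1_null f : L1 mu f -> {ae mu, forall x, f x = 0} -> H1 f /\ (H1_norm f <= 0)%E.
Proof.
move=> lf f0.
have hd : atomic_decomposition mu RR q f (fun=> 0) (fun _ _ => 0).
  split => //.
  - by move=> j; rewrite eqxx.
  - by rewrite Normc.normc0 eseries0// ltry.
  - have e n : L1_norm mu (fun x => f x - \sum_(i < n) 0 * 0) = 0%E.
      rewrite /L1_norm -(integral0 mu setT).
      apply: ae_eq_integral => //.
        apply/measurable_EFinP/measurable_normc => k; under eq_fun do rewrite partB.
        by apply: measurable_funB => //; exact: (L1_measurable lf).
      apply: filterS f0 => x -> _; rewrite big1 ?subrr ?Normc.normc0// => i _.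
      by rewrite mul0r.
    rewrite /L1_sum; apply: cvg_near_cst; apply: nearW => n; exact: e.
split; first by eexists; eexists; exact: hd.
apply: ge_ereal_inf; eexists; first by eexists; eexists; split; [exact: hd|reflexivity].
by rewrite Normc.normc0 eseries0.
Qed.

Lemma H1_dual_ae l f g : H1_dual l -> L1 mu f -> H1 g -> {ae mu, forall x, f x = g x} ->
  l f = l g.
Proof.
move=> hl lf hg fg; have lg := H1_L1 hg.
have lfg : L1 mu (fun x => f x - g x).
  rewrite (_ : (fun x => _) = fun x => -1 * g x + f x); first exact: L1_lin.
  by apply/funext => x; rewrite mulN1r addrC.
have [hfg nfg] : H1 (fun x => f x - g x) /\ (H1_norm (fun x => f x - g x)%R <= 0)%E.
  by apply: H1_null => //; apply: filterS fg => x ->; rewrite subrr.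
rewrite (dual_sub hl hg hfg); have [M M0 hM] := dual_bound hl.
rewrite (_ : l _ = 0) ?add0r//; apply: normc_eq0_le => e e0.
rewrite -lee_fin; apply: (le_trans (hM _ hfg)).
rewrite (@le_trans _ _ 0%E)// ?lee_fin ?(ltW e0)//.
by rewrite mule_ge0_le0// lee_fin.
Qed.

Definition of_real (b : X -> R) : X -> C := fun x => Complex (b x) 0.

Lemma of_real_L1 b : integ setT b -> L1 mu (of_real b).
Proof. by move=> ib; split => //=; exact: integrable0. Qed.

Lemma cancellative_L1 A b : RR A -> cancellative mu A q b -> L1 mu (of_real b).
Proof.
move=> RA [lb b0 _]; apply: of_real_L1; have mA := RR_measurable RR_sets RA.
apply: (@integrable_support _ _ _ mu A) => //.
exact: (in_Lp_integrable_conj p0 q0 pq mA (RR_fine RR_sets RA)).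
Qed.

Lemma cancellative_atom A b : RR A -> cancellative mu A q b ->
  powint mu A q b <= fine (mu A) `^ (1 - q) -> atom (of_real b).
Proof.
move=> RA cb nb; have [lb b0 ib] := cb.
have mA := RR_measurable RR_sets RA; have m0 := RR_gt0 RR_sets RA.
split; first exact: cancellative_L1 RA cb.
split.
  apply: complex_eq => k; rewrite part_cintegral part0; case: k => /=.
    by rewrite /Rintegral integral0.
  by rewrite -ib; apply: Rintegral_support.
exists A; split => //.
  by apply: aeW => x Ax; rewrite /of_real b0.
have mi0 : 0 <= (fine (mu A))^-1 by rewrite invr_ge0 ltW.
apply/powmean_le => //.
  by apply: integral_ge0 => x _; rewrite lee_fin powR_ge0.
have -> : (fine (mu A))^-1 `^ q * fine (mu A) = fine (mu A) `^ (1 - q).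
  rewrite -powR_inv1 ?(ltW m0)// -powRrM -[X in _ * X]powRr1 ?(ltW m0)// -powRD.
    by congr (_ `^ _); ring.
  by rewrite (gt_eqF m0) implybT.
have -> : (\int[mu]_(x in A) (normc (of_real b x) `^ q)%:E = (powint mu A q b)%:E)%E.
  rewrite /powint /Rintegral fineK; last exact: integrable_fin_num lb.2.
  by apply: eq_integral => x _; rewrite /= expr0n/= addr0 sqrtr_sqr.
by rewrite lee_fin.
Qed.

Lemma cancellative_finite_atomic A b : RR A -> cancellative mu A q b ->
  finite_atomic mu RR q (of_real b).
Proof.
move=> RA cb; have [lb b0 ib] := cb.
have mA := RR_measurable RR_sets RA; have m0 := RR_gt0 RR_sets RA.
(* The first summand is the size of b relative to a normalized atom; adding 1 keeps s positive when
   b is null. *)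
pose s := (fine (mu A) `^ (q - 1) * powint mu A q b) `^ q^-1 + 1.
have s0 : 0 < s by rewrite ltr_wpDl ?powR_ge0.
have ha : atom (of_real (fun x => s^-1 * b x)).
  apply: (cancellative_atom RA); first exact: (cancellativeZ p0 q0 pq mA (RR_fine RR_sets RA)).
  rewrite powintZ// ger0_norm ?invr_ge0 ?(ltW s0)//.
  have hs : fine (mu A) `^ (q - 1) * powint mu A q b <= s `^ q.
    have i0 : 0 <= fine (mu A) `^ (q - 1) * powint mu A q b.
      by rewrite mulr_ge0 ?powR_ge0 ?powint_ge0.
    rewrite /s; move: (_ * powint _ _ _ _) i0 => I I0.
    have {1}-> : I = (I `^ q^-1) `^ q by rewrite -powRrM mulVf ?gt_eqF// powRr1.
    by apply: ge0_ler_powR; rewrite ?nnegrE ?addr_ge0 ?powR_ge0 ?(ltW q0)// lerDl.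
  rewrite -(@ler_pM2l _ (s `^ q)) ?powR_gt0// mulrA -powRM ?invr_ge0 ?(ltW s0)//.
  rewrite divff ?gt_eqF// powR1 mul1r.
  rewrite -(@ler_pM2l _ (fine (mu A) `^ (q - 1))) ?powR_gt0// (le_trans hs)//.
  rewrite mulrCA -powRD; last by rewrite (gt_eqF m0) implybT.
  by rewrite (_ : q - 1 + (1 - q) = 0) ?powRr0 ?mulr1//; ring.
have := finite_atomic_add (real_complex R s) ha (finite_atomic0 mu RR q).
rewrite (_ : (fun x => _) = of_real b)//; apply/funext => x.
apply: complex_eq => k; rewrite addr0 partM /of_real; case: k => /=; first by ring.
by rewrite !mulr0 addr0 mulrA divff ?mul1r// gt_eqF.
Qed.

Lemma H1_norm_atom a : atom a -> (H1_norm a <= 1)%E.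
Proof.
move=> ha; have hd := atomic_decomposition_cons 1 ha (decomposition0 mu RR q).
rewrite (_ : (fun x => _) = a) in hd; last by apply/funext => x; rewrite mul1r addr0.
apply: ge_ereal_inf; eexists; first by eexists; eexists; split; [exact: hd|reflexivity].
apply: nneseries_le_bound => [k|[|n]]; first exact: normc_ge0.
  by rewrite big_geq.
by rewrite big_nat_recl// [X in X + _]Normc.normc1 big1 ?addr0// => i _; rewrite Normc.normc0.
Qed.

(** 32 is 8 from [oscillation_of_tests] times 4 from [oscillation_BMO]. *)
Lemma tests_BMO f (M : R) : 0 <= M ->
  (forall k, measurable_fun setT (fun x => part k (f x))) ->
  (forall A k, RR A -> in_Lp mu A p (fun x => part k (f x))) ->
  (forall A k b, RR A -> cancellative mu A q b ->
    powint mu A q b <= fine (mu A) `^ (1 - q) ->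
    `|\int[mu]_(x in A) (part k (f x) * b x)| <= M) ->
  BMO mu RR p f /\ (BMO_norm mu RR p f <= (32 * M)%:E)%E.
Proof.
move=> M0 mf lf test.
have oscf : osc (8 * M) f.
  split => // A k RA; split; first exact: lf.
  apply: (oscillation_of_tests p0 q0 pq (RR_measurable RR_sets RA) (RR_fine RR_sets RA)
    (RR_gt0 RR_sets RA) M0 (lf A k RA)) => b cb nb.
  exact: (test A k b RA cb nb).
have := oscillation_BMO p0 q0 pq RR_sets (mulr_ge0 (ler0n _ 8) M0) oscf.
by rewrite (_ : 4 * (8 * M) = 32 * M)//; ring.
Qed.

Lemma part_cintegral_of_real f A b k : measurable A ->
  (forall x, ~ A x -> b x = 0) ->
  part k (cintegral mu setT (fun x => f x * of_real b x)) =
  \int[mu]_(x in A) (part k (f x) * b x).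
Proof.
move=> mA b0; rewrite part_cintegral -(@Rintegral_support _ _ _ mu A setT)//; last first.
  by move=> x Ax; rewrite b0// mulr0.
apply: eq_Rintegral => x _; rewrite /of_real; case: (f x) => u v.
by case: k => /=; ring.
Qed.

(** A real normalized test is itself an atom, of H^{1,q} norm at most 1, and each part of its
    pairing with f is at most the modulus. *)
Lemma BMO_norm_le_dual f D (M : R) : 0 < D -> osc D f -> 0 <= M ->
  (forall g, H1 g -> (H1_norm g <= 1)%E -> normc (bmo_pairing f g) <= M) ->
  (BMO_norm mu RR p f <= (32 * M)%:E)%E.
Proof.
move=> D0 fD M0 hM; apply: (tests_BMO M0 fD.1 (fun A k RA => (fD.2 A k RA).1) _).2.
move=> A k b RA cb nb; have ha := cancellative_atom RA cb nb.
have [_ b0 _] := cb.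
rewrite -(part_cintegral_of_real f k (RR_measurable RR_sets RA) b0) -(pairing_atom D0 fD ha).
apply: (le_trans (part_le_normc _ _)); apply: hM; first exact: atom_H1.
exact: H1_norm_atom.
Qed.

End duality.

(** * Linearity and norm equivalence *)

Section bmo_linearity.
Context {R : realType} {d : measure_display} {X : metricMeasurableType d R}.
Context (mu : {measure set X -> \bar R}).
Local Notation C := R[i].
Local Notation normc := Normc.normc.
Implicit Types (f g h : X -> C) (A : set X) (c : C).
Context (RR : set (set X)) (p q : R) (p0 : 0 < p) (q0 : 0 < q) (pq : p^-1 + q^-1 = 1).
Hypothesis RR_sets : forall A, RR A ->
  [/\ measurable A, (0 < mu A)%E & (mu A < +oo)%E].
Local Notation bmo_pairing := (bmo_pairing mu).
Local Notation H1 := (H1 mu RR q).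
Local Notation osc := (oscillation_bounded mu RR p).
Local Notation BMO_norm := (BMO_norm mu RR p).

Let real_osc A (E : R) (u : X -> R) := in_Lp mu A p u /\
  powint mu A p (fun x => u x - mean mu A u) <= E * fine (mu A).

Let integrable_in_Lp A (u : X -> R) : RR A -> in_Lp mu A p u ->
  mu.-integrable A (fun x => (u x)%:E).
Proof.
move=> RA lu; apply: (in_Lp_integrable p0 q0 pq (RR_measurable RR_sets RA)) => //.
by have [] := RR_sets RA.
Qed.

Let center_Lp A (u : X -> R) : RR A -> in_Lp mu A p u ->
  in_Lp mu A p (fun x => u x - mean mu A u).
Proof.
move=> RA lu; have mA := RR_measurable RR_sets RA.
by apply: in_LpB => //; exact: (in_Lp_cst mA (RR_fine RR_sets RA)).
Qed.

Let real_osc_lin A (E E' k : R) u v : RR A -> real_osc A E u -> real_osc A E' v ->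
  real_osc A (2 `^ p * (`|k| `^ p * E + E')) (fun x => k * u x + v x).
Proof.
move=> RA [lu ou] [lv ov]; have mA := RR_measurable RR_sets RA.
split; first by apply: in_LpD => //; exact: in_LpZ.
rewrite (mean_linear mA k (integrable_in_Lp RA lu) (integrable_in_Lp RA lv)).
rewrite (_ : (fun x => _) = fun x => k * (u x - mean mu A u) + (v x - mean mu A v)); last first.
  by apply/funext => x; ring.
have lu' := center_Lp RA lu.
apply: (le_trans (powintD mA p0 (in_LpZ k mA lu') (center_Lp RA lv))).
rewrite -mulrA ler_wpM2l ?powR_ge0// mulrDl lerD//.
by rewrite powintZ// -mulrA ler_wpM2l ?powR_ge0.
Qed.

Lemma BMO_osc f : BMO mu RR p f -> exists2 D : R, 0 < D & osc D f.
Proof.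
move=> [lf nf]; have n0 : (0 <= BMO_norm f)%E by rewrite /BMO_norm le_max lexx.
have e : BMO_norm f = (fine (BMO_norm f))%:E by rewrite fineK// ge0_fin_numE.
(* The 1 keeps D positive when the norm is zero, as the normalized Hoelder inequality divides by
   D. *)
exists (fine (BMO_norm f) + 1); first by rewrite ltr_wpDl// fine_ge0.
apply: BMO_oscillation => //; first by rewrite addr_ge0// fine_ge0.
by rewrite e lee_fin lerDl.
Qed.

(** Only the existence of a finite constant matters here. [E k] comes from applying the power
    triangle inequality twice to part k, [F] serves both parts, and the root undoes the p-th
    power. *)
Lemma osc_lin c f g D D' : 0 <= D -> 0 <= D' -> osc D f -> osc D' g ->
  exists2 D'' : R, 0 <= D'' & osc D'' (fun x => c * f x + g x).
Proof.
move=> D0 D'0 [mf hf] [mg hg].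
pose E k := 2 `^ p * (`|complex.Re c| `^ p * D `^ p + 2 `^ p *
  (`|(if k then 1 else -1) * complex.Im c| `^ p * D `^ p + D' `^ p)).
have E0 k : 0 <= E k by rewrite ?(mulr_ge0, addr_ge0, powR_ge0).
pose F := E true + E false.
have F0 : 0 <= F by rewrite addr_ge0.
have e k : (fun x => part k (c * f x + g x)) = fun x => complex.Re c * part k (f x) +
    (((if k then 1 else -1) * complex.Im c) * part (~~ k) (f x) + part k (g x)).
  by apply/funext => x; rewrite partD partM addrA.
exists (F `^ p^-1); first exact: powR_ge0.
split.
  move=> k; rewrite e; apply: measurable_funD; first exact: measurable_funM.
  by apply: measurable_funD => //; exact: measurable_funM.
move=> A k RA.
change (real_osc A ((F `^ p^-1) `^ p) (fun x => part k (c * f x + g x))); rewrite e.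
have [l o] := @real_osc_lin A (D `^ p) _ (complex.Re c) _ _ RA (hf A k RA)
  (@real_osc_lin A (D `^ p) (D' `^ p) ((if k then 1 else -1) * complex.Im c)
     _ _ RA (hf A (~~ k) RA) (hg A k RA)).
split => //; apply: (le_trans o); rewrite -powRrM mulVf ?gt_eqF// powRr1//.
rewrite ler_wpM2r ?(ltW (RR_gt0 RR_sets RA))// -/(E k) /F.
by case: k {l o}; rewrite ?lerDl ?lerDr.
Qed.

Lemma BMO_lin c f g : BMO mu RR p f -> BMO mu RR p g ->
  BMO mu RR p (fun x => c * f x + g x).
Proof.
move=> /BMO_osc [D D0 oD] /BMO_osc [D' D'0 oD'].
have [D'' D''0 o] := osc_lin c (ltW D0) (ltW D'0) oD oD'.
exact: (oscillation_BMO p0 q0 pq RR_sets D''0 o).1.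
Qed.

Lemma BMO_sub f g : BMO mu RR p f -> BMO mu RR p g -> BMO mu RR p (fun x => f x - g x).
Proof.
move=> hf hg; rewrite (_ : (fun x => _) = fun x => -1 * g x + f x); first exact: BMO_lin.
by apply/funext => x; rewrite mulN1r addrC.
Qed.

Lemma pairing_series f h lam (a : nat -> X -> C) : BMO mu RR p f ->
  atomic_decomposition mu RR q h lam a ->
  ccvg (fun n => \sum_(0 <= k < n) lam k * cintegral mu setT (fun x => f x * a k x))
    (bmo_pairing f h).
Proof.
move=> /BMO_osc [D D0 oD] hd; have [S _ hS] := decomposition_sum hd.
by have [] := pairing_decomposition p0 q0 pq RR_sets D0 oD hd hS.
Qed.

(** Truncation is not linear in f, so there is no linearity at a fixed level n; it is read off the
    series along a decomposition of h, whose terms are linear in f. *)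
Lemma pairing_linear_BMO c f g h : BMO mu RR p f -> BMO mu RR p g -> H1 h ->
  bmo_pairing (fun x => c * f x + g x) h = c * bmo_pairing f h + bmo_pairing g h.
Proof.
move=> hf hg [lam [a hd]].
apply: (ccvg_unique (pairing_series (BMO_lin c hf hg) hd)).
have /(_ c) := @ccvg_lin _ _ _ _ _ _ (pairing_series hf hd) (pairing_series hg hd).
apply: ccvg_near; apply: nearW => n.
rewrite mulr_sumr -big_split; apply: eq_bigr => k _ /=.
have [l0|l0] := eqVneq (lam k) 0; first by rewrite l0 !mul0r mulr0 addr0.
have ha : atom mu RR q (a k) by case: hd => _ + _ _; exact.
have [D D0 oD] := BMO_osc hf; have [D' D'0 oD'] := BMO_osc hg.
rewrite mulrCA -mulrDr; congr (_ * _).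
rewrite -(cintegral_lin _ (atom_pairing_L1 p0 q0 pq RR_sets D0 oD ha)
  (atom_pairing_L1 p0 q0 pq RR_sets D'0 oD' ha)).
by congr cintegral; apply/funext => x; ring.
Qed.

Lemma pairing_sub f g h : BMO mu RR p f -> BMO mu RR p g -> H1 h ->
  bmo_pairing (fun x => f x - g x) h = bmo_pairing f h - bmo_pairing g h.
Proof.
move=> hf hg hh; have := pairing_linear_BMO (-1) hg hf hh; rewrite mulN1r addrC => <-.
by congr (_ mu _ h); apply/funext => x; rewrite mulN1r addrC.
Qed.

(** Along a decomposition of h every term for f - g vanishes, because a constant integrates to zero
    against an atom. *)
Lemma pairing_constant f g h : BMO mu RR p f -> BMO mu RR p g -> eq_mod_constants mu f g ->
  H1 h -> bmo_pairing f h = bmo_pairing g h.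
Proof.
move=> hf hg [c fgc] hh; apply/eqP; rewrite -subr_eq0 -pairing_sub//; apply/eqP.
have hfg := BMO_sub hf hg; case: hh => lam [a hd].
apply: (ccvg_unique (pairing_series hfg hd)).
have := @ccvg_cst R 0; apply: ccvg_near; apply: nearW => n.
rewrite big1// => k _; have [l0|l0] := eqVneq (lam k) 0; first by rewrite l0 mul0r.
have [la [ia _]] : atom mu RR q (a k) by case: hd => _ + _ _; exact.
have lz := @L1_0 _ _ _ mu.
have := cintegral_lin c la lz; rewrite ia cintegral0 mulr0 addr0.
have [D D0 oD] := BMO_osc hfg.
suff -> : cintegral mu setT (fun x => c * a k x + 0) =
    cintegral mu setT (fun x => (f x - g x) * a k x) by move=> ->; rewrite mulr0.
apply: complex_eq => j; rewrite !part_cintegral.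
apply: Rintegral_ae_eq => //.
- exact: (L1_measurable (L1_lin c la lz)).
- apply: L1_measurable; apply: (atom_pairing_L1 p0 q0 pq RR_sets D0 oD).
  by case: hd => _ + _ _; exact.
- by apply: filterS fgc => x -> _; rewrite addr0.
Qed.

Lemma pairing_bound_BMO f g : BMO mu RR p f -> H1 g ->
  (H1_norm mu RR q g <= 1)%E -> ((normc (bmo_pairing f g))%:E <= 32%:E * BMO_norm f)%E.
Proof.
move=> [lf nf] hg g1; have n0 : (0 <= BMO_norm f)%E by rewrite /BMO_norm le_max lexx.
have e : BMO_norm f = (fine (BMO_norm f))%:E by rewrite fineK// ge0_fin_numE.
have b0 : 0 <= fine (BMO_norm f) by rewrite fine_ge0.
rewrite e -EFinM lee_fin; apply/ler_addgt0Pr => t t0.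
(* The slack makes D positive even for a function of zero norm, and becomes t after multiplication
   by 32. *)
have t32 : 0 < t / 32 by rewrite divr_gt0.
have D0 : 0 < fine (BMO_norm f) + t / 32 by rewrite ltr_wpDl.
have oD : osc (fine (BMO_norm f) + t / 32) f.
  by apply: BMO_oscillation => //; [exact: ltW | rewrite e lee_fin lerDl ltW].
have := pairing_bound p0 q0 pq RR_sets D0 oD hg.
have le : ((32 * (fine (BMO_norm f) + t / 32))%:E * H1_norm mu RR q g <=
    (32 * (fine (BMO_norm f) + t / 32))%:E)%E.
  rewrite -[leRHS]mule1; apply: lee_wpmul2l => //.
  by rewrite lee_fin mulr_ge0// ltW.
move=> /le_trans /(_ le); rewrite lee_fin mulrDr.
by rewrite (_ : 32 * (t / 32) = t)//; field.
Qed.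

Lemma dual_norm_ge0 l : H1_dual mu RR q l -> (0 <= H1_dual_norm mu RR q l)%E.
Proof.
move=> hl; have h0 := H1_0 mu RR q.
have n0 : (H1_norm mu RR q (fun=> 0%R) <= 1)%E.
  have [_ h] : H1 (fun=> 0) /\ (H1_norm mu RR q (fun=> 0%R) <= 0)%E.
    by apply: H1_null; [exact: L1_0 | exact: aeW].
  exact: le_trans h _.
apply: ereal_sup_ge; exists (normc (l (fun=> 0%R)))%:E; first by exists (fun=> 0).
by rewrite lee_fin normc_ge0.
Qed.

Lemma dual_norm_equivalent f : BMO mu RR p f ->
  ((32^-1)%:E * BMO_norm f <= H1_dual_norm mu RR q (bmo_pairing f))%E /\
  (H1_dual_norm mu RR q (bmo_pairing f) <= 32%:E * BMO_norm f)%E.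
Proof.
move=> hf; have [D D0 oD] := BMO_osc hf.
have hl := H1_dual_pairing p0 q0 pq RR_sets D0 oD.
have up : (H1_dual_norm mu RR q (bmo_pairing f) <= 32%:E * BMO_norm f)%E.
  apply: ge_ereal_sup => _ [g [hg g1] <-]; exact: pairing_bound_BMO.
split => //.
have n0 : (0 <= BMO_norm f)%E by rewrite /BMO_norm le_max lexx.
have fin : H1_dual_norm mu RR q (bmo_pairing f) \is a fin_num.
  rewrite ge0_fin_numE ?dual_norm_ge0//; apply: (le_lt_trans up).
  by rewrite lte_mul_pinfty//; case: hf.
rewrite lee_pdivrMl// -(fineK fin) -EFinM.
apply: (BMO_norm_le_dual p0 q0 pq RR_sets D0 oD); first by rewrite fine_ge0// dual_norm_ge0.
move=> g hg g1; rewrite -lee_fin fineK//.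
by apply: ereal_sup_ubound; exists g.
Qed.

(** Forwards, the pairing with f - g has bound 0 and [BMO_norm_le_dual] applies with M = 0.
    Backwards, zero norm means oscillation at most D for every D > 0, so the pairing is arbitrarily
    small. *)
Lemma pairing_eq_iff f g : BMO mu RR p f -> BMO mu RR p g ->
  (forall h, H1 h -> bmo_pairing f h = bmo_pairing g h) <-> BMO_norm (fun x => f x - g x) = 0%E.
Proof.
move=> hf hg; have hfg := BMO_sub hf hg.
have n0 : (0 <= BMO_norm (fun x => f x - g x)%R)%E by rewrite /BMO_norm le_max lexx.
split => [e|e h hh].
  have [D D0 oD] := BMO_osc hfg.
  apply/eqP; rewrite eq_le n0 andbT.
  have := BMO_norm_le_dual p0 q0 pq RR_sets D0 oD (lexx 0); rewrite mulr0; apply=> h hh _.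
  by rewrite pairing_sub// e// subrr Normc.normc0.
apply/eqP; rewrite -subr_eq0 -pairing_sub//; apply/eqP; apply: normc_eq0_le => t t0.
have [lam [a hd]] := hh; have [S _ hS] := decomposition_sum hd.
have S0 : 0 <= S by have := hS 0%N; rewrite big_geq.
have S1 : 0 < 32 * (S + 1) by rewrite mulr_gt0// ltr_wpDl.
(* With this D the bound 32 D S is at most t; the 1 allows for S = 0. *)
have D0 : 0 < t / (32 * (S + 1)) by rewrite divr_gt0.
have oD : osc (t / (32 * (S + 1))) (fun x => f x - g x).
  by apply: BMO_oscillation => //; [exact: ltW|case: hfg|rewrite e lee_fin ltW].
have [_ _ le] := pairing_decomposition p0 q0 pq RR_sets D0 oD hd hS.
apply: (le_trans le).
rewrite (_ : 32 * (t / (32 * (S + 1))) * S = t * (S / (S + 1))); last first.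
  by field; rewrite gt_eqF// ltr_wpDl.
by rewrite ler_piMr ?(ltW t0)// ler_pdivrMr ?mul1r ?lerDl// ltr_wpDl.
Qed.

End bmo_linearity.

(** * Surjectivity *)

Section surjectivity.
Context {R : realType} {d : measure_display} {X : metricMeasurableType d R}.
Context (mu : {sigma_finite_measure set X -> \bar R}).
Local Notation C := R[i].
Local Notation normc := Normc.normc.
Context (RR : set (set X)) (p q : R) (p0 : 0 < p) (q0 : 0 < q) (pq : p^-1 + q^-1 = 1).
Hypothesis RR_sets : forall A, RR A ->
  [/\ measurable A, (0 < mu A)%E & (mu A < +oo)%E].
Hypothesis RR_C : condition_C RR.
Context (l : (X -> C) -> C) (hl : H1_dual mu RR q l).

(** The two parts of [l] on real functions are real functionals; their densities become the real and
    imaginary parts of f. *)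
Let L k (b : X -> R) : R := part k (l (of_real b)).

Let of_real_H1 A b : RR A -> cancellative mu A q b -> H1 mu RR q (of_real b).
Proof.
move=> RA cb; apply: finite_atomic_H1.
exact: (cancellative_finite_atomic p0 q0 pq RR_sets RA cb).
Qed.

Let L_linear k A c b b' : RR A -> cancellative mu A q b -> cancellative mu A q b' ->
  L k (fun x => c * b x + b' x) = c * L k b + L k b'.
Proof.
move=> RA cb cb'; rewrite /L.
rewrite (_ : of_real _ = fun x => real_complex R c * of_real b x + of_real b' x); last first.
  apply/funext => x; apply: complex_eq => j; rewrite partD partM /of_real.
  by case: j => /=; ring.
rewrite (hl.1 (real_complex R c) _ _ (of_real_H1 RA cb) (of_real_H1 RA cb')).
by rewrite partD partM/= mulr0 mul0r addr0.
Qed.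

Let L_bound : exists2 M : R, 0 <= M & forall k A b, RR A -> cancellative mu A q b ->
  powint mu A q b <= fine (mu A) `^ (1 - q) -> `|L k b| <= M.
Proof.
have [M M0 hM] := dual_bound hl; exists M => // k A b RA cb nb.
have ha := cancellative_atom p0 q0 pq RR_sets RA cb nb.
apply: (le_trans (part_le_normc _ _)); rewrite -lee_fin.
apply: (le_trans (hM _ (atom_H1 ha))); rewrite -[leRHS]mule1.
by apply: lee_wpmul2l => //; exact: H1_norm_atom.
Qed.

(** Stated for every set A, with content only under [RR A], so that [choice] yields a family defined
    on all sets. *)
Let local_density k A : exists h : X -> R, measurable_fun setT h /\
  (RR A -> in_Lp mu A p h /\
    forall b, cancellative mu A q b -> L k b = \int[mu]_(x in A) (h x * b x)).
Proof.
have [RA|RA] := pselect (RR A); last by exists (cst 0); split.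
have [M M0 hM] := L_bound.
have [h [lh hL]] := @cancellative_representation _ _ _ mu p q A (fine (mu A)) (L k) M p0 q0 pq
  (RR_measurable RR_sets RA) (RR_fine RR_sets RA) (RR_gt0 RR_sets RA) M0
  (fun c b b' => @L_linear k A c b b' RA) (fun b => hM k A b RA).
by exists h; split => //; exact: lh.1.
Qed.

Let global_density k : exists2 f : X -> R, measurable_fun setT f &
  forall A, RR A -> in_Lp mu A p f /\
    forall b, cancellative mu A q b -> L k b = \int[mu]_(x in A) (f x * b x).
Proof.
have [RR' [RR'RR nested cover]] := RR_C.
have [h hP] := choice (local_density k).
have [||||f mf fP] := @glue_densities _ _ _ mu p q p0 q0 pq RR' _ nested h.
- by move=> A /RR'RR /RR_sets.
- by move=> A; have [] := hP A.
- by move=> A /RR'RR RA; have [_ /(_ RA) []] := hP A.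
- move=> A B b RA RB AB cb.
  have mA := RR_measurable RR_sets (RR'RR _ RA).
  have mB := RR_measurable RR_sets (RR'RR _ RB).
  have [_ /(_ (RR'RR _ RA)) [_ <-//]] := hP A.
  have [_ /(_ (RR'RR _ RB)) [_ <-//]] := hP B.
  exact: (@cancellative_sub _ _ _ mu A).
(* Gluing only concerns RR'. A general member lies in some A' of RR' by the second clause of
   condition (C), and its cancellative functions are cancellative on A'. *)
exists f => // A RA; have [A' RA' AA'] := cover A RA.
have mA := RR_measurable RR_sets RA.
have mA' := RR_measurable RR_sets (RR'RR _ RA').
have [lf fE] := fP A' RA'; split; first exact: (@in_Lp_sub _ _ _ mu A A').
move=> b cb; have cb' := cancellative_sub mA mA' AA' q0 cb.
have [_ /(_ (RR'RR _ RA')) [_ ->//]] := hP A'.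
rewrite -fE//; apply: Rintegral_support => // x Ax.
by case: cb => _ b0 _; rewrite b0// mulr0.
Qed.

Lemma H1_dual_surjective : exists2 f, BMO mu RR p f & forall g, H1 mu RR q g -> l g = bmo_pairing mu f g.
Proof.
have [f0 mf0 f0P] := global_density false; have [f1 mf1 f1P] := global_density true.
pose f x := Complex (f0 x) (f1 x).
have mf k : measurable_fun setT (fun x => part k (f x)) by case: k.
have lf A k : RR A -> in_Lp mu A p (fun x => part k (f x)).
  by move=> RA; case: k; [exact: (f1P A RA).1 | exact: (f0P A RA).1].
have fP A k b : RR A -> cancellative mu A q b -> L k b = \int[mu]_(x in A) (part k (f x) * b x).
  by move=> RA; case: k; [exact: (f1P A RA).2 | exact: (f0P A RA).2].
have [M M0 hM] := L_bound.
have [Bf _] : BMO mu RR p f /\ (BMO_norm mu RR p f <= (32 * M)%:E)%E.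
  apply: (tests_BMO p0 q0 pq RR_sets M0 mf lf) => A k b RA cb nb.
  by rewrite -fP//; exact: (hM k A).
exists f => //; have [D D0 oD] := BMO_osc p0 RR_sets Bf.
have he := H1_dual_pairing p0 q0 pq RR_sets D0 oD.
have on_real A b : RR A -> cancellative mu A q b -> l (of_real b) = bmo_pairing mu f (of_real b).
  move=> RA cb; have fb := cancellative_finite_atomic p0 q0 pq RR_sets RA cb.
  have [_ ->] := pairing_represents p0 q0 pq RR_sets D0 oD fb.
  have [_ b0 _] := cb; apply: complex_eq => k.
  rewrite (part_cintegral_of_real mu f k (RR_measurable RR_sets RA) b0).
  exact: fP.
apply: H1_dual_unique => //; apply: finite_atomic_ind => [|c a g ha hg IH].
  by rewrite (dual0 hl) (dual0 he).
rewrite (hl.1 c _ _ (atom_H1 ha) (finite_atomic_H1 hg)).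
rewrite (he.1 c _ _ (atom_H1 ha) (finite_atomic_H1 hg)) IH.
congr (_ * _ + _).
have [A [RA hA]] := atomP q0 RR_sets ha; have mA := RR_measurable RR_sets RA.
(* An atom vanishes outside A only almost everywhere; multiplying by the indicator gives functions
   that vanish everywhere there. *)
pose b k x := \1_A x * part k (a x).
have cb k : cancellative mu A q (b k).
  have [la sa ia _] := hA k; split.
  - apply: (in_Lp_le mA q0 _ _ la).
      by apply: measurable_funM; [exact: measurable_indic | exact: la.1].
    by move=> x Ax; rewrite /b indicE mem_set// mul1r.
  - by move=> x Ax; rewrite /b indicE memNset// mul0r.
  - rewrite -ia (Rintegral_ae_support mA la.1 sa).
    by apply: eq_Rintegral => x xA; rewrite /b indicE xA mul1r.
(* Rebuilding the atom from its real parts reduces the claim to [on_real] by complex linearity; both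
   functionals ignore the null set where a' and a differ. *)
pose a' x := Complex 0 1 * of_real (b true) x + of_real (b false) x.
have a'a : {ae mu, forall x, a' x = a x}.
  have [_ s0 _ _] := hA false; have [_ s1 _ _] := hA true.
  apply: filterS2 s0 s1 => x s0 s1; apply: complex_eq => k.
  have e : part k (a' x) = b k x.
    by rewrite /a' partD partM /of_real; case: k => /=; ring.
  rewrite e /b indicE; case: (boolP (x \in A)) => [_|/negP xA]; first by rewrite mul1r.
  have Ax : ~ A x by move=> Ax; apply: xA; exact: mem_set.
  by rewrite mul0r; case: k {e}; rewrite ?s0 ?s1.
have la' : L1 mu a'.
  by apply: L1_lin; exact: (cancellative_L1 p0 q0 pq RR_sets RA).
rewrite -(H1_dual_ae hl la' (atom_H1 ha) a'a) -(H1_dual_ae he la' (atom_H1 ha) a'a).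
have h k := of_real_H1 RA (cb k).
rewrite /a' (hl.1 (Complex 0 1) _ _ (h true) (h false)) (he.1 (Complex 0 1) _ _ (h true) (h false)).
by rewrite !(on_real A).
Qed.

End surjectivity.

Theorem theorem3p9 (R : realType) (d : measure_display)
    (X : metricMeasurableType d R) (mu : {sigma_finite_measure set X -> \bar R})
    (borel : forall U : set X, open U -> measurable U)
    (kappa0 : R) (RR : set (set X)) (p : R) :
  calderon_zygmund mu kappa0 RR -> condition_C RR -> 1 < p ->
  let p' := p / (p - 1) in
  exists ell : (X -> R[i]) -> ((X -> R[i]) -> R[i]),
    (* [ell f] is the unique bounded extension of [g |-> \int f g] *)
    (forall f, BMO mu RR p f ->
       [/\ H1_dual mu RR p' (ell f),
           represents mu RR p' f (ell f)
         & forall l, H1_dual mu RR p' l -> represents mu RR p' f l ->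
             {in H1 mu RR p', l =1 ell f}]) /\
    (* linearity *)
    (forall (c : R[i]) f g, BMO mu RR p f -> BMO mu RR p g ->
       BMO mu RR p (fun x => c * f x + g x) /\
       {in H1 mu RR p', forall h,
          ell (fun x => c * f x + g x) h = c * ell f h + ell g h}) /\
    (* [ell] factors through the quotient modulo constants ... *)
    (forall f g, BMO mu RR p f -> BMO mu RR p g ->
       eq_mod_constants mu f g -> {in H1 mu RR p', ell f =1 ell g}) /\
    (* ... its kernel is the null space of the seminorm (that is, the constants
       whenever the seminorm is a norm on the quotient) ... *)
    (forall f g, BMO mu RR p f -> BMO mu RR p g ->
       {in H1 mu RR p', ell f =1 ell g} <->
       BMO_norm mu RR p (fun x => f x - g x) = 0%E) /\
    (* ... and it is onto the dual, *)
    (forall l, H1_dual mu RR p' l ->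
       exists2 f, BMO mu RR p f & {in H1 mu RR p', l =1 ell f}) /\
    (* with equivalence of norms *)
    (exists2 K : R, 0 < K & forall f, BMO mu RR p f ->
       ((K^-1)%:E * BMO_norm mu RR p f <= H1_dual_norm mu RR p' (ell f))%E /\
       (H1_dual_norm mu RR p' (ell f) <= K%:E * BMO_norm mu RR p f)%E).
Proof.
move=> [_ RR_sets _ _] RR_C p1 p'.
have p0 : 0 < p by exact: lt_trans p1.
have q0 : 0 < p' by rewrite divr_gt0// subr_gt0.
have pq : p^-1 + p'^-1 = 1.
  by rewrite /p' invf_div; field; rewrite (gt_eqF p0).
exists (bmo_pairing mu); split.
  move=> f hf; have [D D0 oD] := BMO_osc p0 RR_sets hf.
  have he := H1_dual_pairing p0 q0 pq RR_sets D0 oD.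
  have re := pairing_represents p0 q0 pq RR_sets D0 oD.
  split => // l hl rl g /set_mem hg; apply: (H1_dual_unique hl he) => // b hb.
  by have [_ ->] := rl b hb; have [_ ->] := re b hb.
split.
  move=> c f g hf hg; split; first exact: (BMO_lin p0 q0 pq RR_sets c hf hg).
  by move=> h /set_mem hh; exact: (pairing_linear_BMO p0 q0 pq RR_sets c hf hg hh).
split.
  by move=> f g hf hg fg h /set_mem hh; exact: (pairing_constant p0 q0 pq RR_sets hf hg fg hh).
split.
  move=> f g hf hg; have [h1 h2] := pairing_eq_iff p0 q0 pq RR_sets hf hg.
  split; first by move=> e; apply: h1 => h hh; apply: e; exact: mem_set.
  by move=> e h /set_mem; exact: h2.
split.
  move=> l hl; have [f hf fl] := H1_dual_surjective p0 q0 pq RR_sets RR_C hl.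
  by exists f => // g /set_mem; exact: fl.
(* The same constant arises on both sides: above, 8 for an atom, doubled in each of two limits;
   below, 8 from centering the tests times 4 from recombining the parts. *)
by exists 32 => // f hf; exact: (dual_norm_equivalent p0 q0 pq RR_sets hf).
Qed.
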